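(* $E_\infty$ is infinite time enumerable and is $\le_c$-greatest among the infinite time enumerable equivalence relations: every infinite time enumerable equivalence relation $E$ on $\mathbb{R}$ satisfies $E\le_c E_\infty$. Likewise, $E_\infty$ is $\le_e$-greatest among the eventually enumerable equivalence relations: every eventually enumerable $E$ satisfies $E\le_e E_\infty$.
   Context: $\mathbb{R}=2^\omega$. Infinite time Turing machines: Turing machines with three binary $\omega$-tapes run in transfinite time, with a special limit state at limit stages, head reset to the first cell, cells taking the $\limsup$ of earlier values. A function $f:\mathbb{R}\to\mathbb{R}$ is infinite time computable if computed (halting) by such a machine possibly with a fixed real parameter; it is eventually computable if some program (possibly with real parameter) on each input $x$ eventually has $f(x)$ permanently on its output tape. $E\le_c F$ (resp. $E\le_e F$) means there is an infinite time computable (resp. eventually computable) $f$ with $x\,E\,x'\iff f(x)\,F\,f(x')$. A real $z$ codes the sequence $((z)_n)_{n\in\omega}$ of reals via a fixed recursive pairing. An equivalence relation $E$ on $\mathbb{R}$ is (infinite time) enumerable if there is an infinite time computable $f$ such that for every $x$, $\{(f(x))_n:n\in\omega\}=[x]_E$; eventually enumerable is defined the same way with $f$ eventually computable. $E_\infty$ is the universal countable Borel equivalence relation, e.g. the orbit equivalence relation of the shift action of the free group $F_2$ on $2^{F_2}$, transferred to $\mathbb{R}$ via a fixed recursive bijection $F_2\cong\omega$. *)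

(* Defs.v *)
From Stdlib Require Import Arith List.
Import ListNotations.

Definition real := nat -> bool.

Definition npair (n k : nat) : nat := (n + k) * (n + k + 1) / 2 + k.
Definition rpair (x y : real) : real :=
  fun n => if Nat.even n then x (Nat.div2 n) else y (Nat.div2 n).
Definition rsect (z : real) (n : nat) : real := fun k => z (npair n k).

(** States are naturals below [nstates]; 0 = start, 1 = halt, 2 = limit state.
    [trans q r1 r2 r3 = (q', w1, w2, w3, right)]: in state q reading r1 r2 r3
    on the three tapes, write w1 w2 w3, move right (true) or left (false),
    go to state q'. *)
Record program := {
  nstates : nat;
  trans : nat -> bool -> bool -> bool -> nat * bool * bool * bool * bool }.

Definition q_start := 0.
Definition q_halt := 1.
Definition q_limit := 2.

(** A program is a finite object: finitely many states, and transitions from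
    states stay among them. *)
Definition valid_program (P : program) : Prop :=
  3 <= nstates P /\
  forall q r1 r2 r3, q < nstates P ->
    fst (fst (fst (fst (trans P q r1 r2 r3)))) < nstates P.

Record config := { st : nat; head : nat; tape1 : real; tape2 : real; tape3 : real }.

Definition upd (t : real) (h : nat) (b : bool) : real :=
  fun n => if Nat.eqb n h then b else t n.

Definition step (P : program) (c : config) : config :=
  let h := head c in
  match trans P (st c) (tape1 c h) (tape2 c h) (tape3 c h) with
  | (q', w1, w2, w3, mv) =>
      {| st := q'; head := if mv then S h else pred h;
         tape1 := upd (tape1 c) h w1; tape2 := upd (tape2 c) h w2;
         tape3 := upd (tape3 c) h w3 |}
  end.

Definition init_config (x : real) : config :=
  {| st := q_start; head := 0; tape1 := x; tape2 := fun _ => false;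
     tape3 := fun _ => false |}.

(** A run of length some ordinal: a well-ordered index set of stages with the
    configuration at each stage, obeying the ITTM rules (successor steps,
    limit stages: limit state, head on cell 0, each cell the limsup). *)
Record run (P : program) (x : real) := {
  stage : Type;
  slt : stage -> stage -> Prop;
  slt_trans : forall i j k, slt i j -> slt j k -> slt i k;
  slt_total : forall i j, slt i j \/ i = j \/ slt j i;
  slt_wf : well_founded slt;
  cfg : stage -> config;
  run_init : forall i, (forall j, ~ slt j i) -> cfg i = init_config x;
  run_succ : forall i j, slt j i -> (forall k, ~ (slt j k /\ slt k i)) ->
      st (cfg j) <> q_halt /\ cfg i = step P (cfg j);
  run_limit : forall i, (exists j, slt j i) ->
      (forall j, slt j i -> exists k, slt j k /\ slt k i) ->
      st (cfg i) = q_limit /\ head (cfg i) = 0 /\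
      (forall n, (tape1 (cfg i) n = true <->
                   forall j, slt j i -> exists k, slt j k /\ slt k i /\ tape1 (cfg k) n = true) /\
                 (tape2 (cfg i) n = true <->
                   forall j, slt j i -> exists k, slt j k /\ slt k i /\ tape2 (cfg k) n = true) /\
                 (tape3 (cfg i) n = true <->
                   forall j, slt j i -> exists k, slt j k /\ slt k i /\ tape3 (cfg k) n = true))
}.

Arguments stage {P x}.
Arguments slt {P x} r _ _.
Arguments cfg {P x} r _.

Definition halts_with (P : program) (x y : real) : Prop :=
  exists (R : run P x) (i : stage R), st (cfg R i) = q_halt /\ tape3 (cfg R i) = y.

(** P on input x eventually has y permanently on its output tape: there is a
    stage a (of some run R0) such that at every stage b >= a of every run,
    the output tape holds y.  "b >= a" is expressed by an order-preserving
    map from the stages <= a of R0 into the stages <= b of R. *)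
Definition eventually_outputs (P : program) (x y : real) : Prop :=
  exists (R0 : run P x) (a : stage R0),
    forall (R : run P x) (b : stage R),
      (exists m : {i : stage R0 | slt R0 i a \/ i = a} -> stage R,
          (forall i j, slt R0 (proj1_sig i) (proj1_sig j) -> slt R (m i) (m j)) /\
          (forall i, slt R (m i) b \/ m i = b)) ->
      tape3 (cfg R b) = y.

Definition it_computable (f : real -> real) : Prop :=
  exists (P : program) (p : real), valid_program P /\
    forall x, halts_with P (rpair x p) (f x).

Definition ev_computable (f : real -> real) : Prop :=
  exists (P : program) (p : real), valid_program P /\
    forall x, eventually_outputs P (rpair x p) (f x).

Definition equivalence_rel (E : real -> real -> Prop) : Prop :=
  (forall x, E x x) /\ (forall x y, E x y -> E y x) /\
  (forall x y z, E x y -> E y z -> E x z).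

Definition reduces_c (E F : real -> real -> Prop) : Prop :=
  exists f, it_computable f /\ forall x x', E x x' <-> F (f x) (f x').
Definition reduces_e (E F : real -> real -> Prop) : Prop :=
  exists f, ev_computable f /\ forall x x', E x x' <-> F (f x) (f x').

Definition it_enumerable (E : real -> real -> Prop) : Prop :=
  exists f, it_computable f /\ forall x y, E x y <-> exists n, rsect (f x) n = y.
Definition ev_enumerable (E : real -> real -> Prop) : Prop :=
  exists f, ev_computable f /\ forall x y, E x y <-> exists n, rsect (f x) n = y.

(** Letters: (generator a/b, inverted?). Words are lists of letters;
    elements of F_2 are the reduced words. *)
Definition letter := (bool * bool)%type.
Definition linv (l : letter) : letter := (fst l, negb (snd l)).
Definition letter_eqb (l l' : letter) : bool :=
  Bool.eqb (fst l) (fst l') && Bool.eqb (snd l) (snd l').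

Fixpoint reduced (w : list letter) : Prop :=
  match w with
  | a :: ((b :: _) as t) => b <> linv a /\ reduced t
  | _ => True
  end.

Definition push (l : letter) (w : list letter) : list letter :=
  match w with
  | l' :: w' => if letter_eqb l' (linv l) then w' else l :: w
  | [] => [l]
  end.
Definition reduce (w : list letter) : list letter := fold_right push [] w.

Definition gmul (g h : list letter) : list letter := reduce (g ++ h).
Definition ginv (g : list letter) : list letter := rev (map linv g).

(** E_infinity transferred to reals via the bijection e : omega -> F_2:
    the real x represents the element n |-> ... of 2^{F_2} with value x n at e n;
    x E y iff y = g . x for some g in F_2, where (g.x)(h) = x(g^{-1} h). *)
Definition Einf (e : nat -> list letter) (x y : real) : Prop :=
  exists g, reduced g /\
    forall n m, e m = gmul (ginv g) (e n) -> y n = x m.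

Definition F2_bijection (e : nat -> list letter) : Prop :=
  (forall n, reduced (e n)) /\ (forall n m, e n = e m -> n = m) /\
  (forall w, reduced w -> exists n, e n = w).

(* Main.v *)
From Stdlib Require Import ZArith Classical ClassicalEpsilon FunctionalExtensionality.
From Stdlib Require Import PropExtensionality Relation_Operators Wellfounded Eqdep_dec.
From mathcomp Require Import all_boot zify.
Require Import Defs.

Set Implicit Arguments.
Unset Strict Implicit.
Unset Printing Implicit Defensive.

(** Let [f] enumerate the classes of [E].  Exchanging [x] with [y := (f x)_i] whenever [x = (f y)_j]
    and [x], [y] differ at a given bit is an involution, and these countably many involutions
    generate [E] (Feldman-Moore).  Let [F_2] act on [R x Z] by letting [a] shift the integer and [b]
    apply the [m]-th involution on level [m]; coloring the point [(x, m)] by a marker bit at [m = 0]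
    and by the bit [m - 1] of [x] above it, the map sending [x] to the coloring of the orbit of
    [(x, 0)] reduces [E] to the shift.

    To compute this map it suffices to run the given program for [f] on [x] and then, in parallel,
    on all members of [f x], restarting the latter whenever the approximation of [f x] changes.
    This is arranged as an iteration [s' n = 1 <-> s in U_n] on [2^omega] with limsup at limits,
    for a sequence of open sets [U_n].  One Turing machine performs such an iteration for any
    sequence of open sets, given as a parameter that lists the basic open subsets of each [U_n]:
    the list is shifted to the left in successive sweeps of length [omega], so that every entry is
    at some point aligned with [s] and can be compared with it by one walk of the head; after
    [omega ^ 2] steps all new bits are known and one more sweep installs them. *)

(** The obstacle is that an eventually computable [f] never signals that its output is final, so the
    members of [f x] cannot wait until [f x] is known; hence the parallel simulation with restarts.
    Conditions on the state have to be open because a finite row of the script tests only finitely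
    many bits. Inequality of two reals is open but equality is not, so inequalities are first stored
    as bits, and an equality is read off from such a bit being false. The parameter of the machine
    is an arbitrary real, so the script may absorb the transition table of the given program, its
    parameter and the bijection [e], none of which has to be computable. Ordinals are replaced by
    well-orders: a convergence time is an order [A], and a stage lies beyond it when [A] maps
    monotonically below that stage. *)

Definition decb (P : Prop) : bool := if excluded_middle_informative P then true else false.

Lemma decbP (P : Prop) : decb P = true <-> P.
Proof. by rewrite /decb; case: excluded_middle_informative. Qed.

Lemma bool_ext (b c : bool) : (b = true <-> c = true) -> b = c.
Proof. by case: b c => -[] [H1 H2] //; [rewrite H1|rewrite -H2]. Qed.

(** * Well-orders and recursion along them *)

Record wo := Wo {
  wcar :> Type;
  wlt : wcar -> wcar -> Prop;
  wlt_trans : forall i j k, wlt i j -> wlt j k -> wlt i k;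
  wlt_total : forall i j, wlt i j \/ i = j \/ wlt j i;
  wlt_wf : well_founded wlt }.

Notation "a <w b" := (wlt a b) (at level 70).
Notation "a <=w b" := (wlt a b \/ a = b) (at level 70).

Section WellOrder.
Variable V : wo.
Implicit Types i j k : V.

Lemma wlt_irr i : ~ i <w i.
Proof. by elim/(well_founded_ind (wlt_wf (w := V))): i => i IH H; apply: (IH i). Qed.

Lemma wle_lt_trans i j k : i <=w j -> j <w k -> i <w k.
Proof. by case=> [h|->] // h'; apply: wlt_trans h h'. Qed.

Lemma wlt_le_trans i j k : i <w j -> j <=w k -> i <w k.
Proof. by move=> h [h'|<-] //; apply: wlt_trans h h'. Qed.

Lemma wle_trans i j k : i <=w j -> j <=w k -> i <=w k.
Proof. by move=> h [h'|<-] //; left; apply: wle_lt_trans h h'. Qed.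

Lemma wlt_ge i j : i <w j -> ~ j <=w i.
Proof. by move=> h h'; apply: (@wlt_irr i); apply: wlt_le_trans h h'. Qed.

Lemma wltVge i j : i <w j \/ j <=w i.
Proof. by case: (wlt_total i j) => [|[->|]]; auto. Qed.

Lemma wnlt i j : ~ i <w j -> j <=w i.
Proof. by case: (wltVge i j). Qed.

Lemma wleast (P : V -> Prop) : (exists i, P i) -> exists i, P i /\ forall j, P j -> i <=w j.
Proof.
case=> i; elim/(well_founded_ind (wlt_wf (w := V))): i => i IH Pi.
case: (classic (exists j, j <w i /\ P j)) => [[j [h Pj]]|N]; first exact: IH h Pj.
by exists i; split=> // j Pj; apply: wnlt => h; apply: N; exists j.
Qed.

Definition wmin i := forall j, ~ j <w i.
Definition wsucc j i := j <w i /\ forall k, ~ (j <w k /\ k <w i).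
Definition wlim i := (exists j, j <w i) /\ forall j, j <w i -> exists k, j <w k /\ k <w i.

Lemma wcases i : wmin i \/ (exists j, wsucc j i) \/ wlim i.
Proof.
case: (classic (exists j, j <w i)) => [Hn|N]; last by left=> j h; apply: N; exists j.
right; case: (classic (exists j, wsucc j i)) => [|N]; first by left.
right; split=> // j h; apply: NNPP => M; apply: N; exists j; split=> // k hk.
by apply: M; exists k.
Qed.

Lemma wsucc_inj j j' i : wsucc j i -> wsucc j' i -> j = j'.
Proof.
move=> [h1 h2] [h3 h4]; case: (wlt_total j j') => [h|[//|h]].
  by case: (h2 j').
by case: (h4 j).
Qed.

Lemma wsucc_le j i k : wsucc j i -> k <w i -> k <=w j.
Proof. by move=> [_ h] hk; apply: wnlt => h'; apply: (h k). Qed.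

Lemma wlim_not_succ i j : wlim i -> ~ wsucc j i.
Proof. by move=> [_ H] [h1 h2]; case: (H j h1) => k /h2. Qed.

Lemma wlt_has_succ j i : j <w i -> exists k, wsucc j k /\ k <=w i.
Proof.
move=> h; case: (@wleast (fun k => j <w k)); first by exists i.
move=> k [hk Hk]; exists k; split; last exact: Hk.
by split=> // l [h1 h2]; apply: (wlt_ge h2); apply: Hk.
Qed.

(** The step [G] takes a total function, and [loc] makes its values outside the stages below [i]
    irrelevant; they are filled with [x0]. *)
Lemma wrec (X : Type) (x0 : X) (G : V -> (V -> X) -> X) :
  (forall i c c', (forall j, j <w i -> c j = c' j) -> G i c = G i c') ->
  exists c, forall i, c i = G i c.
Proof.
move=> loc.
pose cut i (rec : forall j, j <w i -> X) j :=
  if excluded_middle_informative (j <w i) is left h then rec j h else x0.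
pose F i rec := G i (cut i rec).
exists (Fix (wlt_wf (w := V)) (fun _ => X) F) => i; rewrite Fix_eq.
  by apply: loc => j h; rewrite /cut; case: (excluded_middle_informative (j <w i)).
move=> k f g fg; apply: loc => j h; rewrite /cut.
by case: (excluded_middle_informative (j <w k)).
Qed.

Lemma titer (X : Type) (init : X) (nxt : X -> X) (L : V -> (V -> X) -> X) :
  (forall i c c', (forall j, j <w i -> c j = c' j) -> L i c = L i c') ->
  exists c : V -> X,
    [/\ forall i, wmin i -> c i = init,
        forall j i, wsucc j i -> c i = nxt (c j)
      & forall i, wlim i -> c i = L i c].
Proof.
move=> loc.
pose G i c := if excluded_middle_informative (exists j, wsucc j i) is left h
  then nxt (c (proj1_sig (constructive_indefinite_description _ h)))
  else if excluded_middle_informative (exists j, j <w i) then L i c else init.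
have locG i c c' : (forall j, j <w i -> c j = c' j) -> G i c = G i c'.
  move=> H; rewrite /G; case: (excluded_middle_informative (exists j, wsucc j i)) => [h|N] /=.
    by case: constructive_indefinite_description => j /= [hj _]; rewrite H.
  by case: excluded_middle_informative => ? //=; apply: loc.
have [c Hc] := wrec init locG.
exists c; split=> [i hi|j i hj|i hi]; rewrite Hc /G;
  case: (excluded_middle_informative (exists j, wsucc j i)).
- by move=> h; have [j hj] := h; case: (hi _ (proj1 hj)).
- by move=> ? /=; case: excluded_middle_informative => // h; have [j hj] := h; case: (hi _ hj).
- move=> h; case: constructive_indefinite_description => j' /= hj'.
  by rewrite (wsucc_inj hj hj').
- by case; exists j.
- by move=> h; have [j hj] := h; case: (wlim_not_succ hi hj).
- by move=> ? /=; case: excluded_middle_informative => // N; case: N; case: hi.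
Qed.

(** At a limit [i] this is the limsup rule, with [P] saying that a given cell holds 1. *)
Definition cofinally i (P : V -> Prop) := forall j, j <w i -> exists k, j <w k /\ k <w i /\ P k.

Lemma cofinally_local i (P Q : V -> Prop) :
  (forall j, j <w i -> P j <-> Q j) -> cofinally i P <-> cofinally i Q.
Proof.
move=> H; split=> C j hj; have [k [h1 [h2 h3]]] := C j hj; exists k; do ?split=> //.
  by apply/H.
by apply/H.
Qed.

Lemma cofinally_const i j (P : V -> Prop) (Q : Prop) : wlim i -> j <w i ->
  (forall k, j <w k -> k <w i -> P k <-> Q) -> cofinally i P <-> Q.
Proof.
move=> li hj H; split=> [C|q].
  by have [k [h1 [h2 /H]]] := C j hj; apply.
move=> l hl; case: (wltVge l j) => h.
  by have [k [h1 h2]] := proj2 li j hj; exists k; split; [apply: wlt_trans h h1|split=> //; apply/H].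
have [k [h1 h2]] := proj2 li l hl; exists k; split=> //; split=> //; apply/H => //.
exact: wle_lt_trans h1.
Qed.
End WellOrder.

(** * Embeddings, products and sums of well-orders *)

Section Embeddings.
Variables A V : wo.

Definition monotone (m : A -> V) := forall i j, i <w j -> m i <w m j.
Definition initial (phi : A -> V) :=
  monotone phi /\ forall i v, v <w phi i -> exists2 j, j <w i & phi j = v.

(** If [m i] were below [phi i], it would be some [phi j] with [j <w i], although [phi j <=w m j]
    and [m j <w m i]. *)
Lemma initial_le (phi m : A -> V) : initial phi -> monotone m -> forall i, phi i <=w m i.
Proof.
move=> [_ Hi] Hm i; elim/(well_founded_ind (wlt_wf (w := A))): i => i IH.
apply: wnlt => /Hi [j hj E].
by apply: (wlt_ge (Hm _ _ hj)); rewrite -E; apply: IH.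
Qed.

(** The value [phi i] is the least element above all earlier values. Such an element exists since
    [m i] is one, by the inductive bound [phi j <=w m j]. *)
Lemma monotone_initial (m : A -> V) : monotone m -> exists phi, initial phi.
Proof.
move=> Hm; case: (classic (inhabited A)) => [[a0]|N]; last first.
  by exists m; split=> // i; case: N.
pose ok i (c : A -> V) v := forall j, j <w i -> c j <w v.
pose G i c := epsilon (inhabits (m a0)) (fun v => ok i c v /\ forall u, ok i c u -> v <=w u).
have locG i c c' : (forall j, j <w i -> c j = c' j) -> G i c = G i c'.
  move=> H; rewrite /G.
  suff E : ok i c = ok i c' by rewrite E.
  apply: functional_extensionality => v.
  apply: propositional_extensionality.
  by split=> h j hj; [rewrite -H|rewrite H] => //; apply: h.
have [phi Hphi] := wrec (m a0) locG.
have key i : [/\ ok i phi (phi i), forall u, ok i phi u -> phi i <=w u & phi i <=w m i].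
  elim/(well_founded_ind (wlt_wf (w := A))): i => i IH.
  have okm : ok i phi (m i).
    by move=> j hj; have [_ _ h] := IH j hj; apply: wle_lt_trans h (Hm _ _ hj).
  have := @wleast V (ok i phi); case; first by exists (m i).
  move=> v Hv; have := @epsilon_spec V (inhabits (m a0))
    (fun v => ok i phi v /\ forall u, ok i phi u -> v <=w u) (ex_intro _ v Hv).
  by rewrite -/(G i phi) -Hphi => -[h1 h2]; split=> //; apply: h2.
exists phi; split=> [i j hij|i v hv]; first by case: (key j) => h _ _; apply: h.
apply: NNPP => N.
(* If [v] is missed by [phi] below [i], then by induction no [phi j] can jump over it, so [v] bounds
   all of them and the minimality of [phi i] applies. *)
have hle : phi i <=w v.
  have [_ h _] := key i; apply: h => j hj.
  case: (wltVge (phi j) v) => // h; case: (classic (phi j = v)) => e.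
    by case: N; exists j.
  elim/(well_founded_ind (wlt_wf (w := A))): j hj h e => j IHj hj h e.
  have h' : v <w phi j by case: h => // h; case: e.
  have [_ hmin _] := key j; case: (wlt_ge h'); apply: hmin => l hl.
  have hli := wlt_trans hl hj.
  case: (wltVge (phi l) v) => // hv2; apply: IHj => // e2.
  by case: N; exists l.
exact: wlt_ge hv hle.
Qed.
End Embeddings.

Section Products.
Variables A B : wo.

(** The first coordinate dominates: [lexwo A B] is a succession of copies of [B] indexed by [A]. *)
Definition lexlt (u v : A * B) := u.1 <w v.1 \/ u.1 = v.1 /\ u.2 <w v.2.

Lemma lexlt_wf : well_founded lexlt.
Proof.
move=> [a b]; elim/(well_founded_ind (wlt_wf (w := A))): a b => a IHa b.
elim/(well_founded_ind (wlt_wf (w := B))): b => b IHb.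
constructor=> -[a' b'] [/= h|/= [-> h]]; [exact: IHa|exact: IHb].
Qed.

Lemma lexlt_trans u v w : lexlt u v -> lexlt v w -> lexlt u w.
Proof.
move: u v w => [a b] [a' b'] [a'' b''] [h|[/= e h]] [h'|[/= e' h']]; rewrite /lexlt /=.
- by left; apply: wlt_trans h h'.
- by left; rewrite -e'.
- by left; rewrite e.
- by right; split; [rewrite e|apply: wlt_trans h h'].
Qed.

Lemma lexlt_total u v : lexlt u v \/ u = v \/ lexlt v u.
Proof.
move: u v => [a b] [a' b']; rewrite /lexlt /=.
case: (wlt_total a a') => [|[<-|]]; auto.
by case: (wlt_total b b') => [|[<-|]]; auto.
Qed.

Definition lexwo := Wo lexlt_trans lexlt_total lexlt_wf.
End Products.

Lemma nat_lt_trans (i j k : nat) : i < j -> j < k -> i < k. Proof. exact: ltn_trans. Qed.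
Lemma nat_lt_total (i j : nat) : i < j \/ i = j \/ j < i. Proof. lia. Qed.
Lemma nat_lt_wf : well_founded (fun i j : nat => i < j).
Proof. by move=> n; elim/ltn_ind: n => n IH; constructor. Qed.
Definition natwo := Wo nat_lt_trans nat_lt_total nat_lt_wf.

Section Sigma.
Variable F : nat -> wo.

(** This is the ordinal sum of the orders [F n]. *)
Definition siglt := lexprod nat F (fun i j : nat => i < j) (fun n => @wlt (F n)).

Lemma siglt_trans u v w : siglt u v -> siglt v w -> siglt u w.
Proof.
case=> [n a m b h|n a b h] H; inversion H; subst.
- by apply: left_lex; apply: ltn_trans h _.
- exact: left_lex.
- exact: left_lex.
- match goal with E : existT _ _ _ = existT _ _ _ |- _ =>
    have {}E := inj_pair2_eq_dec _ PeanoNat.Nat.eq_dec _ _ _ _ E; subst end.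
  by apply: right_lex; apply: wlt_trans h _; eassumption.
Qed.

Lemma siglt_total u v : siglt u v \/ u = v \/ siglt v u.
Proof.
move: u v => [n a] [m b]; case: (ltngtP n m) => h.
- by left; apply: left_lex.
- by right; right; apply: left_lex.
- case: _ / h b => b; case: (wlt_total a b) => [h|[->|h]]; auto.
  + by left; apply: right_lex.
  + by right; right; apply: right_lex.
Qed.

Lemma siglt_wf : well_founded siglt.
Proof. apply: wf_lexprod; [exact: nat_lt_wf|by move=> n; apply: wlt_wf]. Qed.

Definition sigwo := Wo siglt_trans siglt_total siglt_wf.
End Sigma.

Section Sub.
Variables (V : wo) (P : V -> Prop).
Definition sublt (u v : {v : V | P v}) := proj1_sig u <w proj1_sig v.
Lemma sublt_total u v : sublt u v \/ u = v \/ sublt v u.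
Proof.
move: u v => [u pu] [v pv]; rewrite /sublt /=; case: (wlt_total u v) => [|[e|]]; auto.
by case: _ / e pv => pv; rewrite (proof_irrelevance _ pu pv); auto.
Qed.
Lemma sublt_trans u v w : sublt u v -> sublt v w -> sublt u w.
Proof. exact: wlt_trans. Qed.
Lemma sublt_wf : well_founded sublt.
Proof. apply: wf_inverse_image; exact: wlt_wf. Qed.
Definition subwo := Wo sublt_trans sublt_total sublt_wf.
End Sub.

(** * Machine runs over arbitrary well-orders *)

Lemma config_ext (c d : config) : st c = st d -> head c = head d ->
  tape1 c = tape1 d -> tape2 c = tape2 d -> tape3 c = tape3 d -> c = d.
Proof. by case: c d => ????? [?????] /= -> -> -> -> ->. Qed.

Section FrozenRuns.
Variables (P : program) (x : real).

Definition limit_config (V : wo) (c : V -> config) (i : V) : config :=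
  {| st := q_limit; head := 0;
     tape1 := fun n => decb (cofinally i (fun k => tape1 (c k) n = true));
     tape2 := fun n => decb (cofinally i (fun k => tape2 (c k) n = true));
     tape3 := fun n => decb (cofinally i (fun k => tape3 (c k) n = true)) |}.

(* Unlike a [run], a frozen run exists over every well-order: it keeps repeating
   the halting configuration once that has been reached. *)
Record fzrun (V : wo) (c : V -> config) : Prop := {
  fz_init : forall i, wmin i -> c i = init_config x;
  fz_succ : forall j i, wsucc j i -> c i = if st (c j) == q_halt then c j else step P (c j);
  fz_halt : forall i j, wlim i -> j <w i -> st (c j) = q_halt -> c i = c j;
  fz_lim : forall i, wlim i -> (forall j, j <w i -> st (c j) <> q_halt) ->
    c i = limit_config c i }.

Lemma limit_config_local (V : wo) (c c' : V -> config) i :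
  (forall j, j <w i -> c j = c' j) -> limit_config c i = limit_config c' i.
Proof.
move=> H; apply: config_ext => //=; apply: functional_extensionality => n;
  by apply: bool_ext; rewrite !decbP; apply: cofinally_local => j hj; rewrite H.
Qed.

Lemma fzrun_exists (V : wo) : exists c : V -> config, fzrun c.
Proof.
pose hb (c : V -> config) i j := j <w i /\ st (c j) = q_halt.
pose L i c := if excluded_middle_informative (exists j, hb c i j)
  then c (epsilon (inhabits i) (hb c i)) else limit_config c i.
have [i c c' H|c [H0 H1 H2]] := @titer V config (init_config x)
  (fun d => if st d == q_halt then d else step P d) L.
  have E : hb c i = hb c' i.
    apply: functional_extensionality => j; apply: propositional_extensionality.
    by split=> -[h1 h2]; split=> //; [rewrite -H|rewrite H].
  rewrite /L E; case: (excluded_middle_informative (exists j, hb c' i j)) => [h|?] /=.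
    apply: H; have [j hj] := h.
    by case: (epsilon_spec (inhabits i) (hb c' i) (ex_intro _ j hj)).
  exact: limit_config_local.
(* All halted stages below a limit carry the same configuration, so it does not matter which of them
   [epsilon] picks in [L]. *)
have hconst i : forall j, j <=w i -> st (c j) = q_halt -> c i = c j.
  elim/(well_founded_ind (wlt_wf (w := V))): i => i IH j [hji|-> //] sj.
  case: (wcases i) => [/(_ j)//|[[k hk]|li]].
    have E := IH k (proj1 hk) j (wsucc_le hk hji) sj.
    by rewrite (H1 _ _ hk) E sj.
  rewrite H2 // /L; case: (excluded_middle_informative (exists j, hb c i j)) => [?|N] /=;
    last by case: N; exists j.
  have [h1 h2] := epsilon_spec (inhabits i) (hb c i) (ex_intro _ j (conj hji sj)).
  set k := epsilon _ _ in h1 h2 *.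
  by case: (wltVge j k) => h; [apply: IH; auto|rewrite (IH _ hji k)].
exists c; split=> // [i j li hji sj|i li N]; first by apply: hconst; auto.
rewrite H2 // /L; case: (excluded_middle_informative (exists j, hb c i j)) => //= h; have [j [h1 h2]] := h.
by case: (N _ h1).
Qed.

Lemma fz_const (V : wo) (c : V -> config) i j : fzrun c -> j <=w i ->
  st (c j) = q_halt -> c i = c j.
Proof.
move=> Hc; elim/(well_founded_ind (wlt_wf (w := V))): i => i IH [hji|-> //] sj.
case: (wcases i) => [/(_ j)//|[[k hk]|li]].
  by rewrite (fz_succ Hc hk) (IH k (proj1 hk) (wsucc_le hk hji) sj) sj.
exact: fz_halt li hji sj.
Qed.

Section Initial.
Variables (A V : wo) (phi : A -> V).
Hypothesis Hphi : initial phi.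

Lemma initial_lt i j : phi i <w phi j -> i <w j.
Proof.
move=> h; case: (wltVge i j) => // -[h'|e].
  by case: (wlt_irr (wlt_trans h (proj1 Hphi _ _ h'))).
by rewrite e in h; case: (wlt_irr h).
Qed.

Lemma initial_min i : wmin i -> wmin (phi i).
Proof. by move=> H v /(proj2 Hphi) [j /H]. Qed.

Lemma initial_succ j i : wsucc j i -> wsucc (phi j) (phi i).
Proof.
move=> [h1 h2]; split; first exact: (proj1 Hphi).
move=> v [a b]; have [k hk e] := proj2 Hphi _ _ b; apply: (h2 k).
by split=> //; apply: initial_lt; rewrite e.
Qed.

Lemma initial_lim i : wlim i -> wlim (phi i).
Proof.
move=> [[j h1] h2]; split; first by exists (phi j); apply: (proj1 Hphi).
move=> v hv; have [k hk <-] := proj2 Hphi _ _ hv.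
have [l [a b]] := h2 k hk; exists (phi l).
by split; apply: (proj1 Hphi).
Qed.

Lemma initial_cofinally i (Q : V -> Prop) :
  cofinally (phi i) Q <-> cofinally i (fun k => Q (phi k)).
Proof.
split=> C.
  move=> j hj; have [k [h1 [h2 h3]]] := C _ (proj1 Hphi _ _ hj).
  by have [l hl e] := proj2 Hphi _ _ h2; exists l; subst k; split=> //; apply: initial_lt.
move=> v hv; have [j hj e] := proj2 Hphi _ _ hv; subst v.
have [k [h1 [h2 h3]]] := C _ hj.
by exists (phi k); split; [|split=> //]; apply: (proj1 Hphi).
Qed.

Lemma initial_limit_config (d : V -> config) i :
  limit_config d (phi i) = limit_config (fun k => d (phi k)) i.
Proof.
by apply: config_ext => //=; apply: functional_extensionality => n;
  apply: bool_ext; rewrite !decbP initial_cofinally.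
Qed.

Lemma fz_restrict (d : V -> config) : fzrun d -> fzrun (fun i => d (phi i)).
Proof.
move=> Hd; split=> [i /initial_min|j i /initial_succ|i j /initial_lim li hj|i li N].
- exact: fz_init.
- exact: fz_succ.
- by apply: fz_halt => //; apply: (proj1 Hphi).
- rewrite (fz_lim Hd (initial_lim li)) ?initial_limit_config // => v hv.
  by have [j hj <-] := proj2 Hphi _ _ hv; apply: N.
Qed.
End Initial.

Lemma fz_unique (V : wo) (c d : V -> config) : fzrun c -> fzrun d -> forall i, c i = d i.
Proof.
move=> Hc Hd i; elim/(well_founded_ind (wlt_wf (w := V))): i => i IH.
case: (wcases i) => [mi|[[k hk]|li]].
- by rewrite (fz_init Hc mi) (fz_init Hd mi).
- by rewrite (fz_succ Hc hk) (fz_succ Hd hk) IH //; case: hk.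
case: (classic (exists j, j <w i /\ st (c j) = q_halt)) => [[j [hj sj]]|N].
  by rewrite (fz_halt Hc li hj sj) (fz_halt Hd li hj) -IH.
have N' j : j <w i -> st (c j) <> q_halt by move=> h1 h2; apply: N; exists j.
rewrite (fz_lim Hc li N') (fz_lim Hd li); first exact: limit_config_local.
by move=> j hj; rewrite -IH //; apply: N'.
Qed.

(** The configuration at a stage depends only on the order type of the stages before it. This is how
    runs over different orders are compared. *)
Lemma fz_initial (A V : wo) (phi : A -> V) c d : initial phi -> fzrun c -> fzrun d ->
  forall i, c i = d (phi i).
Proof. by move=> Hphi Hc Hd; apply: (fz_unique Hc (fz_restrict Hphi Hd)). Qed.

Definition runwo (R : run P x) : wo :=
  Wo (slt_trans P x R) (slt_total P x R) (slt_wf P x R).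

Lemma run_nonhalting (R : run P x) (i j : runwo R) : j <w i -> st (cfg R j) <> q_halt.
Proof.
move=> /wlt_has_succ [k [[h1 h2] _]].
by have [] := run_succ P x R k j h1 h2.
Qed.

Lemma run_fz (R : run P x) : fzrun (V := runwo R) (cfg R).
Proof.
split=> [i|j i [h1 h2]|i j _ /run_nonhalting//|i [h1 h2] _].
- exact: run_init.
- have [h3 ->] := run_succ P x R i j h1 h2.
  by case: eqP => // e; case: h3.
- have [H1 [H2 H3]] := run_limit P x R i h1 h2.
  by apply: config_ext => //=; apply: functional_extensionality => n;
    have [H4 [H5 H6]] := H3 n; apply: bool_ext; rewrite decbP.
Qed.

Section Truncate.
Variables (V : wo) (c : V -> config) (v : V).
Hypotheses (Hc : fzrun c) (Hv : forall u, u <w v -> st (c u) <> q_halt).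

Definition trunc := subwo (fun u => u <=w v).

Lemma trunc_initial : initial (fun u : trunc => proj1_sig u).
Proof.
split=> // -[i hi] u /= hu.
have h : u <=w v by left; apply: wlt_le_trans hu hi.
by exists (exist _ u h).
Qed.

Let Hd := fz_restrict trunc_initial Hc.

Lemma trunc_nonhalting (i j : trunc) : j <w i -> st (c (proj1_sig j)) <> q_halt.
Proof. by move=> h; apply: Hv; exact: (@wlt_le_trans V _ _ _ h (proj2_sig i)). Qed.

Lemma trunc_succ (i j : trunc) : wlt j i -> (forall k, ~ (wlt j k /\ wlt k i)) ->
  st (c (proj1_sig j)) <> q_halt /\ c (proj1_sig i) = step P (c (proj1_sig j)).
Proof.
move=> h1 h2; have N := trunc_nonhalting h1; split=> //.
rewrite (fz_succ Hd (conj h1 h2)).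
by case: eqP => // e; case: N.
Qed.

Lemma trunc_limit (i : trunc) : (exists j, wlt j i) ->
  (forall j, wlt j i -> exists k, wlt j k /\ wlt k i) ->
  st (c (proj1_sig i)) = q_limit /\ head (c (proj1_sig i)) = 0 /\
  (forall n, (tape1 (c (proj1_sig i)) n = true <->
      forall j : trunc, wlt j i -> exists k, wlt j k /\ wlt k i /\ tape1 (c (proj1_sig k)) n = true) /\
    (tape2 (c (proj1_sig i)) n = true <->
      forall j : trunc, wlt j i -> exists k, wlt j k /\ wlt k i /\ tape2 (c (proj1_sig k)) n = true) /\
    (tape3 (c (proj1_sig i)) n = true <->
      forall j : trunc, wlt j i -> exists k, wlt j k /\ wlt k i /\ tape3 (c (proj1_sig k)) n = true)).
Proof.
move=> h1 h2; rewrite (fz_lim Hd (conj h1 h2)) /=; last first.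
  by move=> j; apply: trunc_nonhalting.
by split=> //; split=> // n; rewrite !decbP.
Qed.

(** A frozen run cut at [v] is a genuine run, because it can halt only at its last stage, which has
    no successor. *)
Definition trunc_run : run P x :=
  Build_run P x trunc (@wlt trunc) (@wlt_trans trunc) (@wlt_total trunc) (@wlt_wf trunc)
    (fun u => c (proj1_sig u)) (fz_init Hd) trunc_succ trunc_limit.
End Truncate.

Lemma least_halting (V : wo) (c : V -> config) v : fzrun c -> st (c v) = q_halt ->
  exists h, [/\ h <=w v, st (c h) = q_halt, c v = c h & forall u, u <w h -> st (c u) <> q_halt].
Proof.
move=> Hc sv; have [|h [sh Hh]] := @wleast V (fun u => st (c u) = q_halt); first by exists v.
exists h; split=> //; [exact: Hh|apply: fz_const => //; exact: Hh|].
by move=> u hu su; case: (wlt_ge hu (Hh _ su)).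
Qed.

Lemma fz_halts_with (V : wo) (c : V -> config) v : fzrun c -> st (c v) = q_halt ->
  halts_with P x (tape3 (c v)).
Proof.
move=> Hc /(least_halting Hc) [h [_ sh -> N]].
exists (trunc_run Hc N).
by exists (exist _ h (or_intror erefl)).
Qed.

Lemma trunc_monotone_initial (R : run P x) (a : runwo R) (V : wo)
  (m : subwo (V := runwo R) (fun i => i <=w a) -> V) c :
  monotone m -> fzrun c ->
  exists phi, [/\ initial phi, forall i, phi i <=w m i & forall i, cfg R (proj1_sig i) = c (phi i)].
Proof.
move=> Hm Hc; have [phi Hphi] := monotone_initial Hm.
exists phi; split=> //; first exact: initial_le.
by move=> i; apply: (fz_initial Hphi (fz_restrict (trunc_initial a) (run_fz R)) Hc).
Qed.

(** The stages of the given run up to its halting stage, taken as a well-order, serve as the halting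
    time; later arguments use nothing else about that run. *)
Lemma halts_with_fz y : halts_with P x y ->
  exists A : wo, inhabited A /\ forall (V : wo) c (m : A -> V) v, fzrun c -> monotone m ->
    (forall i, m i <=w v) -> st (c v) = q_halt /\ tape3 (c v) = y.
Proof.
move=> [R [a [sa <-]]]; pose A := subwo (V := runwo R) (fun i => i <=w a).
pose a' : A := exist _ a (or_intror erefl).
exists A; split=> // V c m v Hc Hm Hv.
have [phi [_ le E]] := trunc_monotone_initial Hm Hc.
have E' := E a'; rewrite /= in E'.
suff -> : c v = c (phi a') by rewrite -E'.
apply: fz_const => //; last by rewrite -E'.
exact: wle_trans (le a') (Hv a').
Qed.

Lemma halts_eventually y : halts_with P x y -> eventually_outputs P x y.
Proof.
move=> [R [a [sa <-]]]; exists R, a => R' b [m [Hm Hb]].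
pose A := subwo (V := runwo R) (fun i => i <=w a).
have [phi [_ le E]] := @trunc_monotone_initial R a (runwo R') m _ Hm (run_fz R').
pose a' : A := exist _ a (or_intror erefl).
have E' := E a'; rewrite /= in E'.
rewrite E'; congr (tape3 _); apply: (@fz_const (runwo R')); first exact: run_fz.
  exact: wle_trans (le a') (Hb a').
by rewrite -E'.
Qed.

Lemma eventually_fz y : eventually_outputs P x y ->
  exists A : wo, inhabited A /\ forall (V : wo) c (m : A -> V) v, fzrun c -> monotone m ->
    (forall i, m i <=w v) -> tape3 (c v) = y.
Proof.
move=> [R [a Ha]]; pose A := subwo (V := runwo R) (fun i => i <=w a).
pose a' : A := exist _ a (or_intror erefl).
exists A; split=> // V c m v Hc Hm Hv.
case: (classic (exists u, u <w v /\ st (c u) = q_halt)) => [[u [hu su]]|N].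
  have [h [hh sh eh N]] := least_halting Hc su.
  rewrite (fz_const Hc (or_introl hu) su) eh.
  have [phi [Hphi le E]] := trunc_monotone_initial Hm Hc.
  (* A halting stage strictly below [phi i] would be [phi j] for some [j] before [i], so that [R]
     would continue after halting. *)
  have le' i : phi i <=w h.
    apply: wnlt => /(proj2 Hphi) [j hj e].
    by case: (@run_nonhalting R (proj1_sig i) (proj1_sig j) hj); rewrite E e.
  apply: (Ha (trunc_run Hc N) (exist _ h (or_intror erefl))).
  exists (fun i => exist _ (phi i) (le' i)); split=> [i j|i].
    exact: (proj1 Hphi).
  case: (le' i) => e; [by left|right].
  by apply: eq_sig_hprop => // *; apply: proof_irrelevance.
have N' u : u <w v -> st (c u) <> q_halt by move=> h1 h2; apply: N; exists u.
apply: (Ha (trunc_run Hc N') (exist _ v (or_intror erefl))).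
exists (fun i => exist _ (m i) (Hv i)); split=> [i j|i]; first exact: Hm.
case: (Hv i) => e; [by left|right].
by apply: eq_sig_hprop => // *; apply: proof_irrelevance.
Qed.

(** The order [S] stands for the stages of an arbitrary competing run. Since [V] begins with [V0]
    and has room for [S], both runs become parts of one frozen run over [V] and can be compared
    there. *)
Lemma fz_eventually y (V0 : wo) (a : V0) (c0 : V0 -> config) : fzrun c0 ->
  (forall v, st (c0 v) <> q_halt) ->
  (forall S : wo, exists (V : wo) (phi : V0 -> V) (m : S -> V),
     [/\ initial phi, monotone m &
       forall c, fzrun c -> forall v, phi a <=w v -> tape3 (c v) = y]) ->
  eventually_outputs P x y.
Proof.
move=> H0 N0 H.
have N u : u <w a -> st (c0 u) <> q_halt by move=> _; apply: N0.
exists (trunc_run H0 N), (exist _ a (or_intror erefl)) => R b [m [Hm Hb]].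
have [V [phi [mR [Hphi HmR Hy]]]] := H (runwo R).
have [psi Hpsi] := monotone_initial HmR.
have [c Hc] := fzrun_exists V.
have -> : cfg R b = c (psi b) by exact: (fz_initial Hpsi (run_fz R) Hc).
apply: (Hy _ Hc).
pose A := subwo (V := subwo (V := V0) (fun u => u <=w a)) (fun i => i <=w exist _ a (or_intror erefl)).
have mon : monotone (A := A) (fun i => psi (m i)).
  by move=> i j hij; apply: (proj1 Hpsi); apply: Hm.
have ini : initial (A := A) (fun i => phi (proj1_sig (proj1_sig i))).
  split=> [i j hij|i v hv]; first by apply: (proj1 Hphi).
  have [j hj e] := proj2 Hphi _ _ hv.
  have h1 : j <=w a by left; apply: wlt_le_trans hj (proj2_sig (proj1_sig i)).
  have h2 : wlt (w := subwo (V := V0) (fun u => u <=w a)) (exist _ j h1) (exist _ a (or_intror erefl))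
    by apply: (wlt_le_trans hj (proj2_sig (proj1_sig i))).
  by exists (exist _ (exist _ j h1) (or_introl h2)).
pose a' : A := exist _ (exist _ a (or_intror erefl)) (or_intror erefl).
apply: (wle_trans (initial_le ini mon a')).
by case: (Hb a') => [h|->]; [left; apply: (proj1 Hpsi)|right].
Qed.
End FrozenRuns.

(** * Configurations as single tapes of cells *)

Definition cell : Type := bool * bool * bool.
Definition cell0 : cell := (false, false, false).
Definition cells (c : config) (n : nat) : cell := (tape1 c n, tape2 c n, tape3 c n).
Definition mkc (s h : nat) (T : nat -> cell) : config :=
  {| st := s; head := h; tape1 := fun n => (T n).1.1; tape2 := fun n => (T n).1.2;
     tape3 := fun n => (T n).2 |}.
Definition updc (T : nat -> cell) (h : nat) (w : cell) : nat -> cell :=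
  fun n => if n == h then w else T n.

Lemma cells_mkc s h T : cells (mkc s h T) = T.
Proof. by apply: functional_extensionality => n; rewrite /cells /=; case: (T n) => -[]. Qed.

Lemma step_mkc P s h T q w1 w2 w3 (mv : bool) :
  trans P s (T h).1.1 (T h).1.2 (T h).2 = (q, w1, w2, w3, mv) ->
  step P (mkc s h T) = mkc q (if mv then h.+1 else h.-1) (updc T h (w1, w2, w3)).
Proof.
move=> E; rewrite /step /= E; apply: config_ext => //=;
  apply: functional_extensionality => n; rewrite /updc /upd -[Nat.eqb n h]/(n == h);
  by case: eqP.
Qed.

Lemma updc_id T h : updc T h (T h) = T.
Proof. by apply: functional_extensionality => n; rewrite /updc; case: eqP => // ->. Qed.

(** * Block machines *)
Section BlockMachine.
Variables (K : nat) (Kpos : 0 < K) (Q : finType) (q0 : Q).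
Notation block_t := (K.-tuple (bool * bool * bool)).
Variable delta : Q -> block_t -> option Q * block_t * bool.

Definition mkblock (F : nat -> cell) : block_t := [tuple of mkseq F K].
Definition block (T : nat -> cell) (m : nat) : block_t := mkblock (fun r => T (K * m + r)).
Definition setblock (T : nat -> cell) m (g : block_t) : nat -> cell :=
  fun n => if n %/ K == m then nth cell0 g (n %% K) else T n.

Lemma nth_mkblock F r : r < K -> nth cell0 (mkblock F) r = F r.
Proof. by move=> h; rewrite nth_mkseq. Qed.

Lemma block_ext (g g' : block_t) : (forall r, r < K -> nth cell0 g r = nth cell0 g' r) -> g = g'.
Proof.
move=> H; apply: val_inj; apply: (@eq_from_nth _ cell0); first by rewrite !size_tuple.
by move=> i; rewrite size_tuple; apply: H.
Qed.

Definition mstate : finType := (Q * 'I_(3 * K).+1 * block_t)%type.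
Definition mst (q : Q) (c : nat) (b : block_t) : mstate := (q, inord c, b).
Definition mcode (m : mstate) : nat := 3 + enum_rank m.
(** The start state and the limit state both decode to the beginning of a block step in state [q0],
    so a block machine starts afresh at every limit. *)
Definition mdecode (n : nat) : mstate :=
  if insub (n - 3) : option 'I_#|mstate| is Some r then
    if n < 3 then mst q0 0 (mkblock (fun _ => cell0)) else enum_val r
  else mst q0 0 (mkblock (fun _ => cell0)).

Lemma mcodeK m : mdecode (mcode m) = m.
Proof. by rewrite /mdecode /mcode addKn valK /= enum_rankK. Qed.

Lemma mdecode_small n : n < 3 -> mdecode n = mst q0 0 (mkblock (fun _ => cell0)).
Proof. by rewrite /mdecode => ->; case: insub. Qed.

Definition bufset (b : block_t) c w : block_t :=
  mkblock (fun i => if i == c then w else nth cell0 b i).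

(* In [3 * K] machine steps the whole block is read left to right, rewritten right to left,
   and the head is moved to the neighbouring block. *)
Definition mtrans (m : mstate) (w : cell) : option mstate * cell * bool :=
  let: (q, c, b) := m in
  let: (q', g, d) := delta q b in
  let next := if c.+1 < 3 * K then Some (mst q c.+1 b)
              else omap (fun q1 => mst q1 0 b) q' in
  if c < K then (Some (mst q c.+1 (bufset b c w)), w, true)
  else if c == K :> nat then (next, w, false)
  else if c < 2 * K then (next, nth cell0 g (2 * K - c), false)
  else if c == 2 * K :> nat then (next, nth cell0 g 0, d)
  else (next, w, d).

Definition block_program : program :=
  {| nstates := 3 + #|mstate|;
     trans := fun n r1 r2 r3 =>
       let: (nx, w, d) := mtrans (mdecode n) (r1, r2, r3) in
       (if nx is Some m then mcode m else q_halt, w.1.1, w.1.2, w.2, d) |}.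

Lemma block_program_valid : valid_program block_program.
Proof.
split=> [|q r1 r2 r3 _]; apply/leP; rewrite /= ?leq_addr //.
by case: mtrans => -[[m|] w] d //=; rewrite /mcode ltn_add2l ltn_ord.
Qed.

Definition at_state (s : nat) (q : Q) : Prop :=
  s <> q_halt /\ exists b, mdecode s = mst q 0 b.

Lemma at_state_start : at_state q_start q0.
Proof. by split=> //; eexists; rewrite mdecode_small. Qed.

Lemma at_state_limit : at_state q_limit q0.
Proof. by split=> //; eexists; rewrite mdecode_small. Qed.

Section OneBlockStep.
Variables (q : Q) (m : nat) (T : nat -> cell) (q' : option Q) (g : block_t) (d : bool).
Hypothesis Hdelta : delta q (block T m) = (q', g, d).
Let P := block_program.
Let T' := setblock T m g.

Lemma block_trans s h c b nx w mv S : mdecode s = mst q c b -> c <= 3 * K ->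
  mtrans (mst q c b) (S h) = (nx, w, mv) ->
  step P (mkc s h S) =
    mkc (if nx is Some m then mcode m else q_halt) (if mv then h.+1 else h.-1) (updc S h w).
Proof.
move=> E Hc Et; rewrite (@step_mkc _ _ _ _
  (if nx is Some m then mcode m else q_halt) w.1.1 w.1.2 w.2 mv).
  by case: w {Et} => -[].
rewrite /= E.
have -> : ((S h).1.1, (S h).1.2, (S h).2) = S h by case: (S h) => -[].
by rewrite Et.
Qed.

Lemma mtrans_mst c b w : c <= 3 * K -> mtrans (mst q c b) w =
  let: (q', g, d) := delta q b in
  let next := if c.+1 < 3 * K then Some (mst q c.+1 b)
              else omap (fun q1 => mst q1 0 b) q' in
  if c < K then (Some (mst q c.+1 (bufset b c w)), w, true)
  else if c == K :> nat then (next, w, false)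
  else if c < 2 * K then (next, nth cell0 g (2 * K - c), false)
  else if c == 2 * K :> nat then (next, nth cell0 g 0, d)
  else (next, w, d).
Proof. by move=> h; rewrite /mtrans /mst inordK. Qed.

(** This is the tape during the rewriting from right to left, when the cells of block [m] beyond
    offset [i] are already new. *)
Definition partial (i : nat) : nat -> cell :=
  fun n => if (K * m + i < n) && (n < K * m + K) then T' n else T n.

Lemma T'_in r : r < K -> T' (K * m + r) = nth cell0 g r.
Proof.
by move=> h; rewrite /T' /setblock mulnC divnMDl // divn_small // addn0 eqxx modnMDl modn_small.
Qed.

Lemma T'_out n : n < K * m \/ K * m + K <= n -> T' n = T n.
Proof.
move=> h; rewrite /T' /setblock; case: eqP => // e.
have := divn_eq n K; have := ltn_pmod n Kpos; rewrite e mulnC; lia.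
Qed.

Lemma partial_top : partial K.-1 = T.
Proof. by apply: functional_extensionality => n; rewrite /partial; case: ifP => // h; lia. Qed.

Lemma partial_step i : 0 < i < K -> updc (partial i) (K * m + i) (nth cell0 g i) = partial i.-1.
Proof.
move=> hi; apply: functional_extensionality => n; rewrite /updc /partial -T'_in; last lia.
case: eqP => [->|ne]; first by case: ifP => // h; lia.
by do 2 case: ifP => //; lia.
Qed.

Lemma partial_last : updc (partial 0) (K * m) (nth cell0 g 0) = T'.
Proof.
apply: functional_extensionality => n; rewrite /updc /partial -(T'_in Kpos).
case: eqP => [->|ne]; first by rewrite addn0.
by case: ifP => // h; rewrite T'_out //; lia.
Qed.

Definition mvh (t : nat) := if d then K * m + t else K * m - t.

Lemma read_phase s : at_state s q -> forall j, j <= K ->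
  exists sj b, [/\ iter j (step P) (mkc s (K * m) T) = mkc sj (K * m + j) T, sj <> q_halt,
    mdecode sj = mst q j b & forall i, i < j -> nth cell0 b i = T (K * m + i)].
Proof.
move=> [Hs [b0 Hb0]]; elim=> [|j IH] hj; first by exists s, b0; rewrite addn0.
have [|sj [b [E1 E2 E3 E4]]] := IH; first lia.
exists (mcode (mst q j.+1 (bufset b j (T (K * m + j))))), (bufset b j (T (K * m + j))); split.
- rewrite iterS E1 (block_trans (nx := Some (mst q j.+1 (bufset b j (T (K * m + j)))))
    (w := T (K * m + j)) (mv := true) E3); first by rewrite updc_id addnS.
    lia.
  by rewrite mtrans_mst; [case: delta => -[? ?] ?; rewrite hj|lia].
- by rewrite /mcode /q_halt; lia.
- by rewrite mcodeK.
- move=> i hi; rewrite nth_mkblock; last lia.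
  by case: eqP => [->//|ne]; apply: E4; lia.
Qed.

Lemma write_phase s : at_state s q -> forall j, j < K ->
  exists sj, [/\ iter (K.+1 + j) (step P) (mkc s (K * m) T)
      = mkc sj (K * m + (K.-1 - j)) (partial (K.-1 - j)), sj <> q_halt &
    mdecode sj = mst q (K.+1 + j) (block T m)].
Proof.
move=> Hs; elim=> [|j IH] hj.
  have [sj [b [E1 E2 E3 E4]]] := read_phase Hs (leqnn K).
  have eb : b = block T m by apply: block_ext => r hr; rewrite E4 // nth_mkblock.
  rewrite eb in E3.
  exists (mcode (mst q K.+1 (block T m))); split.
  - rewrite addn0 iterS E1 (block_trans (nx := Some (mst q K.+1 (block T m)))
      (w := T (K * m + K)) (mv := false) E3); try lia.
      by rewrite updc_id subn0 partial_top; congr mkc; lia.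
    by rewrite mtrans_mst ?Hdelta; [rewrite ltnn eqxx ifT //; lia|lia].
  - by rewrite /mcode /q_halt; lia.
  - by rewrite mcodeK addn0.
have [|sj [E1 E2 E3]] := IH; first lia.
exists (mcode (mst q (K.+1 + j).+1 (block T m))); split.
- rewrite addnS iterS E1 (block_trans (nx := Some (mst q (K.+1 + j).+1 (block T m)))
      (w := nth cell0 g (2 * K - (K.+1 + j))) (mv := false) E3); try lia.
    have -> : 2 * K - (K.+1 + j) = K.-1 - j by lia.
    rewrite partial_step; last lia.
    have -> : (K.-1 - j).-1 = K.-1 - j.+1 by lia.
    by congr mkc; lia.
  rewrite mtrans_mst ?Hdelta; last lia.
  have -> : (K.+1 + j < K) = false by lia.
  have -> : (K.+1 + j == K) = false by lia.
  have -> : K.+1 + j < 2 * K by lia.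
  by have -> : (K.+1 + j).+1 < 3 * K by lia.
- by rewrite /mcode /q_halt; lia.
- by rewrite mcodeK addnS.
Qed.

Definition next_state (t : nat) := if 2 * K + t < 3 * K then Some (mst q (2 * K + t) (block T m))
  else omap (fun q1 => mst q1 0 (block T m)) q'.

Lemma move_phase s : at_state s q -> forall j, j < K ->
  iter ((2 * K).+1 + j) (step P) (mkc s (K * m) T) =
    mkc (if next_state j.+1 is Some m then mcode m else q_halt) (mvh j.+1) T'.
Proof.
move=> Hs; elim=> [|j IH] hj.
  have [|sj [E1 E2 E3]] := write_phase Hs (j := K.-1); first lia.
  rewrite subnn addn0 in E1; rewrite addn0.
  have e : K.+1 + K.-1 = 2 * K by lia.
  rewrite e in E1, E3.
  rewrite iterS E1 (block_trans (nx := next_state 1) (w := nth cell0 g 0) (mv := d) E3); try lia.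
    by rewrite partial_last /mvh addn1 subn1.
  rewrite mtrans_mst ?Hdelta; last lia.
  rewrite /next_state addn1 ltnn eqxx.
  have -> : (2 * K < K) = false by lia.
  by have -> : (2 * K == K) = false by lia.
have e : next_state j.+1 = Some (mst q (2 * K + j.+1) (block T m)).
  by rewrite /next_state ifT //; lia.
rewrite addnS iterS IH ?e; last lia.
rewrite (block_trans (nx := next_state j.+2) (w := T' (mvh j.+1)) (mv := d)
  (c := 2 * K + j.+1) (b := block T m)); try lia.
- by rewrite updc_id /mvh; congr mkc; case: d; lia.
- by rewrite mcodeK.
rewrite mtrans_mst ?Hdelta; last lia.
rewrite /next_state (addnS _ j.+1).
have -> : (2 * K + j.+1 < K) = false by lia.
have -> : (2 * K + j.+1 == K) = false by lia.
have -> : (2 * K + j.+1 < 2 * K) = false by lia.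
by have -> : (2 * K + j.+1 == 2 * K) = false by lia.
Qed.

Lemma block_step_final s : at_state s q ->
  exists s', iter (3 * K) (step P) (mkc s (K * m) T) =
      mkc s' (K * (if d then m.+1 else m.-1)) T' /\
    (if q' is Some q1 then at_state s' q1 else s' = q_halt).
Proof.
move=> Hs; have := move_phase Hs (j := K.-1).
have -> : (2 * K).+1 + K.-1 = 3 * K by lia.
move=> ->; last lia.
have -> : next_state K.-1.+1 = omap (fun q1 => mst q1 0 (block T m)) q'.
  by rewrite /next_state ifF //; lia.
eexists; split.
  (* For a move to the left from block 0 both sides are 0: the head is stopped at the first cell
     just as the block index is. *)
  by congr mkc; rewrite /mvh; case: d; rewrite ?mulnS; nia.
case: q' => [q1|] //=; split; first by rewrite /mcode /q_halt; lia.
by eexists; rewrite mcodeK.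
Qed.

(** No cell takes a third value in the middle of a block step. Otherwise a limsup over all machine
    steps could differ from the limsup over the starts of the passes. *)
Lemma block_step_between s j : at_state s q -> j < 3 * K ->
  let c := iter j (step P) (mkc s (K * m) T) in
  st c <> q_halt /\ forall n, cells c n = T n \/ cells c n = T' n.
Proof.
move=> Hs hj /=.
case: (leqP j K) => h1.
  have [sj [b [-> E2 _ _]]] := read_phase Hs h1.
  by rewrite cells_mkc; auto.
case: (leqP j (2 * K)) => h2.
  have [|sj [E1 E2 _]] := write_phase Hs (j := j - K.+1); first lia.
  have e : K.+1 + (j - K.+1) = j by lia.
  rewrite e in E1; rewrite E1 cells_mkc; split=> // n.
  by rewrite /partial; case: ifP; auto.
have := move_phase Hs (j := j - (2 * K).+1).
have -> : (2 * K).+1 + (j - (2 * K).+1) = j by lia.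
move=> ->; last lia.
rewrite cells_mkc; split; last by auto.
by rewrite /next_state ifT /= ?/mcode ?/q_halt; lia.
Qed.
End OneBlockStep.
End BlockMachine.

(** * Passes, the sweeps of length omega *)

Definition btw (w w0 w1 : cell) : Prop :=
  [/\ w.1.1 = w0.1.1 \/ w.1.1 = w1.1.1, w.1.2 = w0.1.2 \/ w.1.2 = w1.1.2
    & w.2 = w0.2 \/ w.2 = w1.2].

(** Convergence of every cell gives the configuration at the end of the pass; the bound on
    intermediate values is what limits of passes require. *)
Definition pass (P : program) (s : nat) (T T' : nat -> cell) : Prop :=
  (forall t, st (iter t (step P) (mkc s 0 T)) <> q_halt /\
     forall n, btw (cells (iter t (step P) (mkc s 0 T)) n) (T n) (T' n)) /\
  (forall n, exists N, forall t, N <= t -> cells (iter t (step P) (mkc s 0 T)) n = T' n).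

Section Passes.
Variables (K : nat) (Kpos : 0 < K) (Q : finType) (q0 : Q).
Notation block_t := (K.-tuple (bool * bool * bool)).
Variable delta : Q -> block_t -> option Q * block_t * bool.

Definition assemble (tau : nat -> block_t) : nat -> cell :=
  fun n => nth cell0 (tau (n %/ K)) (n %% K).
Definition updb (tau : nat -> block_t) m g : nat -> block_t :=
  fun k => if k == m then g else tau k.

Lemma assemble_at tau m r : r < K -> assemble tau (K * m + r) = nth cell0 (tau m) r.
Proof. by move=> h; rewrite /assemble mulnC divnMDl // divn_small // addn0 modnMDl modn_small. Qed.

Lemma block_assemble tau m : block K (assemble tau) m = tau m.
Proof. by apply: block_ext => r h; rewrite nth_mkblock // assemble_at. Qed.

Lemma assemble_block T : assemble (block K T) = T.
Proof.
apply: functional_extensionality => n; rewrite /assemble nth_mkblock ?ltn_pmod //.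
by congr T; rewrite mulnC -divn_eq.
Qed.

Lemma setblock_assemble tau m g : setblock (assemble tau) m g = assemble (updb tau m g).
Proof. by apply: functional_extensionality => n; rewrite /setblock /assemble /updb; case: eqP. Qed.

Lemma updb_id tau m : updb tau m (tau m) = tau.
Proof. by apply: functional_extensionality => n; rewrite /updb; case: eqP => // ->. Qed.

Definition bconf : Type := Q * nat * (nat -> block_t).
Definition halting (b : bconf) := (delta b.1.1 (b.2 b.1.2)).1.1 == None.
Definition bnx (b : bconf) : bconf :=
  let: (q, m, tau) := b in
  let: (q', g, d) := delta q (tau m) in
  (odflt q q', if d then m.+1 else m.-1, updb tau m g).

Definition bbtw (g g0 g1 : block_t) : Prop :=
  forall r, r < K -> btw (nth cell0 g r) (nth cell0 g0 r) (nth cell0 g1 r).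

Lemma btw_l w w' : btw w w w'. Proof. by split; left. Qed.
Lemma btw_r w w' : btw w' w w'. Proof. by split; right. Qed.
Lemma bbtw_l g g' : bbtw g g g'. Proof. by move=> r _; apply: btw_l. Qed.
Lemma bbtw_r g g' : bbtw g' g g'. Proof. by move=> r _; apply: btw_r. Qed.

Let P := block_program q0 delta.

Section Trajectory.
Variables (tau tau' : nat -> block_t).
Let traj j : bconf := iter j bnx (q0, 0, tau).

(** Block [k - 1] is left open in the last clause because a row pass goes back by one block to shift
    the script. *)
Definition okconf (k : nat) (b : bconf) : Prop :=
  [/\ ~~ halting b, forall m, bbtw (b.2 m) (tau m) (tau' m) &
      forall m, m.+1 < k -> b.2 m = tau' m].

Hypothesis ok_all : forall j, exists k, okconf k (traj j).
Hypothesis ok_ev : forall k, exists J, forall j, J <= j -> exists2 k', k <= k' & okconf k' (traj j).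

Lemma traj_machine s : at_state K q0 s q0 -> forall j, exists sj,
  [/\ iter (3 * K * j) (step P) (mkc s 0 (assemble tau)) =
      mkc sj (K * (traj j).1.2) (assemble (traj j).2) & at_state K q0 sj (traj j).1.1].
Proof.
move=> Hs; elim=> [|j [sj [E1 E2]]]; first by exists s; rewrite muln0 /= muln0.
have [k [+ _ _]] := ok_all j; rewrite /halting.
have -> : traj j.+1 = bnx (traj j) by [].
case: (traj j) E1 E2 => -[q m] t /= E1 E2; case Ed: delta => [[[q1|] g] d] //= _.
have := @block_step_final K Kpos Q q0 delta q m (assemble t) (Some q1) g d.
rewrite block_assemble => /(_ Ed sj E2) [s' [E3 E4]].
exists s'; split=> //.
by rewrite mulnS iterD E1 E3 setblock_assemble.
Qed.

Lemma between s j i : at_state K q0 s q0 -> i < 3 * K ->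
  let c := iter (3 * K * j + i) (step P) (mkc s 0 (assemble tau)) in
  st c <> q_halt /\ forall n, cells c n = assemble (traj j).2 n \/ cells c n = assemble (traj j.+1).2 n.
Proof.
move=> Hs hi; have [sj [E1 E2]] := traj_machine Hs j.
have [k [+ _ _]] := ok_all j; rewrite /halting addnC iterD E1.
have -> : traj j.+1 = bnx (traj j) by [].
case: (traj j) E1 E2 => -[q m] t /= E1 E2; case Ed: delta => [[[q1|] g] d] //= _.
have := @block_step_between K Kpos Q q0 delta q m (assemble t) (Some q1) g d.
rewrite block_assemble => /(_ Ed sj i E2 hi) /=.
by rewrite setblock_assemble.
Qed.

Lemma assemble_btw t : (forall m, bbtw (t m) (tau m) (tau' m)) ->
  forall n, btw (assemble t n) (assemble tau n) (assemble tau' n).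
Proof. by move=> H n; apply: H; rewrite ltn_pmod. Qed.

Lemma pass_of_ok s : at_state K q0 s q0 -> pass P s (assemble tau) (assemble tau').
Proof.
move=> Hs; have K3 : 0 < 3 * K by lia.
split=> [t|n].
  have [h1 h2] := between (t %/ (3 * K)) Hs (ltn_pmod t K3).
  rewrite mulnC -divn_eq in h1 h2; split=> // n.
  have [k1 [_ b1 _]] := ok_all (t %/ (3 * K)).
  have [k2 [_ b2 _]] := ok_all (t %/ (3 * K)).+1.
  by case: (h2 n) => ->; apply: assemble_btw.
have [J HJ] := ok_ev (n %/ K).+2.
exists (3 * K * J) => t ht.
have hJ : J <= t %/ (3 * K) by rewrite leq_divRL // mulnC.
have [h1 h2] := between (t %/ (3 * K)) Hs (ltn_pmod t K3).
rewrite mulnC -divn_eq in h1 h2.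
have [k1 hk1 [_ _ b1]] := HJ _ hJ.
have [|k2 hk2 [_ _ b2]] := HJ (t %/ (3 * K)).+1; first lia.
by case: (h2 n) => ->; rewrite /assemble ?b1 ?b2 //; lia.
Qed.
End Trajectory.

(** Checkpoints [c k] cut the pass into finite stretches. In the stretch from [c k] all blocks [m]
    with [m.+1 < k] are final, so every cell converges. *)
Lemma pass_of_chain tau tau' s (c : nat -> bconf) : at_state K q0 s q0 -> c 0 = (q0, 0, tau) ->
  (forall k, exists2 n, 0 < n & iter n bnx (c k) = c k.+1 /\
     forall i, i < n -> okconf tau tau' k (iter i bnx (c k))) ->
  pass P s (assemble tau) (assemble tau').
Proof.
move=> Hs c0 H.
have start k : exists2 j, k <= j & iter j bnx (c 0) = c k.
  elim: k => [|k [j hj E]]; first by exists 0.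
  have [n n0 [En _]] := H k; exists (n + j); first lia.
  by rewrite iterD E En.
have later k d : exists2 k', k <= k' & okconf tau tau' k' (iter d bnx (c k)).
  elim/ltn_ind: d k => d IH k; have [n n0 [En Hn]] := H k.
  case: (ltnP d n) => hd; first by exists k => //; apply: Hn.
  have [|k' hk' ok'] := IH (d - n) _ k.+1; first lia.
  by exists k'; [lia|rewrite -(subnK hd) iterD En].
apply: pass_of_ok => //; rewrite -c0.
  by move=> j; have [k _ ok] := later 0 j; exists k.
move=> k; have [J hJ E] := start k; exists J => j hj.
have [k' hk' ok] := later k (j - J); exists k' => //.
by rewrite -(subnK hj) iterD E.
Qed.
End Passes.

(** * The row machine *)
Section RowMachine.
Variables (h : nat) (h6 : 6 <= h).
Let K := 2 * h.
Notation block_t := (K.-tuple (bool * bool * bool)).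
Notation code := (h.-tuple bool).
Variables (go : code -> bool) (test : code -> bool -> (nat -> bool) -> bool)
  (setB : code -> bool) (setO : code -> option (nat * bool)).

Lemma Kpos : 0 < K. Proof. by rewrite /K; lia. Qed.

(* In every block, tape 1 interleaves input bits [xb] and script code [pc]; the first half of
   tape 2 holds the state bit (0), its buffered next value (1), two alternating pass flags (2, 3),
   a flag marking the first pass of a round (4) and a mark on block 0 (5); the second half [sc]
   holds the shifting copy of the script; tape 3 is the output. *)
Definition t1 (g : block_t) r := (nth cell0 g r).1.1.
Definition fl (g : block_t) r := (nth cell0 g r).1.2.
Definition t3 (g : block_t) r := (nth cell0 g r).2.
Definition xb (g : block_t) i := t1 g (2 * i).
Definition pc (g : block_t) : code := [tuple of mkseq (fun i => t1 g (2 * i + 1)) h].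
Definition sc (g : block_t) : code := [tuple of mkseq (fun i => fl g (h + i)) h].
Definition put (g : block_t) (F : nat -> bool) (S : code) (O : nat -> bool) : block_t :=
  mkblock K (fun r => (t1 g r, if r < h then F r else nth false S (r - h), O r)).

Lemma code_ext (S S' : code) : (forall i, i < h -> nth false S i = nth false S' i) -> S = S'.
Proof.
move=> H; apply: val_inj; apply: (@eq_from_nth _ false); first by rewrite !size_tuple.
by move=> i; rewrite size_tuple; apply: H.
Qed.

Lemma nth_sc g i : i < h -> nth false (sc g) i = fl g (h + i).
Proof. by move=> hi; rewrite nth_mkseq. Qed.

Lemma nth_put g F S O r : r < K ->
  nth cell0 (put g F S O) r = (t1 g r, if r < h then F r else nth false S (r - h), O r).
Proof. by move=> hr; rewrite nth_mkblock. Qed.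

Lemma t1_put g F S O r : r < K -> t1 (put g F S O) r = t1 g r.
Proof. by move=> hr; rewrite /t1 nth_put. Qed.

Lemma t3_put g F S O r : r < K -> t3 (put g F S O) r = O r.
Proof. by move=> hr; rewrite /t3 nth_put. Qed.

Lemma fl_put g F S O r : r < h -> fl (put g F S O) r = F r.
Proof. by move=> hr; rewrite /fl nth_put /= ?hr //; rewrite /K; lia. Qed.

Lemma sc_put g F S O : sc (put g F S O) = S.
Proof.
apply: code_ext => i hi; rewrite nth_sc // /fl nth_put /=; last by rewrite /K; lia.
by rewrite ifF ?addKn //; lia.
Qed.

Lemma put_ext g F S O F' S' O' : (forall r, r < h -> F r = F' r) -> S = S' ->
  (forall r, r < K -> O r = O' r) -> put g F S O = put g F' S' O'.
Proof.
move=> HF -> HO; apply: block_ext => r hr; rewrite !nth_put // HO //.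
by case: ifP => // /HF ->.
Qed.

Lemma put_eta g : put g (fl g) (sc g) (t3 g) = g.
Proof.
apply: block_ext => r hr; rewrite nth_put // /t1 /t3.
have -> : (if r < h then fl g r else nth false (sc g) (r - h)) = fl g r.
  by case: ltnP => // hr2; rewrite nth_sc ?subnKC //; rewrite /K in hr; lia.
by rewrite /fl; case: nth => -[].
Qed.

Lemma bbtwP g g0 g1 : (forall r, r < K -> t1 g r = t1 g0 r) ->
  (forall r, r < h -> fl g r = fl g0 r \/ fl g r = fl g1 r) ->
  (sc g = sc g0 \/ sc g = sc g1) ->
  (forall r, r < K -> t3 g r = t3 g0 r \/ t3 g r = t3 g1 r) -> bbtw g g0 g1.
Proof.
move=> H1 H2 H3 H4 r hr; split; [by left; apply: H1| |exact: H4].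
case: (ltnP r h) => hr2; first exact: H2.
have hr3 : r - h < h by rewrite /K in hr; lia.
by case: H3 => /(congr1 (fun S : code => nth false S (r - h))); rewrite !nth_sc // subnKC // => e;
  [left|right].
Qed.

Definition rstate : finType := ('I_7 * bool * code)%type.
Definition rs (k : nat) (r : bool) (c : code) : rstate := (inord k, r, c).
Definition c0 : code := [tuple of mkseq (fun _ => false) h].
Definition r0 : rstate := rs 0 false c0.
Definition rs' k r := rs k r c0.

Definition setf (F : nat -> bool) k v : nat -> bool := fun r => if r == k then v else F r.
Definition updO (r : bool) (a : option (nat * bool)) (O : nat -> bool) : nat -> bool :=
  fun i => if a is Some (j, v) then if r && (i == j) then v else O i else O i.
Definition act (r : bool) (g : block_t) : block_t :=
  put g (setf (fl g) 1 (fl g 1 || (r && setB (sc g)))) (sc g) (updO r (setO (sc g)) (t3 g)).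
Definition toggle (g : block_t) : block_t :=
  put g (setf (setf (setf (fl g) 2 (~~ fl g 2)) 3 (~~ fl g 3)) 4 false) (sc g) (t3 g).
Definition commit (take : bool) (g : block_t) : block_t :=
  put g (setf (setf (fl g) 0 (if take then fl g 1 else fl g 0)) 1 false) (pc g) (t3 g).
Definition commit0 (take : bool) (g : block_t) : block_t :=
  put g (setf (setf (setf (setf (fl (commit take g)) 2 true) 3 false) 4 true) 5 true) (pc g) (t3 g).
Definition passes (g : block_t) : bool := test (sc g) (fl g 0) (xb g).

(** State 0 selects the kind of pass. State 1 compares to the right until the next row begins; state
    2 brings the verdict back to the marked block 0. States 3, 4 and 5 act on a block while the
    verdict is still in force, copy its script entry one block to the left, and return. State 6
    continues a commit. *)
Definition rdelta (q : rstate) (g : block_t) : option rstate * block_t * bool :=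
  let: (k, r, c) := q in
  match nat_of_ord k with
  | 0 => if fl g 2 != fl g 3 then
           if fl g 4 && fl g 0 then (None, g, true)
           else (Some (if go (sc g) && passes g then rs' 1 false else rs' 3 false), toggle g, true)
         else (Some (rs' 6 (fl g 2 && ~~ fl g 4)), commit0 (fl g 2 && ~~ fl g 4) g, true)
  | 1 => if go (sc g) then (Some (rs' 2 true), g, false)
         else if passes g then (Some (rs' 1 false), g, true)
         else (Some (rs' 2 false), g, false)
  | 2 => if fl g 5 then (Some (rs' 3 r), act r g, true) else (Some (rs' 2 r), g, false)
  | 3 => let r' := r && ~~ go (sc g) in (Some (rs 4 r' (sc g)), act r' g, false)
  | 4 => (Some (rs' 5 r), put g (fl g) c (t3 g), true)
  | 5 => (Some (rs' 3 r), g, true)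
  | _ => (Some (rs' 6 r), commit r g, true)
  end.

Let P := block_program r0 rdelta.
Notation bnx := (bnx rdelta).
Notation halting := (halting rdelta).
Notation okconf := (okconf rdelta).

Section Commit.
Variables (tau : nat -> block_t).
Hypothesis Hf : fl (tau 0) 2 = fl (tau 0) 3.
(** Flags 2 and 3 differ during a round and both have limsup 1 at its end, so equal flags call for a
    commit. Flag 4 is then 0, having been on in the first pass only; at a limit of rounds its limsup
    is 1, and at the very start flag 2 is still 0. Thus [take] singles out the end of a round; in
    the two other cases the state bits are kept. *)
Let take := fl (tau 0) 2 && ~~ fl (tau 0) 4.

Definition committed (m : nat) : block_t := if m == 0 then commit0 take (tau 0) else commit take (tau m).

Lemma commit_pass s : at_state K r0 s r0 -> pass P s (assemble tau) (assemble committed).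
Proof.
move=> Hs; pose c k : bconf K rstate :=
  if k is 0 then (r0, 0, tau) else (rs' 6 take, k, fun m => if m < k then committed m else tau m).
apply: (@pass_of_chain _ Kpos _ _ _ _ _ _ c) => // -[|k].
  exists 1 => //; split.
    rewrite /= /rs inordK //= Hf eqxx /= -Hf -/take; congr pair.
    by apply: functional_extensionality => -[].
  case=> // _; split=> // [|m]; last exact: bbtw_l.
  by rewrite /halting /= /rs inordK //= Hf eqxx.
exists 1 => //; split.
  rewrite /= /rs inordK //=; congr pair.
  apply: functional_extensionality => m; rewrite /updb ltnn.
  by case: eqP => [->|ne]; [rewrite ltnS leqnn|have -> : (m < k.+2) = (m < k.+1) by lia].
case=> // _; split=> //= [|m|m hm].
- by rewrite /halting /= /rs inordK.
- by case: ifP => _; [apply: bbtw_r|apply: bbtw_l].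
- by rewrite ifT //; lia.
Qed.
End Commit.

Lemma halting_pass tau s : at_state K r0 s r0 -> fl (tau 0) 2 != fl (tau 0) 3 ->
  fl (tau 0) 4 -> fl (tau 0) 0 ->
  exists2 n, (forall i, i < n -> st (iter i (step P) (mkc s 0 (assemble tau))) <> q_halt) &
    st (iter n (step P) (mkc s 0 (assemble tau))) = q_halt /\
    tape3 (iter n (step P) (mkc s 0 (assemble tau))) = tape3 (mkc s 0 (assemble tau)).
Proof.
move=> Hs H1 H2 H3; have Hd : rdelta r0 (tau 0) = (None, tau 0, true).
  by rewrite /r0 /rs /= inordK //= H1 H2 H3.
exists (3 * K) => [i hi|].
  have := @block_step_between K Kpos rstate r0 rdelta r0 0 (assemble tau) None (tau 0) true.
  rewrite block_assemble; last exact: Kpos.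
  by move=> /(_ Hd s i Hs hi) /=; rewrite muln0 => -[].
have := @block_step_final K Kpos rstate r0 rdelta r0 0 (assemble tau) None (tau 0) true.
rewrite block_assemble; last exact: Kpos.
move=> /(_ Hd s Hs); rewrite muln0 setblock_assemble updb_id => -[s' [-> ->]].
by [].
Qed.

Section RowPass.
Variables (tau : nat -> block_t) (N : nat).
Hypotheses (Hfg : fl (tau 0) 2 != fl (tau 0) 3) (Hh : ~~ (fl (tau 0) 4 && fl (tau 0) 0))
  (Hmk : forall k, fl (tau k) 5 = (k == 0)).
Hypotheses (N0 : 0 < N) (goN : go (sc (tau N)))
  (ngo : forall k, 0 < k < N -> ~~ go (sc (tau k))).

Definition matched : bool := go (sc (tau 0)) && all (fun k => passes (tau k)) (iota 0 N).
Definition rr (k : nat) : bool := matched && (k < N).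
Definition tau1 (k : nat) : block_t := if k == 0 then toggle (tau 0) else tau k.
Definition mid (k : nat) : block_t := act (rr k) (tau1 k).
Definition fin (k : nat) : block_t := put (mid k) (fl (mid k)) (sc (tau k.+1)) (t3 (mid k)).

Lemma sc_tau1 k : sc (tau1 k) = sc (tau k).
Proof. by rewrite /tau1; case: eqP => // ->; rewrite /toggle sc_put. Qed.
Lemma t1_tau1 k r : r < K -> t1 (tau1 k) r = t1 (tau k) r.
Proof. by move=> hr; rewrite /tau1; case: eqP => // ->; rewrite /toggle t1_put. Qed.
Lemma t3_tau1 k r : r < K -> t3 (tau1 k) r = t3 (tau k) r.
Proof. by move=> hr; rewrite /tau1; case: eqP => // ->; rewrite /toggle t3_put. Qed.
Lemma fl_tau1 k r : r < h -> fl (tau1 k) r =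
  if k == 0 then setf (setf (setf (fl (tau 0)) 2 (~~ fl (tau 0) 2)) 3 (~~ fl (tau 0) 3)) 4 false r
  else fl (tau k) r.
Proof. by move=> hr; rewrite /tau1; case: eqP => // _; rewrite /toggle fl_put. Qed.

Lemma sc_mid k : sc (mid k) = sc (tau k). Proof. by rewrite /mid /act sc_put sc_tau1. Qed.
Lemma t1_mid k r : r < K -> t1 (mid k) r = t1 (tau k) r.
Proof. by move=> hr; rewrite /mid /act t1_put // t1_tau1. Qed.
Lemma t3_mid k r : r < K -> t3 (mid k) r = updO (rr k) (setO (sc (tau k))) (t3 (tau k)) r.
Proof.
move=> hr; rewrite /mid /act t3_put // sc_tau1 /updO.
by case: setO => [[j v]|]; rewrite t3_tau1.
Qed.
Lemma fl_mid k r : r < h ->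
  fl (mid k) r = if r == 1 then fl (tau k) 1 || (rr k && setB (sc (tau k))) else fl (tau1 k) r.
Proof.
move=> hr; rewrite /mid /act fl_put // sc_tau1 /setf; case: eqP => // e.
by rewrite fl_tau1; [case: eqP => // ->|rewrite -e].
Qed.

Lemma t1_fin k r : r < K -> t1 (fin k) r = t1 (tau k) r.
Proof. by move=> hr; rewrite /fin t1_put // t1_mid. Qed.
Lemma sc_fin k : sc (fin k) = sc (tau k.+1). Proof. by rewrite /fin sc_put. Qed.
Lemma t3_fin k r : r < K -> t3 (fin k) r = updO (rr k) (setO (sc (tau k))) (t3 (tau k)) r.
Proof. by move=> hr; rewrite /fin t3_put // t3_mid. Qed.
Lemma fl_fin k r : r < h ->
  fl (fin k) r = if r == 1 then fl (tau k) 1 || (rr k && setB (sc (tau k))) else fl (tau1 k) r.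
Proof. by move=> hr; rewrite /fin fl_put // fl_mid. Qed.

Lemma bbtw_mid k : bbtw (mid k) (tau k) (fin k).
Proof.
apply: bbtwP; first by move=> r; exact: t1_mid.
- by move=> r hr; right; rewrite fl_mid // fl_fin.
- by left; rewrite sc_mid.
- by move=> r hr; right; rewrite t3_mid // t3_fin.
Qed.

Lemma bbtw_tau1 k : bbtw (tau1 k) (tau k) (fin k).
Proof.
apply: bbtwP; first by move=> r; exact: t1_tau1.
- move=> r hr; rewrite fl_fin //; case: eqP => [->|_]; last by right.
  by left; rewrite fl_tau1; [case: eqP => // ->|lia].
- by left; rewrite sc_tau1.
- by move=> r hr; left; rewrite t3_tau1.
Qed.

Lemma passes_tau1 k : 0 < k -> passes (tau1 k) = passes (tau k).
Proof. by rewrite /tau1; case: k. Qed.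

Definition reaches (b b' : bconf K rstate) : Prop :=
  exists n, iter n bnx b = b' /\ forall i, i < n -> okconf tau fin 0 (iter i bnx b).

Lemma reaches_step b b' : okconf tau fin 0 b -> reaches (bnx b) b' -> reaches b b'.
Proof.
move=> ob [n [<- Hn]]; exists n.+1; split; first by rewrite iterSr.
by case=> // i hi; rewrite iterSr; apply: Hn.
Qed.

Definition swept1 (m : nat) : block_t := if m == 0 then mid 0 else tau m.

Lemma rr0 : rr 0 = matched. Proof. by rewrite /rr N0 andbT. Qed.

Lemma ok_tau1 q k : ~~ halting (q, k, tau1) -> okconf tau fin 0 (q, k, tau1).
Proof. by move=> H; split=> // m; apply: bbtw_tau1. Qed.

Lemma back_reaches k : reaches (rs' 2 matched, k, tau1) (rs' 3 matched, 1, swept1).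
Proof.
elim: k => [|k IH]; apply: reaches_step.
- by apply: ok_tau1; rewrite /halting /= /rs inordK //=; case: ifP.
- exists 0; split=> //=; rewrite /rs inordK //=.
  rewrite fl_tau1 /= ?/setf /= ?Hmk //=.
  congr pair; apply: functional_extensionality => m; rewrite /updb /swept1.
  case: eqP => [_|]; first by rewrite -rr0.
  by rewrite /tau1; case: m.
- by apply: ok_tau1; rewrite /halting /= /rs inordK //=; case: ifP.
- by move: IH; rewrite /= {2}/rs' /rs inordK //= Hmk /= updb_id.
Qed.

Lemma cmp_reaches d k : k + d = N -> 0 < k -> go (sc (tau 0)) ->
  (forall i, i < k -> passes (tau i)) -> reaches (rs' 1 false, k, tau1) (rs' 3 matched, 1, swept1).
Proof.
elim: d k => [|d IH] k kd k0 g0 Hk; apply: reaches_step.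
- apply: ok_tau1; rewrite /halting /= /rs inordK //=.
  by case: ifP => // _; case: ifP.
- have ek : k = N by lia.
  rewrite /= {1}/rs' /rs inordK //= sc_tau1 ek goN /= updb_id.
  have <- : matched = true.
    by rewrite /matched g0; apply/allP => i; rewrite mem_iota /= => hi; apply: Hk; lia.
  exact: back_reaches.
- apply: ok_tau1; rewrite /halting /= /rs inordK //=.
  by case: ifP => // _; case: ifP.
- rewrite /= {1}/rs' /rs inordK //= sc_tau1 (negbTE (ngo _)); last lia.
  rewrite passes_tau1 //; case: ifP => pk /=; rewrite updb_id.
    apply: IH => //; first lia.
    by move=> i hi; case: (ltnP i k) => hik; [apply: Hk|have -> : i = k by lia].
  have <- : matched = false.
    rewrite /matched; apply/negP => /andP [_ /allP /(_ k)].
    by rewrite mem_iota pk /= add0n => H; have : false by apply: H; lia.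
  exact: back_reaches.
Qed.

Definition swept k (m : nat) : block_t :=
  if m.+1 < k then fin m else if m.+1 == k then mid m else tau m.

Lemma swept_1 : swept 1 = swept1.
Proof. by apply: functional_extensionality => -[]. Qed.

Lemma start_reaches : exists2 n, 0 < n & iter n bnx (r0, 0, tau) = (rs' 3 (rr 0), 1, swept 1) /\
  forall i, i < n -> okconf tau fin 0 (iter i bnx (r0, 0, tau)).
Proof.
rewrite swept_1.
have ok0 : okconf tau fin 0 (r0, 0, tau).
  split=> // [|m]; last exact: bbtw_l.
  by rewrite /halting /= /rs inordK //= Hfg (negbTE Hh).
have E1 : bnx (r0, 0, tau) =
  (if go (sc (tau 0)) && passes (tau 0) then rs' 1 false else rs' 3 false, 1, tau1).
  by rewrite /= /rs inordK //= Hfg (negbTE Hh) /=; congr pair.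
have [n [En Hn]] : reaches (bnx (r0, 0, tau)) (rs' 3 (rr 0), 1, swept1).
  rewrite E1 rr0; case: ifP => [/andP [g0 p0]|np].
    apply: (@cmp_reaches N.-1) => //; first lia.
    by case.
  have mf : matched = false.
    rewrite /matched; apply/negP => /andP [g0 /allP /(_ 0)].
    by rewrite mem_iota N0 g0 /= in np * => H; rewrite np in H; have : false by apply: H.
  (* Without a match block 0 is skipped, which is harmless because acting with verdict false is the
     identity. *)
  exists 0; split=> //=; rewrite mf; congr pair.
  apply: functional_extensionality => m; rewrite /swept1 /tau1; case: eqP => // _.
  rewrite /mid rr0 mf /act /= orbF -[LHS]put_eta; apply: put_ext => //.
    by move=> r _; rewrite /setf; case: eqP => // ->.
  by move=> r _; rewrite /updO; case: setO => // -[].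
exists n.+1 => //; split; first by rewrite iterSr.
by case=> // i hi; rewrite iterSr; apply: Hn.
Qed.

Lemma rrS k : rr k && ~~ go (sc (tau k.+1)) = rr k.+1.
Proof.
rewrite /rr; case: matched => //=.
case: (ltnP k.+1 N) => h1; first by rewrite ngo //; lia.
case: (ltnP k N) => //= h2; have -> : k.+1 = N by lia.
by rewrite goN.
Qed.

Lemma bbtw_swept k m : bbtw (swept k m) (tau m) (fin m).
Proof.
rewrite /swept; case: ifP => _; first exact: bbtw_r.
by case: ifP => _; [apply: bbtw_mid|apply: bbtw_l].
Qed.

Lemma row_pass s : at_state K r0 s r0 -> pass P s (assemble tau) (assemble fin).
Proof.
move=> Hs; pose c k : bconf K rstate :=
  if k is k'.+1 then (rs' 3 (rr k'), k, swept k) else (r0, 0, tau).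
apply: (@pass_of_chain _ Kpos _ _ _ _ _ _ c) => // -[|k]; first exact: start_reaches.
(* Three block steps lead to the next checkpoint: act on block [k.+1] and pick up its script entry,
   store the entry in block [k], step back over block [k.+1]. *)
pose b1 : bconf K rstate := (rs 4 (rr k.+1) (sc (tau k.+1)), k,
  fun m => if m < k then fin m else if m <= k.+1 then mid m else tau m).
pose b2 : bconf K rstate := (rs' 5 (rr k.+1), k.+1, swept k.+2).
have E1 : bnx (c k.+1) = b1.
  rewrite /= {1}/rs' /rs inordK //= /b1.
  have -> : swept k.+1 k.+1 = tau k.+1 by rewrite /swept ifF ?ifF //; lia.
  rewrite rrS; congr pair; apply: functional_extensionality => m; rewrite /updb /swept.
  case: eqP => [->|ne]; first by rewrite ifF ?ltnSn //; lia.
  rewrite ltnS; case: ltnP => // h1; rewrite eqSS; case: eqP => [->|ne2]; first by rewrite leqnSn.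
  by rewrite ifF //; lia.
have E2 : bnx b1 = b2.
  rewrite /= /rs inordK //= /b2 ltnn leqnSn; congr pair.
  apply: functional_extensionality => m; rewrite /updb /swept.
  case: eqP => [->|ne]; first by rewrite ltnSn.
  rewrite ltnS eqSS; case: (ltnP m k) => h1; first by rewrite ifT //; lia.
  have -> : (m < k.+1) = false by lia.
  by case: eqP => [->|ne2]; [rewrite leqnn|have -> : (m <= k.+1) = false by lia].
have E3 : bnx b2 = c k.+2.
  by rewrite /= /rs' /rs inordK //= updb_id.
exists 3 => //; split; first by rewrite !iterS E1 E2 E3.
have E2' : iter 2 bnx (c k.+1) = b2 by rewrite iterS -E2 -E1.
case=> [|[|[|//]]] _; rewrite ?E2' ?(E1 : iter 1 bnx (c k.+1) = b1).
- split=> /=; [by rewrite /halting /= /rs inordK| |].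
    exact: bbtw_swept.
  by move=> m hm; rewrite /swept hm.
- split=> /=; [by rewrite /halting /= ?/rs' /rs inordK| |].
    move=> m; case: ifP => _; first exact: bbtw_r.
    by case: ifP => _; [apply: bbtw_mid|apply: bbtw_l].
  by move=> m hm; rewrite ifT.
- split=> /=; [by rewrite /halting /= /rs' /rs inordK| |].
    exact: bbtw_swept.
  by move=> m hm; rewrite /swept ifT //; lia.
Qed.
End RowPass.
End RowMachine.

(** * Runs composed of passes *)

Section LexNat.
Variable U : wo.
Notation V := (lexwo U natwo).

Lemma lex_succ (u : U) n : wsucc ((u, n) : V) (u, n.+1).
Proof.
split; first by right; split=> //=.
move=> [u' n'] [/= [h1|[/= e1 h1]] [h2|[/= e2 h2]]].
- by apply: (wlt_irr (wlt_trans h1 h2)).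
- by rewrite /= e2 in h1; apply: (wlt_irr h1).
- by rewrite /= -e1 in h2; apply: (wlt_irr h2).
- by move: h1 h2; rewrite /wlt /=; lia.
Qed.

Lemma lex_lt0 (v u : U) n : ((u, n) : V) <w (v, 0) <-> u <w v.
Proof. by split=> [[//|[_]]|h]; [rewrite /wlt /=; lia|left]. Qed.

Lemma lex_lim (v u : U) : u <w v -> wlim ((v, 0) : V).
Proof.
move=> h; split; first by exists (u, 0); left.
move=> [u' n] /lex_lt0 h'; exists (u', n.+1); split; last by left.
by right; split=> //=.
Qed.

Lemma cofinally_succ (u v : U) (Q : V -> Prop) : wsucc u v ->
  cofinally ((v, 0) : V) Q <-> forall n0, exists n, n0 < n /\ Q (u, n).
Proof.
move=> s; split=> H.
  move=> n0; have [|[u' n] [h1 [/lex_lt0 h2 h3]]] := H (u, n0); first by left; case: s.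
  have hle := wsucc_le s h2.
  case: h1 => [/= h1|[/= e h1]]; first by case: (wlt_ge h1).
  by exists n; rewrite e.
move=> [u' n'] /lex_lt0 h; have [n [h1 h2]] := H n'.
exists (u, n); split; last by split=> //; apply/lex_lt0; case: s.
by case: (wsucc_le s h) => h'; [left|right].
Qed.

Lemma cofinally_lim (v : U) (Q : V -> Prop) : wlim v ->
  cofinally ((v, 0) : V) Q <-> cofinally v (fun u => exists n, Q (u, n)).
Proof.
move=> l; split=> H.
  move=> j hj; have [j' [h1 h2]] := proj2 l j hj.
  have [|[u n] [h3 [/lex_lt0 h4 h5]]] := H (j', 0); first by apply/lex_lt0.
  exists u; split; last by split=> //; exists n.
  by case: h3 => [/= h3|[/= <- _]] //; apply: wlt_trans h1 h3.
move=> [u n] /lex_lt0 h; have [u' [h1 [h2 [n' h3]]]] := H u h.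
by exists (u', n'); split; [left|split=> //; apply/lex_lt0].
Qed.

Variables (P : program) (inp : real) (c : V -> config).
Hypothesis Hc : fzrun P inp c.

Lemma run_pass u s T T' : c (u, 0) = mkc s 0 T -> pass P s T T' ->
  forall n, c (u, n) = iter n (step P) (mkc s 0 T).
Proof.
move=> E [H _]; elim=> [|n IH] //.
rewrite (fz_succ Hc (lex_succ u n)) IH; have [h _] := H n.
by case: eqP.
Qed.

Lemma run_prefix u s T m : c (u, 0) = mkc s 0 T ->
  (forall i, i < m -> st (iter i (step P) (mkc s 0 T)) <> q_halt) ->
  c (u, m) = iter m (step P) (mkc s 0 T).
Proof.
move=> E; elim: m => [|n IH] H //.
rewrite (fz_succ Hc (lex_succ u n)) IH; last by move=> i hi; apply: H; lia.
by case: eqP => // e; case: (H n).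
Qed.

Lemma pass_nonhalting u s T T' n v : c (u, 0) = mkc s 0 T -> pass P s T T' ->
  v <=w ((u, n) : V) -> st (c v) <> q_halt.
Proof.
move=> E Hp Hv sv; have := fz_const Hc Hv sv.
rewrite (run_pass E Hp) => e; have [h _] := (proj1 Hp) n.
by rewrite e in h.
Qed.

(** Every cell is constant from some step of the pass on, and its limsup is that constant. *)
Lemma pass_next u v s T T' : wsucc u v -> c (u, 0) = mkc s 0 T -> pass P s T T' ->
  c (v, 0) = mkc q_limit 0 T'.
Proof.
move=> uv E Hp; have [_ Hev] := Hp.
rewrite (fz_lim Hc); last 2 first.
- exact: lex_lim (proj1 uv).
- move=> [u' n] /lex_lt0 h; apply: (pass_nonhalting E Hp (n := n)).
  by case: (wsucc_le uv h) => [h'|->]; [left; left|right].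
apply: config_ext => //=; apply: functional_extensionality => n; apply: bool_ext;
  rewrite decbP (cofinally_succ _ uv); have [N HN] := Hev n;
  (split=> [H|e n0]; [have [m [h1]] := H N|exists (n0 + N).+1; split; first lia]);
  rewrite (run_pass E Hp).
- by rewrite -(HN m) // ltnW.
- by move: e; rewrite -(HN (n0 + N).+1) //; lia.
- by rewrite -(HN m) // ltnW.
- by move: e; rewrite -(HN (n0 + N).+1) //; lia.
- by rewrite -(HN m) // ltnW.
- by move: e; rewrite -(HN (n0 + N).+1) //; lia.
Qed.
(** A 1 seen in the middle of a pass is already there at the start of this pass or at the start of
    the next one, which is still below the limit. So only starts of passes count for the limsup. *)
Lemma pass_lim (nx : U -> U) v : wlim v -> (forall u, wsucc u (nx u)) ->
  (forall u, u <w v -> exists2 s, c (u, 0) = mkc s 0 (cells (c (u, 0))) &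
     pass P s (cells (c (u, 0))) (cells (c (nx u, 0)))) ->
  c (v, 0) = mkc q_limit 0 (fun n =>
    (decb (cofinally v (fun u => tape1 (c (u, 0)) n = true)),
     decb (cofinally v (fun u => tape2 (c (u, 0)) n = true)),
     decb (cofinally v (fun u => tape3 (c (u, 0)) n = true)))).
Proof.
move=> lv Hnx H; have [[w hw] _] := lv.
have nxlt u : u <w v -> nx u <w v.
  move=> hu; case: (wltVge (nx u) v) => // -[hv|e].
    by case: (proj2 (Hnx u) v).
  by case: (wlim_not_succ lv (j := u)); rewrite e.
rewrite (fz_lim Hc); last 2 first.
- exact: lex_lim hw.
- move=> [u n] /lex_lt0 h; have [s E Hp] := H u h.
  by apply: (pass_nonhalting E Hp (n := n)); right.
have key (f : config -> nat -> bool) n :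
    (forall u m, u <w v -> f (c (u, m)) n = true ->
       f (c (u, 0)) n = true \/ f (c (nx u, 0)) n = true) ->
    cofinally ((v, 0) : V) (fun k => f (c k) n = true) <->
    cofinally v (fun u => f (c (u, 0)) n = true).
  move=> Hf; rewrite (cofinally_lim _ lv); split=> C j hj.
    have [u [h1 [h2 [m h3]]]] := C j hj.
    case: (Hf u m h2 h3) => h4; first by exists u.
    exists (nx u); split; first by apply: wlt_trans h1 _; case: (Hnx u).
    by split=> //; apply: nxlt.
  by have [u [h1 [h2 h3]]] := C j hj; exists u; do ?split=> //; exists 0.
apply: config_ext => //=; apply: functional_extensionality => n; congr decb;
  apply: propositional_extensionality; [apply: (key tape1)|apply: (key tape2)|apply: (key tape3)];
  move=> u m hu; have [s E Hp] := H u hu; have [_ /(_ n) [h1 h2 h3]] := proj1 Hp m;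
  rewrite (run_pass E Hp m) => e.
- by case: h1 => h1; [left|right]; rewrite -e; symmetry; apply: h1.
- by case: h2 => h2; [left|right]; rewrite -e; symmetry; apply: h2.
- by case: h3 => h3; [left|right]; rewrite -e; symmetry; apply: h3.
Qed.
End LexNat.

Lemma rpair_even x y n : rpair x y (2 * n) = x n.
Proof. by rewrite /rpair PeanoNat.Nat.even_even PeanoNat.Nat.div2_double. Qed.

Lemma rpair_odd x y n : rpair x y (2 * n + 1) = y n.
Proof. by rewrite /rpair PeanoNat.Nat.even_odd addn1 PeanoNat.Nat.div2_succ_double. Qed.

(** * Rounds of passes as single steps of the iteration *)

Section Rounds.
Variables (h : nat) (h6 : 6 <= h).
Let K := 2 * h.
Notation code := (h.-tuple bool).
Variables (go : code -> bool) (test : code -> bool -> (nat -> bool) -> bool)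
  (setB : code -> bool) (setO : code -> option (nat * bool)).
Hypothesis test_ext : forall S a f g, (forall i, i < h -> f i = g i) -> test S a f = test S a g.
Variables (base : nat -> code) (x : real) (Want : real -> nat -> Prop) (out : nat -> nat).

Definition next_go (t N : nat) : Prop :=
  [/\ 0 < N, go (base (t + N)) & forall k, 0 < k < N -> ~~ go (base (t + k))].
(* The row of the script that starts at [t] and has length [N] matches the state [s]. *)
Definition fires (t N : nat) (s : real) : Prop :=
  [/\ go (base t), next_go t N &
    forall k, k < N -> test (base (t + k)) (s k) (fun i => x (h * k + i))].

Hypothesis next_go_ex : forall t, exists N, next_go t N.
Hypothesis soundB : forall t N s k, fires t N s -> k < N -> setB (base (t + k)) -> Want s k.
Hypothesis completeB : forall s k, Want s k ->
  exists t N, [/\ fires t N s, k < N & setB (base (t + k))].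
Hypothesis soundO : forall t N s k r v, fires t N s -> k < N ->
  setO (base (t + k)) = Some (r, v) -> r < K -> s (out (K * k + r)) = v.
Hypothesis completeO : forall s j,
  exists t N, [/\ fires t N s, j %/ K < N & setO (base (t + j %/ K)) = Some (j %% K, s (out j))].

Definition script : real := fun j => nth false (base (j %/ h)) (j %% h).
Let inp := rpair x script.
Let P := block_program (r0 h) (rdelta go test setB setO).
Let K0 : 0 < K. Proof. by rewrite /K; lia. Qed.

Definition static (T : nat -> cell) := forall n, (T n).1.1 = inp n.

Lemma xb_static T k i : static T -> i < h -> xb (block K T k) i = x (h * k + i).
Proof.
move=> sT hi; rewrite /xb /t1 nth_mkblock; last by rewrite /K; lia.
by rewrite sT /inp -(rpair_even x script); congr rpair; rewrite /K; lia.
Qed.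

Lemma pc_static T k : static T -> pc (block K T k) = base k.
Proof.
move=> sT; apply: code_ext => i hi; rewrite nth_mkseq // /t1 nth_mkblock; last by rewrite /K; lia.
have -> : K * k + (2 * i + 1) = 2 * (h * k + i) + 1 by rewrite /K; lia.
rewrite sT /inp rpair_odd /script mulnC divnMDl ?modnMDl ?divn_small ?addn0 ?modn_small //.
lia.
Qed.

Lemma fl_block T k r : r < K -> fl (block K T k) r = (T (K * k + r)).1.2.
Proof. by move=> hr; rewrite /fl nth_mkblock. Qed.

Definition Bset t s k : Prop :=
  exists t' N, [/\ t' < t, fires t' N s, k < N & setB (base (t' + k))].

(* The tape after [t] row passes of the round that computes the successor of the state [s];
   during these the script has moved [t] blocks to the left. *)
Definition RT t (s : real) (T : nat -> cell) : Prop :=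
  [/\ static T,
      [/\ fl (block K T 0) 2 = ~~ odd t, fl (block K T 0) 3 = odd t & fl (block K T 0) 4 = (t == 0)],
      [/\ forall k, fl (block K T k) 5 = (k == 0), forall k, fl (block K T k) 0 = s k
        & forall k, sc (block K T k) = base (k + t)]
    & forall k, fl (block K T k) 1 = true <-> Bset t s k].

Lemma static_assemble (tau : nat -> (2 * h).-tuple (bool * bool * bool)) T : static T ->
  (forall k r, r < K -> t1 (tau k) r = t1 (block K T k) r) -> static (assemble tau).
Proof.
move=> sT H n; have hr : n %% K < K by rewrite ltn_pmod.
have := H (n %/ K) _ hr; rewrite /t1 nth_mkblock // => E.
by rewrite /assemble E sT; congr inp; rewrite mulnC -divn_eq.
Qed.

Lemma block_fields T n : (T n).2 = t3 (block K T (n %/ K)) (n %% K).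
Proof.
rewrite /t3 nth_mkblock ?ltn_pmod //.
by congr (T _).2; rewrite mulnC -divn_eq.
Qed.

Lemma fires_matched T t N s : RT t s T -> next_go t N ->
  matched go test (block K T) N = true <-> fires t N s.
Proof.
move=> [sT _ [_ HA HS] _] HN; rewrite /matched.
have pE k : passes test (block K T k) = test (base (t + k)) (s k) (fun i => x (h * k + i)).
  by rewrite /passes HS HA addnC; apply: test_ext => i hi; rewrite xb_static.
split=> [/andP [g0 /allP H]|[g0 _ H]].
  split=> //; first by rewrite HS add0n in g0.
  by move=> k hk; rewrite -pE; apply: H; rewrite mem_iota.
rewrite HS add0n g0; apply/allP => k; rewrite mem_iota => hk.
by rewrite pE; apply: H.
Qed.

Lemma row_step t s T q : RT t s T -> ~~ ((t == 0) && s 0) -> at_state K (r0 h) q (r0 h) ->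
  exists T', [/\ pass P q T T', RT t.+1 s T',
    forall j, (T' j).2 = (T j).2 \/ (T' j).2 = s (out j) &
    forall N j, fires t N s -> j %/ K < N ->
      setO (base (t + j %/ K)) = Some (j %% K, s (out j)) -> (T' j).2 = s (out j)].
Proof.
move=> HR nh Hq; have [sT [f2 f3 f4] [f5 fA fS] fB] := HR.
have [N HN] := next_go_ex t; have [N0 gN nN] := HN.
have FM := fires_matched HR HN.
pose tau := block K T; pose tau' := fin go test setB setO tau N.
have next_inj N' : next_go t N' -> N' = N.
  move=> [h1 h2 h3]; case: (ltngtP N' N) => // hlt.
    by have := nN N'; rewrite h2; lia.
  by have := h3 N; rewrite gN; lia.
have hp : pass P q T (assemble tau').
  rewrite -{1}(@assemble_block K K0 T).
  apply: (row_pass (h := h)) => //.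
  - by rewrite f2 f3; case: odd.
  - by rewrite f4 fA.
  - by rewrite fS addnC.
  - by move=> k hk; rewrite fS addnC; apply: nN.
have bE k : block K (assemble tau') k = tau' k by rewrite block_assemble.
have rrE k : rr go test tau N k = true <-> fires t N s /\ k < N.
  by rewrite /rr; split=> [/andP [/FM]|[/FM -> ->]].
have h5 r : r < 6 -> r < h by move=> h1; apply: leq_trans h6.
have flE k r : r < h -> r != 1 -> fl (block K (assemble tau') k) r =
    if k == 0 then setf (setf (setf (fl (tau 0)) 2 (~~ fl (tau 0) 2)) 3 (~~ fl (tau 0) 3)) 4 false r
    else fl (tau k) r.
  by move=> h1 /negbTE h2; rewrite bE fl_fin // h2 fl_tau1.
have fS' : forall k, sc (tau k) = base (k + t) := fS.
exists (assemble tau'); split=> //.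
- split.
  + by apply: (static_assemble sT) => k r hr; rewrite t1_fin.
  + by split; rewrite flE ?h5 //= /setf /= ?f2 ?f3.
  + split=> k.
    * by rewrite flE ?h5 //; have := f5 k; case: eqP => [->|_] e; rewrite /setf /= -e.
    * by rewrite flE ?h5 //; have := fA k; case: eqP => [->|_] e; rewrite /setf /= -e.
    * by rewrite bE sc_fin // fS' addSnnS.
  + move=> k; rewrite bE fl_fin //=; last exact: h5.
    split=> [/orP [/fB [t' [N' [h1 h2 h3 h4]]]|/andP [/rrE [h1 h2]]]|].
    * by exists t', N'; split=> //; lia.
    * by rewrite fS' addnC => h3; exists t, N.
    * move=> [t' [N' [h1 h2 h3 h4]]]; apply/orP.
      (* Rows that start before [t] were treated in earlier passes; this pass adds exactly the row
         that starts at [t]. *)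
      have [e|ne] := eqVneq t' t; last first.
        by left; apply/fB; exists t', N'; split=> //; lia.
      right; subst t'; have eN : N' = N by apply: next_inj; case: h2.
      by subst N'; rewrite fS' addnC h4 andbT; apply/rrE.
- move=> j; rewrite !block_fields bE t3_fin ?ltn_pmod // /updO fS' addnC.
  case Eo: setO => [[r v]|]; last by left.
  case: ifP => [/andP [/rrE [h1 h2] /eqP er]|_]; [right|by left].
  rewrite -(soundO h1 h2 Eo) -?er ?ltn_pmod //.
  by congr (s (out _)); rewrite mulnC -divn_eq.
- move=> N' j h1 h2 h3.
  have eN : N' = N by apply: next_inj; case: h1.
  subst N'; rewrite block_fields bE t3_fin ?ltn_pmod // /updO fS' addnC h3 eqxx andbT.
  by have -> : rr go test tau N (j %/ K) by apply/rrE.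
Qed.

Lemma commit_step T s q : static T -> fl (block K T 0) 2 = fl (block K T 0) 3 ->
  (forall k, k != 0 -> fl (block K T k) 5 = false) ->
  (forall k, s k = if fl (block K T 0) 2 && ~~ fl (block K T 0) 4
                   then fl (block K T k) 1 else fl (block K T k) 0) ->
  at_state K (r0 h) q (r0 h) ->
  exists T', [/\ pass P q T T', RT 0 s T' & forall j, (T' j).2 = (T j).2].
Proof.
move=> sT e23 f5 Hs Hq; pose tau := block K T; pose tau' := committed tau.
have bE k : block K (assemble tau') k = tau' k by rewrite block_assemble.
exists (assemble tau'); split.
- rewrite -{1}(@assemble_block K K0 T).
  exact: (commit_pass (h := h)).
- split.
  + apply: (static_assemble sT) => k r hr; rewrite /tau' /committed.
    by case: eqP => [->|_]; rewrite t1_put.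
  + by split; rewrite bE /tau' /committed /= fl_put //; lia.
  + split=> k; rewrite bE /tau' /committed.
    * case: eqP => [_|/eqP ne]; first by rewrite fl_put.
      by rewrite fl_put //= /setf /= f5.
    * rewrite Hs; case: eqP => [->|_]; rewrite fl_put /= /setf /= ?fl_put //=; lia.
    * rewrite addn0 -(pc_static k sT).
      by case: eqP => [->|_]; rewrite sc_put.
  + move=> k; rewrite bE /tau' /committed.
    have -> : fl (if k == 0 then commit0 (fl (tau 0) 2 && ~~ fl (tau 0) 4) (tau 0)
       else commit (fl (tau 0) 2 && ~~ fl (tau 0) 4) (tau k)) 1 = false.
      by case: eqP => _; rewrite fl_put /= /setf /= ?fl_put //=; lia.
    by split=> // -[t' [N' []]].
- move=> j; rewrite !block_fields bE /tau' /committed.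
  by case: eqP => [->|_]; rewrite t3_put ?ltn_pmod.
Qed.

Definition macro_iter (W : wo) (s : W -> real) : Prop :=
  [/\ forall a, wmin a -> forall n, s a n = false,
      forall b a, wsucc b a -> forall n, s a n = true <-> Want (s b) n &
      forall a, wlim a -> forall n, s a n = true <-> cofinally a (fun b => s b n = true)].

Section MacroRun.
Variables (W : wo) (s : W -> real).
Hypothesis Hs : macro_iter s.
Notation U := (lexwo W natwo).
Notation V := (lexwo U natwo).
Variable c : V -> config.
Hypothesis Hc : fzrun P inp c.

(** Stage [((a, i), n)] is step [n] of pass [i] in round [a]. Pass 0 commits the state [s a], and
    pass [t.+1] treats script position [t]. *)
Definition cf (a : W) (i : nat) : config := c ((a, i), 0).
Definition Tp (a : W) (i : nat) : nat -> cell := cells (cf a i).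
Notation bl a i k := (block K (Tp a i) k).

Definition pass_at a i : Prop :=
  exists2 q, cf a i = mkc q 0 (Tp a i) & pass P q (Tp a i) (Tp a i.+1).

Lemma pass_atP a i q T : at_state K (r0 h) q (r0 h) -> cf a i = mkc q 0 (Tp a i) ->
  pass P q (Tp a i) T ->
  [/\ pass_at a i, Tp a i.+1 = T & cf a i.+1 = mkc q_limit 0 (Tp a i.+1)].
Proof.
move=> Hq E Hp; have E' := pass_next Hc (lex_succ a i) E Hp.
have ET : Tp a i.+1 = T by rewrite /Tp /cf E' cells_mkc.
by split=> //; [exists q; rewrite ?ET|rewrite ET].
Qed.

Definition round (a : W) : Prop := forall t,
  [/\ pass_at a t.+1, RT t (s a) (Tp a t.+1),
      forall j, (Tp a t.+2 j).2 = (Tp a t.+1 j).2 \/ (Tp a t.+2 j).2 = s a (out j) &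
      forall N j, fires t N (s a) -> j %/ K < N ->
        setO (base (t + j %/ K)) = Some (j %% K, s a (out j)) -> (Tp a t.+2 j).2 = s a (out j)].

(** The clause [op_state] is for limits of rounds: before the commit a block may still show the
    state of the previous round, but that round lies below the same limit, so the limsup of the
    state bits is not spoiled. *)
Record opened (a : W) : Prop := {
  op_static : static (Tp a 0);
  op_mark : forall k, k != 0 -> fl (bl a 0 k) 5 = false;
  op_state : forall k, fl (bl a 0 k) 0 = true ->
    s a k = true \/ exists2 b, wsucc b a & s b k = true;
  op_pass : pass_at a 0;
  op_RT : RT 0 (s a) (Tp a 1);
  op_cf : cf a 1 = mkc q_limit 0 (Tp a 1);
  op_out : forall j, (Tp a 1 j).2 = (Tp a 0 j).2 }.

Lemma opened_of_commit a q : at_state K (r0 h) q (r0 h) -> cf a 0 = mkc q 0 (Tp a 0) ->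
  static (Tp a 0) -> fl (bl a 0 0) 2 = fl (bl a 0 0) 3 ->
  (forall k, k != 0 -> fl (bl a 0 k) 5 = false) ->
  (forall k, s a k = if fl (bl a 0 0) 2 && ~~ fl (bl a 0 0) 4 then fl (bl a 0 k) 1 else fl (bl a 0 k) 0) ->
  (forall k, fl (bl a 0 k) 0 = true -> s a k = true \/ exists2 b, wsucc b a & s b k = true) ->
  opened a.
Proof.
move=> Hq E sT e23 f5 Hsa Hst.
have [T' [h1 h2 h3]] := commit_step sT e23 f5 Hsa Hq.
have [k1 k2 k3] := pass_atP Hq E h1.
by split=> //; rewrite ?k2.
Qed.

Lemma round_of_opened a : opened a -> s a 0 = false -> round a.
Proof.
move=> Ho s0; suff H t : RT t (s a) (Tp a t.+1) /\ cf a t.+1 = mkc q_limit 0 (Tp a t.+1).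
  move=> t; have [h1 h2] := H t.
  have Hq := @at_state_limit K _ (r0 h).
  have [|T' [h3 h4 h5 h6']] := row_step h1 _ Hq; first by rewrite s0 andbF.
  have [k1 k2 k3] := pass_atP Hq h2 h3.
  by split=> //; rewrite k2.
elim: t => [|t [h1 h2]]; first by split; [exact: op_RT|exact: op_cf].
have Hq := @at_state_limit K _ (r0 h).
have [|T' [h3 h4 h5 h6']] := row_step h1 _ Hq; first by rewrite s0 andbF.
have [k1 k2 k3] := pass_atP Hq h2 h3.
by split=> //; rewrite k2.
Qed.

Lemma Tp_lim a b : b <w a -> (forall b i, b <w a -> pass_at b i) ->
  cf a 0 = mkc q_limit 0 (Tp a 0) /\
  forall n, [/\ (Tp a 0 n).1.1 = true <-> cofinally ((a, 0) : U) (fun u => (Tp u.1 u.2 n).1.1 = true),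
    (Tp a 0 n).1.2 = true <-> cofinally ((a, 0) : U) (fun u => (Tp u.1 u.2 n).1.2 = true) &
    (Tp a 0 n).2 = true <-> cofinally ((a, 0) : U) (fun u => (Tp u.1 u.2 n).2 = true)].
Proof.
move=> hb H; pose nx (u : U) : U := (u.1, u.2.+1).
have snx u : wsucc u (nx u) by case: u => b' i; apply: lex_succ.
have Hu u : u <w ((a, 0) : U) -> exists2 q, c (u, 0) = mkc q 0 (cells (c (u, 0))) &
    pass P q (cells (c (u, 0))) (cells (c (nx u, 0))).
  by case: u => b' i /lex_lt0 hb'; have [q E1 E2] := H b' i hb'; exists q.
have E := pass_lim Hc (lex_lim hb) snx Hu; have E' : Tp a 0 = cells (c ((a, 0), 0)) by [].
rewrite /cf E' E cells_mkc; split=> // n.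
by split; rewrite decbP; apply: cofinally_local => -[b' i] _; rewrite /Tp /cf.
Qed.

Lemma passes_of a : opened a -> round a -> forall i, pass_at a i.
Proof. by move=> Ho Hr [|t]; [exact: op_pass|have [] := Hr t]. Qed.

Lemma cofinally_ev (b a : W) (Q : U -> Prop) (R : Prop) i0 : wsucc b a ->
  (forall i, i0 < i -> Q (b, i) <-> R) -> cofinally ((a, 0) : U) Q <-> R.
Proof.
move=> sb HQ; rewrite (cofinally_succ _ sb); split=> [H|r n0].
  by have [n [h1 h2]] := H i0; apply/(HQ n).
by exists (n0 + i0).+1; split; [lia|apply/HQ => //; lia].
Qed.

(** The alternating flags both have limsup 1, while the buffered bits only grow during round [b];
    their limsup collects the bits set by any row, which are the wanted ones by [soundB] and
    [completeB]. *)
Lemma opened_succ b a : wsucc b a -> (forall b, b <w a -> opened b /\ round b) -> opened a.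
Proof.
move=> sb IH; have [ob rb] := IH b (proj1 sb).
have [E HT] := Tp_lim (proj1 sb) (fun b' i hb' => let: conj o r := IH b' hb' in passes_of o r i).
have K6 r : r < 6 -> r < K by rewrite /K; lia.
have flE k r i0 (R : bool) : r < 6 -> (forall t, i0 <= t -> fl (bl b t.+1 k) r = R) ->
    fl (bl a 0 k) r = R.
  move=> hr H; rewrite fl_block ?K6 //; apply: bool_ext.
  have [_ -> _] := HT (K * k + r); rewrite (@cofinally_ev b a _ (R = true) i0) //.
  by case=> // i hi; cbn [fst snd]; rewrite -(H i) ?fl_block ?K6 //; lia.
have tog k r (e : bool) : r < 6 -> (forall t, odd t = e -> fl (bl b t.+1 k) r = true) ->
    fl (bl a 0 k) r = true.
  move=> hr H; rewrite fl_block ?K6 //; have [_ -> _] := HT (K * k + r).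
  rewrite (cofinally_succ _ sb) => n0; exists (n0.*2 + e).+1; split; first lia.
  by cbn [fst snd]; rewrite -fl_block ?K6 //; apply: H; rewrite oddD odd_double; case: (e).
have f2 : fl (bl a 0 0) 2 = true.
  by apply: (tog _ _ false) => // t ot; have [_ [_ [-> _ _] _ _] _ _] := rb t; rewrite ot.
have f3 : fl (bl a 0 0) 3 = true.
  by apply: (tog _ _ true) => // t ot; have [_ [_ [_ -> _] _ _] _ _] := rb t; rewrite ot.
have f4 : fl (bl a 0 0) 4 = false.
  by apply: (flE _ _ 1) => // -[|t] // _; have [_ [_ [_ _ ->] _ _] _ _] := rb t.+1.
have fA k : fl (bl a 0 k) 0 = s b k.
  by apply: (flE _ _ 0) => // t _; have [_ [_ _ [_ -> _] _] _ _] := rb t.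
have [_ Hsucc _] := Hs.
apply: (opened_of_commit (at_state_limit _ _) E).
- move=> n; apply: bool_ext; have [-> _ _] := HT n.
  apply: (cofinally_ev (i0 := 0) sb) => -[|t] // _; cbn [fst snd].
  by have [_ [-> _ _ _] _ _] := rb t.
- by rewrite f2 f3.
- move=> k /negbTE k0; apply: (flE _ _ 0) => // t _.
  by have [_ [_ _ [-> _ _] _] _ _] := rb t.
- move=> k; rewrite f2 f4 /=; apply: bool_ext; rewrite (Hsucc _ _ sb).
  rewrite fl_block ?K6 //; have [_ -> _] := HT (K * k + 1).
  rewrite (cofinally_succ _ sb); split=> [w n0|H].
    have [t [N [h1 h2 h3]]] := completeB w.
    exists (n0 + t).+2; split; first lia.
    cbn [fst snd]; rewrite -fl_block ?K6 //; have [_ [_ _ _ fB] _ _] := rb (n0 + t).+1.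
    by apply/fB; exists t, N; split=> //; lia.
  have [[|t] [// _]] := H 0; cbn [fst snd]; rewrite -fl_block ?K6 //.
  have [_ [_ _ _ fB] _ _] := rb t => /fB [t' [N [_ h1 h2 h3]]].
  exact: soundB h1 h2 h3.
- by move=> k; rewrite fA; right; exists b.
Qed.

Lemma opened_lim a : wlim a -> (forall b, b <w a -> opened b /\ round b) -> opened a.
Proof.
move=> la IH; have [[b0 hb0] la2] := la.
have [E HT] := Tp_lim hb0 (fun b' i hb' => let: conj o r := IH b' hb' in passes_of o r i).
have K6 r : r < 6 -> r < K by rewrite /K; lia.
have on k r i : r < 6 -> (forall b, b <w a -> fl (bl b i k) r = true) -> fl (bl a 0 k) r = true.
  move=> hr H; rewrite fl_block ?K6 //; have [_ -> _] := HT (K * k + r).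
  rewrite (cofinally_lim _ la) => j hj; have [b [h1 h2]] := la2 j hj.
  by exists b; do ?split=> //; exists i; cbn [fst snd]; rewrite -fl_block ?K6 //; apply: H.
have f2 : fl (bl a 0 0) 2 = true.
  apply: (on _ _ 1) => // b hb; have [_ rb] := IH b hb.
  by have [_ [_ [-> _ _] _ _] _ _] := rb 0.
have f3 : fl (bl a 0 0) 3 = true.
  apply: (on _ _ 2) => // b hb; have [_ rb] := IH b hb.
  by have [_ [_ [_ -> _] _ _] _ _] := rb 1.
have f4 : fl (bl a 0 0) 4 = true.
  apply: (on _ _ 1) => // b hb; have [_ rb] := IH b hb.
  by have [_ [_ [_ _ ->] _ _] _ _] := rb 0.
have [_ _ Hlim] := Hs.
have fA k : fl (bl a 0 k) 0 = s a k.
  apply: bool_ext; rewrite (Hlim _ la) fl_block ?K6 //; have [_ -> _] := HT (K * k + 0).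
  rewrite (cofinally_lim _ la); split=> C j hj.
    have [j' [j1 j2]] := la2 j hj; have [b [h1 [h2 [i]]]] := C j' j2.
    cbn [fst snd]; rewrite -fl_block ?K6 // => h3; have [ob rb] := IH b h2.
    have hjb := wlt_trans j1 h1.
    case: i h3 => [/(op_state ob) [h3|[b' h3 h4]]|t].
    - by exists b.
    - exists b'; split; last by split=> //; apply: wlt_trans (proj1 h3) h2.
      by apply: wlt_le_trans j1 _; apply: wsucc_le h3 h1.
    - by have [_ [_ _ [_ -> _] _] _ _] := rb t => h3; exists b.
  have [b [h1 [h2 h3]]] := C j hj; exists b; do ?split=> //; exists 1.
  have [ob rb] := IH b h2; cbn [fst snd]; rewrite -fl_block ?K6 //.
  by have [_ [_ _ [_ -> _] _] _ _] := rb 0.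
apply: (opened_of_commit (at_state_limit _ _) E).
- move=> n; apply: bool_ext; have [-> _ _] := HT n.
  rewrite (cofinally_lim _ la).
  apply: (cofinally_const la hb0) => b _ hb; have [ob rb] := IH b hb.
  split=> [[[|t]]|e]; cbn [fst snd]; last by exists 0; cbn [fst snd]; rewrite (op_static ob).
    by rewrite (op_static ob).
  by have [_ [-> _ _ _] _ _] := rb t.
- by rewrite f2 f3.
- move=> k k0; apply: negbTE; apply/negP; rewrite fl_block ?K6 //.
  have [_ H _] := HT (K * k + 5); move/H; rewrite (cofinally_lim _ la) => /(_ b0 hb0).
  move=> [b [_ [hb [i]]]]; have [ob rb] := IH b hb; cbn [fst snd]; rewrite -fl_block ?K6 //.
  case: i => [|t]; first by rewrite (op_mark ob).
  by have [_ [_ _ [-> _ _] _] _ _] := rb t; rewrite (negbTE k0).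
- by move=> k; rewrite f2 f4 /= fA.
- by move=> k; rewrite fA; left.
Qed.

Lemma opened_min a : wmin a -> opened a.
Proof.
move=> ma; have E : cf a 0 = mkc q_start 0 (fun n => (inp n, false, false)).
  rewrite /cf (fz_init Hc) //; move=> [[b i] n] [[/= /ma//|[_]]|[_]]; rewrite /wlt /=; lia.
have ET : Tp a 0 = fun n => (inp n, false, false) by rewrite /Tp E cells_mkc.
have K6 r : r < 6 -> r < K by rewrite /K; lia.
have f0 k r : r < 6 -> fl (bl a 0 k) r = false by move=> hr; rewrite fl_block ?K6 // ET.
have [Hmin _ _] := Hs.
apply: (opened_of_commit (q := q_start) (at_state_start _ _)).
- by rewrite ET.
- by rewrite ET.
- by rewrite !f0.
- by move=> k _; rewrite f0.
- by move=> k; rewrite !f0 ?Hmin.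
- by move=> k; rewrite f0.
Qed.

Lemma opened_all a : (forall b, b <w a -> s b 0 = false) -> opened a.
Proof.
elim/(well_founded_ind (wlt_wf (w := W))): a => a IH H.
have IH' b : b <w a -> opened b /\ round b.
  move=> hb; have ob : opened b by apply: IH => // b' hb'; apply: H; apply: wlt_trans hb.
  by split=> //; apply: round_of_opened => //; apply: H.
case: (wcases a) => [|[[b hb]|la]].
- exact: opened_min.
- exact: opened_succ hb IH'.
- exact: opened_lim la IH'.
Qed.

(** Some row that fires in round [b] writes the right value into cell [j], and every later write
    into this cell in the same round is right as well. *)
Lemma out_succ b a : wsucc b a -> (forall d, d <w a -> s d 0 = false) ->
  forall j, (Tp a 0 j).2 = s b (out j).
Proof.
move=> sb H j.
have IH b' : b' <w a -> opened b' /\ round b'.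
  move=> hb; have ob : opened b' by apply: opened_all => d hd; apply: H; apply: wlt_trans hb.
  by split=> //; apply: round_of_opened => //; apply: H.
have [ob rb] := IH b (proj1 sb).
have [_ HT] := Tp_lim (proj1 sb) (fun b' i hb' => let: conj o r := IH b' hb' in passes_of o r i).
apply: bool_ext; have [_ _ ->] := HT j.
have [t0 [N [h1 h2 h3]]] := completeO (s b) j.
apply: (cofinally_ev (i0 := t0.+1) sb) => i hi; cbn [fst snd].
suff -> : (Tp b i j).2 = s b (out j) by [].
elim: i hi => // -[|t] IHi // hi.
have [_ _ e1 e2] := rb t.
have [e|ne] := eqVneq t t0; first by apply: (e2 N) => //; rewrite e.
by case: (e1 j) => // ->; apply: IHi; lia.
Qed.

(** The halting test is part of the first row pass of round [a], before any write of that round;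
    hence the output is that of the state [s b]. *)
Lemma macro_halts b a : wsucc b a -> (forall d, d <w a -> s d 0 = false) -> s a 0 = true ->
  halts_with P inp (fun j => s b (out j)).
Proof.
move=> sb H s1; have oa := opened_all H.
have [_ [f2 f3 f4] [_ fA _] _] := op_RT oa.
have := @halting_pass h h6 go test setB setO (block K (Tp a 1)) q_limit (at_state_limit _ _).
rewrite f2 f3 f4 fA s1 assemble_block // => -[] // n Hn [h1 h2].
have E := run_prefix Hc (op_cf oa) Hn.
rewrite -E in h1 h2.
have -> : (fun j => s b (out j)) = tape3 (c ((a, 1), n)).
  rewrite h2 /=; apply: functional_extensionality => j.
  by rewrite -(out_succ sb H) -(op_out oa).
exact: fz_halts_with Hc h1.
Qed.

Hypothesis nonhalting : forall a, s a 0 = false.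

Lemma macro_opened a : opened a /\ round a.
Proof.
have oa : opened a by apply: opened_all.
by split=> //; apply: round_of_opened.
Qed.

Lemma macro_nonhalting v : st (c v) <> q_halt.
Proof.
move: v => [[a i] n]; have [oa ra] := macro_opened a.
have [q E Hp] := passes_of oa ra i.
by apply: (pass_nonhalting Hc E Hp (n := n)); right.
Qed.

(** The inequality [a0 <w a] is strict because round [a0] is spent on writing [y]. After that,
    writes repeat the same values, and constant cells survive limits. *)
Lemma macro_stable a0 y : (forall b, a0 <=w b -> forall j, s b (out j) = y j) ->
  forall a i n, a0 <w a -> tape3 (c ((a, i), n)) = y.
Proof.
move=> Hy.
have all_i a : a0 <=w a -> (forall j, (Tp a 0 j).2 = y j) -> forall i j, (Tp a i j).2 = y j.
  move=> ha H0 i j; have [oa ra] := macro_opened a.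
  elim: i => [|[|t] IH] //; first by rewrite (op_out oa).
  have [_ _ e _] := ra t; case: (e j) => -> //.
  exact: Hy.
have at0 a : a0 <w a -> forall j, (Tp a 0 j).2 = y j.
  elim/(well_founded_ind (wlt_wf (w := W))): a => a IH ha j.
  case: (wcases a) => [/(_ a0)//|[[b sb]|la]].
    by rewrite (out_succ sb) // Hy //; apply: wsucc_le sb ha.
  have [_ HT] := Tp_lim ha (fun b' i _ => let: conj o r := macro_opened b' in passes_of o r i).
  apply: bool_ext; have [_ _ ->] := HT j; rewrite (cofinally_lim _ la).
  apply: (cofinally_const la ha) => b hb hba.
  have e i : (Tp b i j).2 = y j by apply: all_i; [left|apply: IH].
  by split=> [[i]|ey]; [cbn [fst snd]; rewrite e|exists 0; cbn [fst snd]; rewrite e].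
move=> a i n ha; have [oa ra] := macro_opened a.
have [q E Hp] := passes_of oa ra i.
rewrite (run_pass Hc E Hp); apply: functional_extensionality => j.
have [_ /(_ j) [_ _]] := proj1 Hp n.
rewrite !all_i; try by [left|apply: at0].
by case=> /=.
Qed.
End MacroRun.
End Rounds.

(** * Scripts for sequences of open sets *)

Lemma card_le_injection (Y A : finType) : #|Y| <= #|A| -> exists f : Y -> A, injective f.
Proof.
move=> le; exists (fun y => enum_val (widen_ord le (enum_rank y))).
by move=> y y' /enum_val_inj /(congr1 val) /= e; apply: enum_rank_inj; apply: val_inj.
Qed.

Section Concatenation.
Variables (A : Type) (a0 : A) (row : nat -> seq A).
Hypothesis row0 : forall r, 0 < size (row r).

Fixpoint row_start r := if r is r'.+1 then row_start r' + size (row r') else 0.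

Lemma row_start_ge r : r <= row_start r.
Proof. by elim: r => //= r IH; have := row0 r; lia. Qed.

Lemma row_start_mono r r' : r <= r' -> row_start r <= row_start r'.
Proof. by elim: r' => [|r' IH]; [case: r|rewrite leq_eqVlt => /orP [/eqP ->|/IH /=]] => //; lia. Qed.

Lemma row_locate j : exists r, row_start r <= j < row_start r.+1.
Proof.
have ex : exists r, j < row_start r.+1 by exists j; apply: row_start_ge.
case: (ex_minnP ex) => r h1 h2; exists r; rewrite h1 andbT.
by case: r h1 h2 => // r h1 h2; case: (leqP (row_start r.+1) j) => // /h2; lia.
Qed.

Definition row_of j := xchoose (row_locate j).
Definition concat j : bool * A :=
  (j == row_start (row_of j), nth a0 (row (row_of j)) (j - row_start (row_of j))).

Lemma row_of_at r k : k < size (row r) -> row_of (row_start r + k) = r.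
Proof.
move=> hk; have /andP [h1 h2] := xchooseP (row_locate (row_start r + k)).
rewrite -/(row_of _) in h1 h2; case: (ltngtP (row_of (row_start r + k)) r) => // h.
  by have := row_start_mono h; lia.
by have := row_start_mono h => /=; lia.
Qed.

Lemma concat_at r k : k < size (row r) -> concat (row_start r + k) = (k == 0, nth a0 (row r) k).
Proof. by move=> hk; rewrite /concat row_of_at // addKn; congr pair; lia. Qed.

Lemma concat_start r : (concat (row_start r)).1.
Proof. by have := @concat_at r 0 (row0 r); rewrite addn0 => ->. Qed.

Lemma concatE j : exists r k, j = row_start r + k /\ k < size (row r).
Proof.
have [r /andP [h1 h2]] := row_locate j; exists r, (j - row_start r).
by move: h2 => /=; lia.
Qed.
End Concatenation.

Definition open_set (U : real -> Prop) : Prop :=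
  forall s, U s -> exists N, forall s', (forall k, k < N -> s k = s' k) -> U s'.

Lemma macro_iter_exists (Want : real -> nat -> Prop) (W : wo) :
  exists s : W -> real, macro_iter Want s.
Proof.
have [i c c' H|s [H0 H1 H2]] := @titer W real (fun _ => false) (fun s n => decb (Want s n))
  (fun i c n => decb (cofinally i (fun b => c b n = true))).
  apply: functional_extensionality => n; apply: bool_ext; rewrite !decbP.
  by apply: cofinally_local => j hj; rewrite H.
exists s; split=> [a ma n|b a sb n|a la n].
- by rewrite H0.
- by rewrite (H1 _ _ sb) decbP.
- by rewrite H2 // decbP.
Qed.

Section Script.
Variables (U : nat -> real -> Prop) (xreg out : nat -> nat).
Hypothesis openU : forall n, open_set (U n).

Definition want (x s : real) (n : nat) : Prop := U n s \/ exists2 j, n = xreg j & x j = true.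

(** A word of [h] bits has to encode a flag for the start of a row together with a symbol. The
    symbols name offsets below [h] and [2 * h], which makes 2 * 15 * 50 = 1500 combinations, fewer
    than 2 ^ 12. *)
Let h := 12.
Let K := 2 * h.
(** The first component is a test: none, a required state bit, or an input bit that must be 1. The
    second is an action: none, setting the next bit, or writing a bit to an output cell of the
    block. *)
Let sym : finType := (option (bool + 'I_h) * option (option ('I_K * bool)))%type.
Let sym0 : sym := (None, None).
Let code := h.-tuple bool.

Definition testok (t : option (bool + 'I_h)) (a : bool) (f : nat -> bool) : bool :=
  match t with None => true | Some (inl b) => a == b | Some (inr i) => f i end.

Definition rowmatch (x s : real) (w : seq sym) : Prop :=
  forall k, k < size w -> testok (nth sym0 w k).1 (s k) (fun i => x (h * k + i)).

Definition sound (w : seq sym) : Prop := forall x s, rowmatch x s w ->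
  forall k, k < size w ->
    ((nth sym0 w k).2 = Some None -> want x s k) /\
    (forall r v, (nth sym0 w k).2 = Some (Some (r, v)) -> s (out (K * k + r)) = v).

(** All sound rows are listed, with soundness decided classically; the list ends up in the
    parameter, so it need not be computable. Codes of anything else give the idle row [[:: sym0]],
    which is sound. *)
Definition rowseq (r : nat) : seq sym :=
  if unpickle r is Some w then if decb (0 < size w /\ sound w) then w else [:: sym0] else [:: sym0].

Lemma rowseq0 r : 0 < size (rowseq r).
Proof. by rewrite /rowseq; case: unpickle => // w; case E: decb => //; case/decbP: E. Qed.

Lemma rowseq_sound r : sound (rowseq r).
Proof.
have snd0 : sound [:: sym0] by move=> x s _ [|k].
by rewrite /rowseq; case: unpickle => // w; case E: decb => //; case/decbP: E.
Qed.

Lemma rowseq_all w : 0 < size w -> sound w -> exists r, rowseq r = w.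
Proof.
move=> w0 sw; exists (pickle w); rewrite /rowseq pickleK.
by case E: decb => //; move/negP: E; case; apply/decbP.
Qed.

Lemma sym_code : exists (enc : bool * sym -> code), injective enc.
Proof.
apply: (@card_le_injection (bool * sym)%type code).
rewrite card_tuple !card_prod !card_option card_sum card_prod !card_ord card_bool.
by [].
Qed.

Lemma script_exists : exists (go : code -> bool) (test : code -> bool -> (nat -> bool) -> bool)
    (setB : code -> bool) (setO : code -> option (nat * bool)) (base : nat -> code),
  (forall S a f g, (forall i, i < h -> f i = g i) -> test S a f = test S a g) /\
  (forall t, exists N, next_go go base t N) /\
  forall x,
  [/\ forall t N s k, fires go test base x t N s -> k < N -> setB (base (t + k)) -> want x s k,
      forall s k, want x s k ->
        exists t N, [/\ fires go test base x t N s, k < N & setB (base (t + k))],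
      forall t N s k r v, fires go test base x t N s -> k < N ->
        setO (base (t + k)) = Some (r, v) -> r < K -> s (out (K * k + r)) = v &
      forall s j, exists t N, [/\ fires go test base x t N s, j %/ K < N &
        setO (base (t + j %/ K)) = Some (j %% K, s (out j))]].
Proof.
have [enc enc_inj] := sym_code.
pose dec c : bool * sym := odflt (false, sym0) [pick y | enc y == c].
have encK y : dec (enc y) = y.
  rewrite /dec; case: pickP => [y' /eqP /enc_inj //|/(_ y)].
  by rewrite eqxx.
pose go c := (dec c).1; pose test c a f := testok (dec c).2.1 a f.
pose setB c := (dec c).2.2 == Some None.
pose setO c := if (dec c).2.2 is Some (Some (r, v)) then Some (nat_of_ord r, v) else None.
pose st := row_start rowseq.
pose base j := enc (concat sym0 rowseq0 j).
have baseE r k : k < size (rowseq r) -> dec (base (st r + k)) = (k == 0, nth sym0 (rowseq r) k).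
  by move=> hk; rewrite encK concat_at.
have go_st r : go (base (st r)) by rewrite /go encK concat_start.
have next r k : k < size (rowseq r) -> next_go go base (st r + k) (size (rowseq r) - k).
  move=> hk; split; first lia.
    have -> : st r + k + (size (rowseq r) - k) = st r.+1 by rewrite -addnA subnKC // ltnW.
    exact: go_st.
  move=> k' /andP [k1 k2]; rewrite -addnA /go baseE; last by rewrite -ltn_subRL.
  by rewrite /= -lt0n addn_gt0 k1 orbT.
have next_inj t N N' : next_go go base t N -> next_go go base t N' -> N' = N.
  move=> [h1 h2 h3] [h4 h5 h6]; case: (ltngtP N' N) => // hlt.
    by have := h3 N'; rewrite h5; lia.
  by have := h6 N; rewrite h2; lia.
have firesI x s r : rowmatch x s (rowseq r) -> fires go test base x (st r) (size (rowseq r)) s.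
  move=> H; split=> //.
    by have := next r 0 (rowseq0 r); rewrite addn0 subn0.
  by move=> k hk; rewrite /test baseE //; apply: H.
have firesE x t N s : fires go test base x t N s ->
    exists r, [/\ t = st r, N = size (rowseq r) & rowmatch x s (rowseq r)].
  move=> [g1 n1 H]; have [r [k [et hk]]] := concatE rowseq0 t.
  rewrite -/st in et; rewrite et /go baseE //= in g1; move/eqP: g1 => k0; subst k.
  rewrite addn0 in et; subst t; exists r.
  have eN : N = size (rowseq r).
    by apply: next_inj n1; have := next r 0 (rowseq0 r); rewrite addn0 subn0.
  by subst N; split=> // k hk'; have := H k hk'; rewrite /test baseE.
exists go, test, setB, setO, base; split.
  move=> S a f g H; rewrite /test /testok; case: (dec S).2.1 => [[b|i]|] //.
  exact: H.
split=> [t|x].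
  by have [r [k [et hk]]] := concatE rowseq0 t; rewrite et; exists (size (rowseq r) - k); apply: next.
split.
- move=> t N s k /firesE [r [-> -> m]] hk; rewrite /setB baseE // => /eqP e.
  by have [h1 _] := rowseq_sound m hk; apply: h1.
- move=> s k [/openU [N0 HN0]|[j -> xj]].
    (* The row prescribes at least the first [N0] bits of [s], which force [U k], and is long enough
       to set the next bit in block [k]. *)
    pose w := mkseq (fun i => (Some (inl (s i)), if i == k then Some None else None) : sym) (maxn N0 k.+1).
    have sw : size w = maxn N0 k.+1 by rewrite size_mkseq.
    have [||r Er] := @rowseq_all w; first lia.
      move=> x' s' m i hi; rewrite nth_mkseq -?sw //=; case: eqP => // -> ; split=> // _; left.
      apply: HN0 => l hl; have /(_ l) := m; rewrite sw nth_mkseq /=; last lia.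
      by move=> /(_ ltac:(lia)) /eqP.
    exists (st r), (size w); split.
    + by rewrite -Er; apply: firesI; rewrite Er => i hi; rewrite nth_mkseq -?sw //=.
    + lia.
    + rewrite /setB baseE Er ?sw; last lia.
      by rewrite nth_mkseq /= ?eqxx //; lia.
  pose m := j %/ h; have hi : j %% h < h by rewrite ltn_pmod.
  clear k; pose k := xreg j.
  (* The row tests the one input bit [x j], stored at offset [j %% h] of block [m], and sets bit
     [xreg j]. *)
  pose w := mkseq (fun i => (if i == m then Some (inr (Ordinal hi)) else None,
    if i == k then Some None else None) : sym) (maxn m k).+1.
  have sw : size w = (maxn m k).+1 by rewrite size_mkseq.
  have ej : h * m + j %% h = j by rewrite mulnC -divn_eq.
  have [||r Er] := @rowseq_all w; first lia.
    move=> x' s' mt i hi'; rewrite nth_mkseq -?sw //=; case: eqP => // ->; split=> // _; right.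
    exists j => //; have /(_ m) := mt; rewrite sw nth_mkseq ?eqxx /=; last lia.
    by rewrite ej; apply; lia.
  exists (st r), (size w); split.
  + rewrite -Er; apply: firesI; rewrite Er => i hi'; rewrite nth_mkseq -?sw //=.
    by case: eqP => // -> /=; rewrite ej.
  + by rewrite -/k; lia.
  + rewrite /setB baseE Er ?sw; last lia.
    by rewrite nth_mkseq /= ?eqxx //; lia.
- move=> t N s k r v /firesE [r' [-> -> m]] hk; rewrite /setO baseE //=.
  have [_ h1] := rowseq_sound m hk.
  case E: (nth _ _ _).2 => [[[r1 v1]|]|] // [<- <-] _.
  exact: h1.
- move=> s j; pose m := j %/ K; have hr : j %% K < K by rewrite ltn_pmod.
  pose o := out j.
  (* The row tests the present value of bit [out j] and copies this value to output cell [j]. *)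
  pose w := mkseq (fun i => (if i == o then Some (inl (s o)) else None,
    if i == m then Some (Some (Ordinal hr, s o)) else None) : sym) (maxn m o).+1.
  have sw : size w = (maxn m o).+1 by rewrite size_mkseq.
  have ej : K * m + j %% K = j by rewrite mulnC -divn_eq.
  have [||r Er] := @rowseq_all w; first lia.
    move=> x' s' mt i hi'; rewrite nth_mkseq -?sw //=; case: eqP => // ->; split=> // r' v' [<- <-] /=.
    rewrite ej; have /(_ o) := mt; rewrite sw nth_mkseq ?eqxx /=; last lia.
    by move=> H; apply/eqP; apply: H; lia.
  exists (st r), (size w); split.
  + rewrite -Er; apply: firesI; rewrite Er => i hi'; rewrite nth_mkseq -?sw //=.
    by case: eqP => // -> /=.
  + by rewrite -/m; lia.
  + rewrite /setO baseE Er ?sw; last lia.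
    by rewrite nth_mkseq /= ?eqxx //; lia.
Qed.

Lemma lex_map_initial (A B C : wo) (phi : A -> B) : initial phi ->
  initial (A := lexwo A C) (V := lexwo B C) (fun u => (phi u.1, u.2)).
Proof.
move=> Hphi; split=> [[a i] [b j] [/= hab|[/= -> hij]]|[a i] [b j] [/= hb|[/= -> hij]]].
- by left; apply: (proj1 Hphi).
- by right.
- by have [a' ha' <-] := proj2 Hphi _ _ hb; exists (a', j) => //; left.
- by exists (a, j) => //; right.
Qed.

(** Everything below programs only the iteration. In the second part [W] ranges over all orders that
    receive [W0], since the competing runs in [eventually_outputs] can be arbitrarily long. *)
Theorem macro_machine : exists (P : program) (p : real), valid_program P /\ forall x,
  (forall (W : wo) (s : W -> real), macro_iter (want x) s -> forall b a, wsucc b a ->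
     (forall d, d <w a -> s d 0 = false) -> s a 0 = true ->
     halts_with P (rpair x p) (fun j => s b (out j))) /\
  (forall y (W0 : wo) (a : W0),
     (forall (W : wo) (m : W0 -> W) (s : W -> real), monotone m -> macro_iter (want x) s ->
        (forall b, s b 0 = false) /\ (forall b, m a <=w b -> forall j, s b (out j) = y j)) ->
     eventually_outputs P (rpair x p) y).
Proof.
have [go [test [setB [setO [base [text [ngo H]]]]]]] := script_exists.
have h6 : 6 <= h by [].
exists (block_program (r0 h) (rdelta go test setB setO)), (script base); split.
  exact: block_program_valid.
move=> x; have [sB cB sO cO] := H x; split.
  move=> W s Hs b a sb N0 s1.
  have [c Hc] := fzrun_exists (block_program (r0 h) (rdelta go test setB setO))
    (rpair x (script base)) (lexwo (lexwo W natwo) natwo).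
  exact: (macro_halts h6 text ngo sB cB sO cO Hs Hc sb N0 s1).
move=> y W0 a Hy.
(* A round strictly after [a] is needed by [macro_stable]; the factor [natwo] supplies [(a, 1)]
   above [(a, 0)]. *)
pose W1 := lexwo W0 natwo.
have up (A : wo) : monotone (A := A) (V := lexwo A natwo) (fun b => (b, 0)).
  by move=> i j hij; left.
have inst (W : wo) (m : W1 -> W) : monotone m -> exists s : W -> real,
    [/\ macro_iter (want x) s, forall b, s b 0 = false &
        forall b, m (a, 0) <=w b -> forall j, s b (out j) = y j].
  move=> mm; have [s Hs] := macro_iter_exists (want x) W.
  have mm' : monotone (fun b => m (b, 0)) by move=> i j hij; apply: mm; apply: up.
  by have [h1 h2] := Hy W _ s mm' Hs; exists s.
have [c0 Hc0] := fzrun_exists (block_program (r0 h) (rdelta go test setB setO))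
  (rpair x (script base)) (lexwo (lexwo W1 natwo) natwo).
have [s0 [Hs0 N0 _]] := inst W1 id (fun _ _ h => h).
apply: (@fz_eventually _ _ _ (lexwo (lexwo W1 natwo) natwo) ((((a, 1), 0), 0)) c0 Hc0).
  by move=> v; apply: (macro_nonhalting h6 text ngo sB cB sO Hs0 Hc0 N0).
(* The sum begins with [W1] and still has room for the stages [S] of a competing run. *)
move=> S; pose W := sigwo (fun n => if n is 0 then W1 else S).
pose inl' (b : W1) : W := existT _ 0 b.
pose inr' (b : S) : W := existT _ 1 b.
have ml : monotone inl' by move=> i j hij; apply: right_lex.
have mr : monotone inr' by move=> i j hij; apply: right_lex.
have [phi Hphi] := monotone_initial ml.
exists (lexwo (lexwo W natwo) natwo), (fun u => ((phi u.1.1, u.1.2), u.2)),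
  (fun b => ((inr' b, 0), 0)); split.
- exact: (lex_map_initial natwo (lex_map_initial natwo Hphi)).
- by move=> i j hij; left; left; apply: mr.
move=> c Hc [[b i] n] hv; have [s [Hs Ns Ss]] := inst W phi (proj1 Hphi).
apply: (macro_stable h6 text ngo sB cB sO cO Hs Hc Ns (a0 := phi (a, 0)) Ss).
have h1 : phi (a, 0) <w phi (a, 1) by apply: (proj1 Hphi); right.
apply: wlt_le_trans h1 _.
by case: hv => [[/= [/= e|[/= e _]]|[/= [e _] _]]|[e _ _]]; [left|right|right|right].
Qed.
End Script.

(** * Free group actions *)
Lemma letter_eqbP l l' : letter_eqb l l' = true <-> l = l'.
Proof. by move: l l' => [[] []] [[] []]. Qed.

Lemma reduced_tail l w : reduced (l :: w) -> reduced w.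
Proof. by case: w => //= ? ? []. Qed.

Lemma push_reduced l w : reduced w -> reduced (push l w).
Proof.
case: w => [|l' w] //= H; case E: letter_eqb; first exact: reduced_tail H.
by split=> // e; move: E; rewrite (proj2 (letter_eqbP _ _) e).
Qed.

Lemma reduce_reduced w : reduced (reduce w).
Proof. by elim: w => //= l w IH; apply: push_reduced. Qed.

Lemma reduced_nseq l k : reduced (nseq k l).
Proof.
elim: k => [|[|k] IH] //=; split=> //.
by case: l {IH} => a b; rewrite /linv => -[]; case: b.
Qed.

Section Action.
Variables (X : Type) (act : letter -> X -> X).
Hypothesis actK : forall l p, act (linv l) (act l p) = p.

(** This is the action of the inverse of [w] on [p]. Coloring [w] by the color of [run_word w p]
    therefore turns the action into the left shift. *)
Fixpoint run_word (w : list letter) (p : X) : X :=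
  if w is l :: w' then run_word w' (act (linv l) p) else p.

Lemma run_word_app u v p : run_word (u ++ v)%list p = run_word v (run_word u p).
Proof. by elim: u p => //= l u IH p. Qed.

Lemma run_word_push l w p : run_word (push l w) p = run_word (l :: w) p.
Proof.
case: w => //= l' w; case E: letter_eqb => //.
by rewrite (proj1 (letter_eqbP _ _) E) actK.
Qed.

Lemma run_word_reduce w p : run_word (reduce w) p = run_word w p.
Proof. by elim: w p => //= l w IH p; rewrite run_word_push /= IH. Qed.

Lemma run_word_ginv w p : run_word (ginv w) (run_word w p) = p.
Proof.
elim: w p => //= l w IH p; rewrite /ginv /= run_word_app /= IH.
exact: actK.
Qed.

End Action.

(** * The reduction of an enumerated equivalence relation *)
Section Reduction.
Variables (E : real -> real -> Prop) (f : real -> real).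
Hypotheses (HE : equivalence_rel E) (Hf : forall x y, E x y <-> exists n, rsect (f x) n = y).

(* The graph of the partial injection sending [x] with [x l = b] to [rsect (f x) i], provided
   that [x] is recovered as [rsect (f y) j] from the image [y] and [y l = ~~ b]: domain and range
   are disjoint, so exchanging them is an involution. *)
Definition flip_idx (i j : nat) (b : bool) := if b then j else i.
Definition flip_ok i j l (x y : real) : Prop :=
  y l = ~~ x l /\ rsect (f y) (flip_idx i j (~~ x l)) = x.
Definition flip i j l (x : real) : real :=
  let y := rsect (f x) (flip_idx i j (x l)) in
  if decb (flip_ok i j l x y) then y else x.

Lemma flipK i j l x : flip i j l (flip i j l x) = x.
Proof.
rewrite {2}/flip; set y := rsect _ _; case D: decb; last first.
  by rewrite /flip -/y D.
move/decbP: D => [e1 e2]; rewrite /flip e1 e2.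
suff -> : decb (flip_ok i j l y x) by [].
by apply/decbP; split; rewrite e1 negbK.
Qed.

Lemma flip_E i j l x : E x (flip i j l x).
Proof.
rewrite /flip; case: decb; last by case: HE.
by apply/Hf; eexists.
Qed.

Lemma flip_all x y : E x y -> x <> y -> exists i j l, flip i j l x = y.
Proof.
move=> Exy ne; have [i ei] := proj1 (Hf _ _) Exy.
have [j ej] := proj1 (Hf _ _) (proj1 (proj2 HE) _ _ Exy).
have [l hl] : exists l, x l <> y l.
  apply: NNPP => N; apply: ne; apply: functional_extensionality => l.
  by apply: NNPP => nl; apply: N; exists l.
have yl : y l = ~~ x l by case: (x l) (y l) hl => -[].
(* The indices are swapped when [x l] is true, so that [flip_idx] selects [i] at [x] and [j] at
   [y]. *)
exists (if x l then j else i), (if x l then i else j), l.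
rewrite /flip; have -> : flip_idx (if x l then j else i) (if x l then i else j) (x l) = i.
  by rewrite /flip_idx; case: (x l).
rewrite ei; suff -> : decb (flip_ok (if x l then j else i) (if x l then i else j) l x y) by [].
apply/decbP; split=> //.
suff -> : flip_idx (if x l then j else i) (if x l then i else j) (~~ x l) = j by [].
by rewrite /flip_idx; case: (x l).
Qed.

Definition flips (n : nat) (x : real) : real :=
  if unpickle n is Some (i, j, l) then flip i j l x else x.

Lemma flipsK n x : flips n (flips n x) = x.
Proof. by rewrite /flips; case: unpickle => [[[i j] l]|] //; apply: flipK. Qed.

Definition point : Type := real * Z.
Definition level (m : Z) (x : real) : real := if (0 <? m)%Z then flips (Z.to_nat (m - 1)) x else x.
Definition pact (l : letter) (p : point) : point :=
  if fst l then (level p.2 p.1, p.2) else (p.1, if snd l then (p.2 - 1)%Z else (p.2 + 1)%Z).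

Lemma pactK l p : pact (linv l) (pact l p) = p.
Proof.
move: l p => [[] b] [x m]; rewrite /pact /=.
  by rewrite /level; case: Z.ltb => //; rewrite flipsK.
by congr pair; case: b => /=; lia.
Qed.

(** Negative levels are false and level 0 is true, so level 0 can be located in the coloring of a
    column. *)
Definition color (p : point) : bool :=
  if (p.2 <? 0)%Z then false else if (p.2 =? 0)%Z then true else p.1 (Z.to_nat (p.2 - 1)).

Lemma pact_E l p : E p.1 (pact l p).1.
Proof.
have [Er _] := HE; rewrite /pact; case: (fst l) => //=.
rewrite /level; case: Z.ltb => //; rewrite /flips.
by case: unpickle => [[[i j] k]|] //; apply: flip_E.
Qed.

Lemma run_word_E w p : E p.1 (run_word pact w p).1.
Proof.
have [Er [_ Et]] := HE; elim: w p => //= l w IH p.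
by apply: Et (pact_E (linv l) p) (IH _).
Qed.

Lemma run_word_up k x m : run_word pact (nseq k (false, true)) (x, m) = (x, (m + Z.of_nat k)%Z).
Proof. by elim: k m => [|k IH] m /=; [|rewrite IH]; congr pair; cbn [fst snd]; lia. Qed.

Lemma run_word_down k x m : run_word pact (nseq k (false, false)) (x, m) = (x, (m - Z.of_nat k)%Z).
Proof. by elim: k m => [|k IH] m /=; [|rewrite IH]; congr pair; cbn [fst snd]; lia. Qed.

(** The word climbs to the level of the involution that exchanges [x] and [y], applies it there, and
    climbs down. *)
Lemma word_between x y : E x y -> exists w, run_word pact w (x, 0%Z) = (y, 0%Z).
Proof.
move=> Exy; case: (classic (x = y)) => [->|ne]; first by exists [::].
have [i [j [l e]]] := flip_all Exy ne; pose n := pickle (i, j, l).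
exists (nseq n.+1 (false, true) ++ (true, true) :: nseq n.+1 (false, false))%list.
rewrite run_word_app run_word_up; cbn [run_word]; rewrite {2}/pact /=.
rewrite -[run_word pact _ _]/(run_word pact (nseq n.+1 (false, false)) _) run_word_down.
rewrite /level; have -> : (0 <? 0 + Z.of_nat n.+1)%Z = true by lia.
have -> : Z.to_nat (0 + Z.of_nat n.+1 - 1) = n by lia.
rewrite /flips /n pickleK e; congr pair; lia.
Qed.

Section Theta.
Variables (e : nat -> list letter) (he : F2_bijection e).

Definition theta (x : real) : real := fun n => color (run_word pact (e n) (x, 0%Z)).

(** Forward, a word from [(x, 0)] to [(y, 0)] yields the shifting group element. Backward, the
    coloring seen from [(y, 0)] equals the one seen from a point [(z, m0)] in the orbit of [(x, 0)];
    comparing the columns of both points forces [m0 = 0] by the marker, and then [y = z] bit by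
    bit. *)
Lemma theta_reduction x y : E x y <-> Einf e (theta x) (theta y).
Proof.
have [er [einj esurj]] := he; split.
  move=> /word_between [w Hw]; exists (reduce (ginv w)); split; first exact: reduce_reduced.
  move=> n m em; rewrite /theta em /gmul run_word_reduce; last exact: pactK.
  rewrite run_word_app.
  suff -> : run_word pact (ginv (reduce (ginv w))) (x, 0%Z) = (y, 0%Z) by [].
  have <- : run_word pact (reduce (ginv w)) (y, 0%Z) = (x, 0%Z).
    rewrite run_word_reduce; last exact: pactK.
    by rewrite -Hw run_word_ginv //; apply: pactK.
  by rewrite run_word_ginv //; apply: pactK.
move=> [g [_ Hg]]; case Ez: (run_word pact (ginv g) (x, 0%Z)) => [z m0].
have Exz : E x z by have := run_word_E (ginv g) (x, 0%Z); rewrite Ez.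
have H w : reduced w -> color (run_word pact w (y, 0%Z)) = color (run_word pact w (z, m0)).
  move=> rw; have [n en] := esurj w rw.
  have [m em] := esurj (gmul (ginv g) (e n)) (reduce_reduced _).
  have := Hg n m em; rewrite /theta em /gmul run_word_reduce; last exact: pactK.
  by rewrite run_word_app Ez en.
have H' k : color (y, k) = color (z, (m0 + k)%Z).
  have := H _ (reduced_nseq (false, true) (Z.to_nat k)).
  have := H _ (reduced_nseq (false, false) (Z.to_nat (- k))).
  rewrite !run_word_up !run_word_down.
  case: (Z.leb_spec0 0 k) => hk.
    have -> : (0 + Z.of_nat (Z.to_nat k) = k)%Z by lia.
    by have -> : (m0 + Z.of_nat (Z.to_nat k) = m0 + k)%Z by lia.
  have -> : (0 - Z.of_nat (Z.to_nat (- k)) = k)%Z by lia.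
  by have -> : (m0 - Z.of_nat (Z.to_nat (- k)) = m0 + k)%Z by lia.
have m0E : m0 = 0%Z.
  have h1 : ~ (m0 < 0)%Z.
    by move=> h; have := H' 0%Z; rewrite /color /=; have -> : (m0 + 0 <? 0)%Z = true by lia.
  have h2 : ~ (0 < m0)%Z.
    move=> h; have := H' (- m0)%Z; rewrite /color /=.
    have -> : (- m0 <? 0)%Z = true by lia.
    have -> : (m0 + - m0 <? 0)%Z = false by lia.
    by have -> : (m0 + - m0 =? 0)%Z = true by lia.
  lia.
suff -> : y = z by [].
apply: functional_extensionality => n; have := H' (Z.of_nat n.+1); rewrite m0E /color /=.
by have -> : Z.to_nat (Z.pos (Pos.of_succ_nat n) - 1) = n by lia.
Qed.
End Theta.
End Reduction.

(** * Open conditions and bit addresses *)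

Lemma open_lit i b : open_set (fun s => s i = b).
Proof. by move=> s e; exists i.+1 => s' H; rewrite -H. Qed.

Lemma open_const (R : Prop) : open_set (fun _ => R).
Proof. by move=> s r; exists 0. Qed.

Lemma open_and A B : open_set A -> open_set B -> open_set (fun s => A s /\ B s).
Proof.
move=> oA oB s [/oA [N HN] /oB [M HM]]; exists (maxn N M) => s' H.
by split; [apply: HN|apply: HM] => k hk; apply: H; lia.
Qed.

Lemma open_or A B : open_set A -> open_set B -> open_set (fun s => A s \/ B s).
Proof.
move=> oA oB s [/oA [N HN]|/oB [N HN]]; exists N => s' H; [left|right]; exact: HN.
Qed.

Lemma open_ex (I : Type) (A : I -> real -> Prop) :
  (forall i, open_set (A i)) -> open_set (fun s => exists i, A i s).
Proof. by move=> oA s [i /oA [N HN]]; exists N => s' H; exists i; apply: HN. Qed.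

(* Opaque, so that comparing two bit addresses never computes them. *)
Lemma address_coding : { cd : (nat -> nat -> nat -> nat -> nat) * (nat -> option (nat * nat * nat * nat)) |
  forall t a b c, cd.1 t a b c != 0 /\ cd.2 (cd.1 t a b c) = Some (t, a, b, c) }.
Proof.
exists (fun t a b c => (pickle (t, a, b, c)).+1, fun n => unpickle n.-1) => t a b c.
by split=> //=; rewrite pickleK.
Qed.

Definition ix := (sval address_coding).1.
Definition unix := (sval address_coding).2.

Lemma ixK t a b c : unix (ix t a b c) = Some (t, a, b, c).
Proof. by case: (svalP address_coding t a b c). Qed.

(** Address 0 stays free for the bit that makes the machine halt. *)
Lemma ix_neq0 t a b c : ix t a b c != 0.
Proof. by case: (svalP address_coding t a b c). Qed.

Lemma ix_inj t a b c t' a' b' c' : ix t a b c = ix t' a' b' c' -> [/\ t = t', a = a', b = b' & c = c'].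
Proof. by move=> /(congr1 unix); rewrite !ixK => -[-> -> -> ->]. Qed.

(** * The simulation network *)
Section Network.
Variables (P : program) (p : real) (e : nat -> list letter) (mode : bool).

(* Copy 0 simulates [P] on the input; copy [n.+1] simulates it on the [n]-th section of the
   current output of copy 0.  The tapes of a copy are stored bit by bit, its head position [bH]
   and state [bQ] in unary; [bC0] and [bC1] are both true exactly at limit stages, where the
   stored head and state are meaningless. *)
Definition bT (j n k : nat) := ix j n k 0.
Definition bH n k := ix 3 n k 0.
Definition bQ n q := ix 4 n q 0.
Definition bHL n := ix 5 n 0 0.
Definition bX j := ix 6 j 0 0.
Definition bD k := ix 7 k 0 0.
Definition bRZ := ix 8 0 0 0.
Definition bI1 := ix 9 0 0 0.
Definition bI2 := ix 10 0 0 0.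
Definition bC0 := ix 11 0 0 0.
Definition bC1 := ix 12 0 0 0.
Definition bW n i m := ix 13 n i m.
Definition bV m := ix 14 m 0 0.
Definition bOut k := ix 15 k 0 0.
Definition bN := ix 16 0 0 0.
Definition bF := ix 17 0 0 0.

Definition lim (s : real) := s bC0 = true /\ s bC1 = true.
(** Negations are written out as positive combinations of literals, so that openness can be read off
    from the syntax. *)
Definition nlim (s : real) := s bC0 = false \/ s bC1 = false.
(** All copies are held in reset until [bI2] comes on; after that only the inner copies are reset,
    whenever [bRZ] reports a change in the output of copy 0. *)
Definition rst n (s : real) := s bI2 = false \/ (n <> 0 /\ s bRZ = true).
Definition nrst n (s : real) := s bI2 = true /\ (n = 0 \/ s bRZ = false).
Definition eH n k s := (lim s /\ k = 0) \/ (nlim s /\ s (bH n k) = true).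
Definition neH n k s := (lim s /\ k <> 0) \/ (nlim s /\ s (bH n k) = false).
Definition eQ n q s := (lim s /\ q = q_limit) \/ (nlim s /\ s (bQ n q) = true).
Definition view n k q b0 b1 b2 s :=
  (eH n k s /\ eQ n q s) /\ (s (bT 0 n k) = b0 /\ s (bT 1 n k) = b1 /\ s (bT 2 n k) = b2).

Definition tq q b0 b1 b2 := fst (fst (fst (fst (trans P q b0 b1 b2)))).
Definition tw j q b0 b1 b2 := let: (_, w0, w1, w2, _) := trans P q b0 b1 b2 in
  match j with 0 => w0 | 1 => w1 | _ => w2 end.
Definition tmv q b0 b1 b2 := snd (trans P q b0 b1 b2).

Definition input n k (s : real) : Prop :=
  if Nat.even k then s (if n is m.+1 then bT 2 0 (npair m (Nat.div2 k)) else bX (Nat.div2 k)) = true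
  else p (Nat.div2 k) = true.

Definition keep j n k s :=
  (s (bHL n) = true /\ s (bT j n k) = true) \/
  (s (bHL n) = false /\ ((neH n k s /\ s (bT j n k) = true) \/
     exists q b0 b1 b2, view n k q b0 b1 b2 s /\ tw j q b0 b1 b2 = true)).

Definition xbit n k := bT 2 0 (npair n k).
Definition colorbit n (m : Z) (s : real) : Prop :=
  if (m <? 0)%Z then False else if (m =? 0)%Z then True else s (xbit n (Z.to_nat (m - 1))) = true.
(** This is the graph of [flip] on indices of sections: [b] is bit [l] of section [n], [m'] is an
    index of the candidate image, and a false [bW] bit stands for an equality. Guessing [b] and [m']
    keeps the condition open. *)
Definition flipr i j l n n' (s : real) : Prop :=
  exists b m', (s (xbit n l) = b /\ s (bW n (flip_idx i j b) m') = false) /\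
    ((s (xbit m' l) = ~~ b /\ s (bW m' (flip_idx i j (~~ b)) n) = false /\ n' = m') \/
     ((s (xbit m' l) = b \/ s (bW m' (flip_idx i j (~~ b)) n) = true) /\ n' = n)).
Definition levr (m : Z) n n' (s : real) : Prop :=
  if (0 <? m)%Z then
    if unpickle (Z.to_nat (m - 1)) is Some (i, j, l) then flipr i j l n n' s else n' = n
  else n' = n.
Fixpoint val (w : list letter) n (m : Z) (s : real) : Prop :=
  match w with
  | nil => colorbit n m s
  | l :: w' => if fst l then exists n', levr m n n' s /\ val w' n' m s
               else val w' n (if snd (linv l) then (m - 1)%Z else (m + 1)%Z) s
  end.

Definition differ i j (s : real) := (s i = true /\ s j = false) \/ (s i = false /\ s j = true).
Definition changed (s : real) := exists k, differ (bT 2 0 k) (bD k) s.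
Definition busy (s : real) := ((exists n, s (bHL n) = false) \/ changed s) \/ (s bRZ = true \/ s bI2 = false).

(** Tag 6 is absent because [want] loads those bits from the input. Tags 9 and 10 time the first
    stages. The clock bits 11 and 12 alternate between (1, 0) and (0, 1) at successor stages, so
    their limsup is (1, 1). In tag 17 the conjunct on [bI1] prevents the initial 0 of [bN] from
    being taken for completion. *)
Definition rule (t a b c : nat) (s : real) : Prop :=
  match t with
  | 0 => (rst a s /\ input a b s) \/ (nrst a s /\ keep 0 a b s)
  | 1 => nrst a s /\ keep 1 a b s
  | 2 => nrst a s /\ keep 2 a b s
  | 3 => (rst a s /\ b = 0) \/ (nrst a s /\ exists k q b0 b1 b2,
           view a k q b0 b1 b2 s /\ (if tmv q b0 b1 b2 then k.+1 else k.-1) = b)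
  | 4 => (rst a s /\ b = q_start) \/ (nrst a s /\ exists k q b0 b1 b2,
           view a k q b0 b1 b2 s /\ tq q b0 b1 b2 = b)
  | 5 => nrst a s /\ (s (bHL a) = true \/ exists k q b0 b1 b2,
           view a k q b0 b1 b2 s /\ tq q b0 b1 b2 = q_halt)
  | 7 => s (bT 2 0 a) = true
  | 8 => changed s
  | 9 => True
  | 10 => s bI1 = true
  | 11 => s bC0 = false \/ s bC1 = true
  | 12 => s bC0 = true /\ s bC1 = false
  | 13 => exists k, differ (bT 2 a.+1 (npair b k)) (bT 2 0 (npair c k)) s
  | 14 => exists k, differ (bT 2 0 (npair a k)) (bX k) s
  | 15 => exists n, s (bV n) = false /\ val (e a) n 0%Z s
  | 16 => busy s
  | 17 => s bI1 = true /\ s bN = false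
  | _ => False
  end.

Definition netU (m : nat) (s : real) : Prop :=
  if m == 0 then mode = true /\ s bF = true
  else if unix m is Some (t, a, b, c) then rule t a b c s else False.

Lemma open_val w n m : open_set (val w n m).
Proof.
elim: w n m => [|l w IH] n m /=.
  rewrite /colorbit; case: Z.ltb; first exact: open_const.
  by case: Z.eqb; [exact: open_const|exact: open_lit].
case: (fst l); last exact: IH.
apply: open_ex => n'; apply: open_and; last exact: IH.
rewrite /levr; case: Z.ltb; last exact: open_const.
case: unpickle => [[[i j] k]|]; last exact: open_const.
rewrite /flipr; repeat first [apply open_lit | apply open_const
  | apply open_and | apply open_or | apply open_ex; intros ?].
Qed.

Lemma open_input n k : open_set (input n k).
Proof. by rewrite /input; case: Nat.even; [apply: open_lit|apply: open_const]. Qed.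

Ltac openness := repeat first
  [ apply open_lit | apply open_const | apply open_input | apply open_val
  | apply open_and | apply open_or | apply open_ex; intros ? ].

Lemma open_netU m : open_set (netU m).
Proof.
rewrite /netU; case: eqP => _; first by apply: open_and; [exact: open_const|exact: open_lit].
case: (unix m) => [[[[t a] b] c]|]; last exact: open_const.
do 18?[case: t => [|t]]; rewrite /rule
  /busy /changed /differ /keep /view /eH /eQ /neH /rst /nrst /lim /nlim; openness.
Qed.
End Network.

(** * Dynamics of the network *)

Section Tail.
Variables (W : wo) (r : W).
Definition tailwo := subwo (fun u => r <w u).
Implicit Types i j : tailwo.

Lemma tail_min i : wmin i -> wsucc r (proj1_sig i).
Proof.
case: i => u hu H; split=> // k [h1 h2].
exact: (H (exist _ k h1)).
Qed.

Lemma tail_succ j i : wsucc j i -> wsucc (proj1_sig j) (proj1_sig i).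
Proof.
move=> [h1 h2]; split=> // k [h3 h4].
have hk : r <w k by apply: wlt_trans (proj2_sig j) h3.
exact: (h2 (exist _ k hk)).
Qed.

Lemma tail_lim i : wlim i -> wlim (proj1_sig i).
Proof.
move=> [[j h1] h2]; split; first by exists (proj1_sig j).
move=> k hk; case: (wltVge r k) => h.
  by have [l [h3 h4]] := h2 (exist _ k h) hk; exists (proj1_sig l).
by exists (proj1_sig j); split=> //; apply: wle_lt_trans h (proj2_sig j).
Qed.

Lemma tail_cofinally i (Q : W -> Prop) : wlim i ->
  cofinally (proj1_sig i) Q <-> cofinally i (fun j => Q (proj1_sig j)).
Proof.
move=> [[j0 h0] _]; split=> C j hj.
  have [k [h1 [h2 h3]]] := C _ hj.
  have hk : r <w k by apply: wlt_trans (proj2_sig j) h1.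
  by exists (exist _ k hk).
case: (wltVge r j) => h.
  by have [k [h1 [h2 h3]]] := C (exist _ j h) hj; exists (proj1_sig k).
have [k [h1 [h2 h3]]] := C j0 h0; exists (proj1_sig k); split=> //.
exact: wle_lt_trans h (proj2_sig k).
Qed.
End Tail.

Lemma nlimE (s : real) : nlim s <-> ~ lim s.
Proof. by rewrite /nlim /lim; case: (s bC0) (s bC1) => -[]; intuition. Qed.

Lemma nrstE n (s : real) : nrst n s <-> ~ rst n s.
Proof.
rewrite /nrst /rst; case: (s bI2) => /=; last by intuition.
case: (s bRZ); last by intuition.
case: n => [|n]; first by intuition.
by split=> [[_ []]|] // H; exfalso; apply: H; right.
Qed.

Section Dynamics.
Variables (P : program) (p : real) (e : nat -> list letter) (mode : bool) (x : real).
Variables (W : wo) (s : W -> real).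
Hypothesis Hs : macro_iter (want (netU P p e mode) bX x) s.

Lemma bit_min a n : wmin a -> s a n = false.
Proof. by case: Hs => H _ _ /H. Qed.

Lemma bit_lim a n : wlim a -> s a n = true <-> cofinally a (fun b => s b n = true).
Proof. by case: Hs => _ _ H /H. Qed.

Lemma bit_succ b a t i j k : t <> 6 -> wsucc b a ->
  s a (ix t i j k) = true <-> rule P p e t i j k (s b).
Proof.
move=> t6 sb; case: Hs => _ H _; rewrite (H _ _ sb) /want /netU (negbTE (ix_neq0 _ _ _ _)) ixK.
split=> [[//|[l /ix_inj [] //]]|]; by left.
Qed.

(** This is the tool for propagating stability: once the inputs of a rule are settled, the bit is
    settled one stage later and stays so through limits. *)
Lemma bit_tail t i j k a0 (R : Prop) : t <> 6 ->
  (forall u, a0 <=w u -> rule P p e t i j k (s u) <-> R) ->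
  forall u, a0 <w u -> s u (ix t i j k) = true <-> R.
Proof.
move=> t6 H u; elim/(well_founded_ind (wlt_wf (w := W))): u => u IH hu.
case: (wcases u) => [/(_ a0)//|[[b sb]|lu]].
  by rewrite (bit_succ _ _ _ t6 sb); apply: H; apply: wsucc_le sb hu.
by rewrite (bit_lim _ lu); apply: (cofinally_const lu hu) => l h1 h2; apply: IH.
Qed.

Lemma bit_input a0 u j : a0 <w u -> s u (bX j) = x j.
Proof.
elim/(well_founded_ind (wlt_wf (w := W))): u => u IH hu; apply: bool_ext.
case: (wcases u) => [/(_ a0)//|[[b sb]|lu]].
  case: Hs => _ H _; rewrite (H _ _ sb) /want /netU (negbTE (ix_neq0 _ _ _ _)) ixK /=.
  by split=> [[//|[l /ix_inj [_ -> _ _]]]|xj] //; right; exists j.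
by rewrite (bit_lim _ lu); apply: (cofinally_const lu hu) => l h1 h2; rewrite IH.
Qed.

Lemma bit_halt b a : wsucc b a -> s a 0 = true <-> mode = true /\ s b bF = true.
Proof.
move=> sb; case: Hs => _ H _; rewrite (H _ _ sb) /want /netU /=.
by split=> [[//|[j /esym/eqP]]|]; [rewrite (negbTE (ix_neq0 _ _ _ _))|left].
Qed.

Lemma clock_succ b a : wsucc b a -> s a bC1 = ~~ s a bC0.
Proof.
move=> sb; have h0 := bit_succ 0 0 0 (t := 11) ltac:(by []) sb.
have h1 := bit_succ 0 0 0 (t := 12) ltac:(by []) sb; rewrite /rule in h0 h1.
apply: bool_ext; rewrite h1; split.
  move=> [h2 h3]; apply/negP => /h0.
  by rewrite h2 h3 => -[].
move=> /negP N; move: N h0; case: (s b bC0) (s b bC1) => -[] N h0 //; exfalso; apply: N; apply/h0; auto.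
Qed.

Lemma clock_next b a : wsucc b a -> s a bC0 = ~~ s b bC0 || s b bC1.
Proof.
move=> sb; have h0 := bit_succ 0 0 0 (t := 11) ltac:(by []) sb.
apply: bool_ext; rewrite h0 /rule.
by case: (s b bC0) (s b bC1) => -[]; intuition.
Qed.

(** Above any stage below the limit there are two consecutive successor stages, at which the clock
    bits have opposite values; so each of the bits is 1 cofinally. *)
Lemma clock_lim a : wlim a -> lim (s a).
Proof.
move=> la; have [[_ _] la2] := la.
have nxt j : j <w a -> exists k, wsucc j k /\ k <w a.
  move=> hj; have [k [h1 h2]] := la2 j hj; have [l [h3 h4]] := wlt_has_succ h1.
  by exists l; split=> //; apply: wle_lt_trans h4 h2.
have two j : j <w a -> exists k l, [/\ j <w k, j <w l, k <w a, l <w a & s l bC0 = ~~ s k bC0 /\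
    (s k bC1 = ~~ s k bC0 /\ s l bC1 = ~~ s l bC0)].
  move=> hj; have [k [h1 h2]] := nxt j hj; have [l [h3 h4]] := nxt k h2.
  exists k, l; split=> //; [exact: (proj1 h1)|exact: wlt_trans (proj1 h1) (proj1 h3)|].
  rewrite (clock_succ h1) (clock_succ h3) (clock_next h3) (clock_succ h1).
  by case: (s k bC0).
split; apply/(bit_lim _ la) => j hj; have [k [l [h1 h2 h3 h4 [h5 [h6 h7]]]]] := two j hj.
  by case E: (s k bC0); [exists k|exists l; rewrite h5 E].
by case E: (s k bC0); [exists l; rewrite h7 h5 E|exists k; rewrite h6 E].
Qed.

Lemma succ_nlim b a : wsucc b a -> nlim (s a).
Proof. by move=> /clock_succ; rewrite /nlim => ->; case: (s a bC0); auto. Qed.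

Record enc (n : nat) (t : real) (c : config) : Prop := {
  enc_T0 : forall k, t (bT 0 n k) = tape1 c k;
  enc_T1 : forall k, t (bT 1 n k) = tape2 c k;
  enc_T2 : forall k, t (bT 2 n k) = tape3 c k;
  enc_HL : t (bHL n) = (st c == q_halt);
  enc_lim : st c <> q_halt -> lim t -> st c = q_limit /\ head c = 0;
  enc_H : st c <> q_halt -> nlim t -> forall k, t (bH n k) = (k == head c);
  enc_Q : st c <> q_halt -> nlim t -> forall q, t (bQ n q) = (q == st c) }.

Lemma enc_view n t c k q b0 b1 b2 : enc n t c -> st c <> q_halt ->
  view n k q b0 b1 b2 t <->
  [/\ k = head c, q = st c, b0 = tape1 c k, b1 = tape2 c k & b2 = tape3 c k].
Proof.
move=> En nh; rewrite /view (enc_T0 En) (enc_T1 En) (enc_T2 En).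
have -> : (eH n k t /\ eQ n q t) <-> (k = head c /\ q = st c).
  case: (classic (lim t)) => L.
    have [-> ->] := enc_lim En nh L; rewrite /eH /eQ nlimE; intuition.
  have L' : nlim t by apply/nlimE.
  rewrite /eH /eQ (enc_H En nh L') (enc_Q En nh L').
  by split=> [[[[]//|[_ /eqP ->]] [[]//|[_ /eqP ->]]]|[-> ->]] //; split; right; rewrite eqxx.
by split=> [[[-> ->] [<- [<- <-]]]|[-> -> -> -> ->]].
Qed.

Lemma enc_neH n t c k : enc n t c -> st c <> q_halt -> neH n k t <-> k <> head c.
Proof.
move=> En nh; case: (classic (lim t)) => L.
  have [_ ->] := enc_lim En nh L; rewrite /neH nlimE; intuition.
have L' : nlim t by apply/nlimE.
rewrite /neH (enc_H En nh L').
by split=> [[[]//|[_ /eqP]]|/eqP h] //; right; split=> //; apply: negbTE.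
Qed.

Section Copy.
Variables (n : nat) (r : W) (v : real).
Hypotheses (Hr : rst n (s r)) (Hn : forall u, r <w u -> nrst n (s u))
  (Hin : forall k, input p n k (s r) <-> rpair v p k = true).
Variable c : tailwo r -> config.
Hypothesis Hc : fzrun P (rpair v p) c.

Lemma keep_step t d j k : enc n t d -> st d <> q_halt -> j < 3 ->
  keep P j n k t <-> match j with 0 => tape1 | 1 => tape2 | _ => tape3 end (step P d) k = true.
Proof.
move=> En nh hj; rewrite /keep (enc_HL En) (enc_neH k En nh).
have -> : (st d == q_halt) = false by apply/eqP.
have Tj : t (bT j n k) = match j with 0 => tape1 | 1 => tape2 | _ => tape3 end d k.
  by case: j hj => [|[|[|]]] // _; rewrite ?(enc_T0 En) ?(enc_T1 En) ?(enc_T2 En).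
rewrite Tj.
have Hv : (exists q b0 b1 b2, view n k q b0 b1 b2 t /\ tw P j q b0 b1 b2 = true) <->
    k = head d /\ tw P j (st d) (tape1 d k) (tape2 d k) (tape3 d k) = true.
  split=> [[q [b0 [b1 [b2 [/(enc_view _ _ _ _ _ En nh) [-> -> -> -> ->] ?]]]]]|[e1 e2]] //.
  exists (st d), (tape1 d k), (tape2 d k), (tape3 d k); split=> //.
  by apply/(enc_view _ _ _ _ _ En nh).
rewrite Hv /step /tw.
have [eh|ne] := eqVneq k (head d).
  rewrite -eh; case: trans => -[[[q' w0] w1] w2] mv /=.
  case: j hj Tj Hv => [|[|[|]]] // _ _ _ /=; rewrite /upd PeanoNat.Nat.eqb_refl; intuition.
case: (trans P (st d) (tape1 d (head d)) _ _) => -[[[q' w0] w1] w2] mv.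
have ef : Nat.eqb k (head d) = false by apply/eqP; apply/eqP.
by case: j hj Tj Hv => [|[|[|]]] // _ _ _ /=; rewrite /upd ef; move/eqP: ne => ne; intuition.
Qed.

(** The simulated run is indexed by the stages after the last reset [r]: the successor of [r] holds
    the initial configuration, and limits of stages are limits of the simulated run. *)
Lemma copy_enc u : enc n (s (proj1_sig u)) (c u).
Proof.
elim/(well_founded_ind (wlt_wf (w := tailwo r))): u => u IH.
have nr : ~ nrst n (s r) by move/nrstE.
case: (wcases u) => [mu|[[j sj]|lu]].
- have su := tail_min mu; rewrite (fz_init Hc mu).
  have nl := succ_nlim su.
  split=> //=.
  + move=> k; apply: bool_ext; rewrite (bit_succ _ _ _ (t := 0) _ su) // /rule -Hin; intuition.
  + move=> k; apply: negbTE; apply/negP => /(bit_succ _ _ _ (t := 1) _ su) []; intuition.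
  + move=> k; apply: negbTE; apply/negP => /(bit_succ _ _ _ (t := 2) _ su) []; intuition.
  + apply: negbTE; apply/negP => /(bit_succ _ _ _ (t := 5) _ su) []; intuition.
  + by move=> _ L; move/nlimE: nl.
  + move=> _ _ k; apply: bool_ext; rewrite (bit_succ _ _ _ (t := 3) _ su) // /rule.
    by split=> [[[_ ->]|[]]|/eqP ->] //; left.
  + move=> _ _ q; apply: bool_ext; rewrite (bit_succ _ _ _ (t := 4) _ su) // /rule.
    by split=> [[[_ ->]|[]]|/eqP ->] //; left.
- have su := tail_succ sj; have En := IH j (proj1 sj).
  have nj := Hn (proj2_sig j); have nr' := proj1 (nrstE _ _) nj.
  have nl := succ_nlim su; rewrite (fz_succ Hc sj); case: eqP => [hl|nh].
    have kE i k : keep P i n k (s (proj1_sig j)) <-> s (proj1_sig j) (bT i n k) = true.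
      by rewrite /keep (enc_HL En) hl eqxx; intuition.
    split=> //=.
    + move=> k; rewrite -(enc_T0 En); apply: bool_ext.
      rewrite (bit_succ _ _ _ (t := 0) _ su) // /rule kE; intuition.
    + move=> k; rewrite -(enc_T1 En); apply: bool_ext.
      rewrite (bit_succ _ _ _ (t := 1) _ su) // /rule kE; intuition.
    + move=> k; rewrite -(enc_T2 En); apply: bool_ext.
      rewrite (bit_succ _ _ _ (t := 2) _ su) // /rule kE; intuition.
    + rewrite hl eqxx; apply/(bit_succ _ _ _ (t := 5) _ su) => //.
      by split=> //; left; rewrite (enc_HL En) hl.
  have vE (R : nat -> nat -> bool -> bool -> bool -> Prop) :
      (exists k q b0 b1 b2, view n k q b0 b1 b2 (s (proj1_sig j)) /\ R k q b0 b1 b2) <->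
      R (head (c j)) (st (c j)) (tape1 (c j) (head (c j))) (tape2 (c j) (head (c j)))
        (tape3 (c j) (head (c j))).
    split=> [[k [q [b0 [b1 [b2 [/(enc_view _ _ _ _ _ En nh) [-> -> -> -> ->] ?]]]]]]|H] //.
    do 5 eexists; split; last exact: H.
    by apply/(enc_view _ _ _ _ _ En nh).
  have stE : st (step P (c j)) = tq P (st (c j)) (tape1 (c j) (head (c j)))
      (tape2 (c j) (head (c j))) (tape3 (c j) (head (c j))).
    by rewrite /step /tq; case: trans => -[[[? ?] ?] ?] ?.
  have hdE : head (step P (c j)) = if tmv P (st (c j)) (tape1 (c j) (head (c j)))
      (tape2 (c j) (head (c j))) (tape3 (c j) (head (c j)))
      then (head (c j)).+1 else (head (c j)).-1.
    by rewrite /step /tmv; case: trans => -[[[? ?] ?] ?] ?.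
  split=> //.
  + move=> k; apply: bool_ext; rewrite (bit_succ _ _ _ (t := 0) _ su) // /rule.
    rewrite (keep_step (j := 0) k En nh) //; intuition.
  + move=> k; apply: bool_ext; rewrite (bit_succ _ _ _ (t := 1) _ su) // /rule.
    rewrite (keep_step (j := 1) k En nh) //; intuition.
  + move=> k; apply: bool_ext; rewrite (bit_succ _ _ _ (t := 2) _ su) // /rule.
    rewrite (keep_step (j := 2) k En nh) //; intuition.
  + apply: bool_ext; rewrite (bit_succ _ _ _ (t := 5) _ su) // /rule (enc_HL En).
    rewrite (vE (fun _ q b0 b1 b2 => tq P q b0 b1 b2 = q_halt)) -stE.
    by split=> [[_ [/eqP/nh []|->]]|/eqP h]; [apply: eqxx|split=> //; right].
  + by move=> _ L; move/nlimE: nl.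
  + move=> _ _ k; apply: bool_ext; rewrite (bit_succ _ _ _ (t := 3) _ su) // /rule.
    rewrite (vE (fun k' q b0 b1 b2 => (if tmv P q b0 b1 b2 then k'.+1 else k'.-1) = k)) -hdE.
    by split=> [[[/nr']//|[_ ->]]|/eqP ->]; [rewrite eqxx|right].
  + move=> _ _ q; apply: bool_ext; rewrite (bit_succ _ _ _ (t := 4) _ su) // /rule.
    rewrite (vE (fun _ q' b0 b1 b2 => tq P q' b0 b1 b2 = q)) -stE.
    by split=> [[[/nr']//|[_ ->]]|/eqP ->]; [rewrite eqxx|right].
have Lu := tail_lim lu; have LL := clock_lim Lu.
case: (classic (exists j, j <w u /\ st (c j) = q_halt)) => [[j [hj sj]]|N].
  have cst l : j <w l -> l <w u -> c l = c j.
    by move=> h1 _; apply: (fz_const Hc) => //; left.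
  have bE i (R : bool) : (forall l, l <w u -> j <w l -> s (proj1_sig l) i = R) -> s (proj1_sig u) i = R.
    move=> H; apply: bool_ext; rewrite (bit_lim _ Lu) (tail_cofinally _ lu).
    by apply: (cofinally_const lu hj) => l h1 h2; rewrite H.
  rewrite (fz_halt Hc lu hj sj); split=> //.
  + by move=> k; apply: bE => l h1 h2; rewrite (enc_T0 (IH l h1)) cst.
  + by move=> k; apply: bE => l h1 h2; rewrite (enc_T1 (IH l h1)) cst.
  + by move=> k; apply: bE => l h1 h2; rewrite (enc_T2 (IH l h1)) cst.
  + by apply: bE => l h1 h2; rewrite (enc_HL (IH l h1)) cst.
have N' j : j <w u -> st (c j) <> q_halt by move=> h1 h2; apply: N; exists j.
rewrite (fz_lim Hc lu N'); split=> //=.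
+ move=> k; apply: bool_ext; rewrite (bit_lim _ Lu) (tail_cofinally _ lu) decbP.
  by apply: cofinally_local => j hj; rewrite (enc_T0 (IH j hj)).
+ move=> k; apply: bool_ext; rewrite (bit_lim _ Lu) (tail_cofinally _ lu) decbP.
  by apply: cofinally_local => j hj; rewrite (enc_T1 (IH j hj)).
+ move=> k; apply: bool_ext; rewrite (bit_lim _ Lu) (tail_cofinally _ lu) decbP.
  by apply: cofinally_local => j hj; rewrite (enc_T2 (IH j hj)).
+ apply: negbTE; apply/negP; move/(bit_lim _ Lu)/(tail_cofinally _ lu).
  have [[j0 h0] _] := lu; move=> /(_ j0 h0) [k [_ [hk]]].
  by rewrite (enc_HL (IH k hk)) => /eqP /(N' _ hk).
+ by move=> _ /nlimE.
+ by move=> _ /nlimE.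
Qed.
End Copy.
End Dynamics.

(** If the least upper bound of [S] were outside [S], it would be a limit of members and thus belong
    to [S] by closure. *)
Lemma closed_max (W : wo) (S : W -> Prop) a b : S a -> (forall u, S u -> u <=w b) ->
  (forall u, wlim u -> a <w u -> cofinally u S -> S u) ->
  exists r, [/\ S r, a <=w r & forall u, S u -> u <=w r].
Proof.
move=> Sa Sb Scl; have [|r [Hr Hmin]] := @wleast W (fun u => forall v, S v -> v <=w u).
  by exists b.
exists r; split=> //; last exact: Hr.
apply: NNPP => nS.
have lt v : S v -> v <w r by move=> Sv; case: (Hr v Sv) => // e; rewrite e in Sv.
have above j : j <w r -> exists2 v, j <w v & S v.
  move=> hj; apply: NNPP => N; apply: (wlt_ge hj); apply: Hmin => v Sv.
  by apply: wnlt => h; apply: N; exists v.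
case: (wcases r) => [/(_ a)|[[j sj]|lr]]; first by apply; apply: lt.
  have [v h1 Sv] := above j (proj1 sj).
  by apply: (proj2 sj v); split=> //; apply: lt.
apply: nS; apply: Scl => //; first exact: lt.
by move=> j hj; have [v h1 Sv] := above j hj; exists v; do ?split=> //; apply: lt.
Qed.

Lemma differE i j (s : real) : differ i j s <-> s i <> s j.
Proof. by rewrite /differ; case: (s i) (s j) => -[]; intuition. Qed.

Lemma real_neq (x y : real) : (exists k, x k <> y k) <-> x <> y.
Proof.
split=> [[k h] e|ne]; first by rewrite e in h.
apply: NNPP => N; apply: ne; apply: functional_extensionality => k.
by apply: NNPP => h; apply: N; exists k.
Qed.

(** * Evaluation of words from stored bits *)

Section ValSpec.
Variables (E : real -> real -> Prop) (f : real -> real).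
Hypotheses (HE : equivalence_rel E) (Hf : forall x y, E x y <-> exists n, rsect (f x) n = y).
Variables (x t : real).
Let X n := rsect (f x) n.
Hypotheses (hx : forall n k, t (xbit n k) = X n k)
  (hW : forall n i m, t (bW n i m) = true <-> rsect (f (X n)) i <> X m).

Lemma hWf n i m : t (bW n i m) = false <-> rsect (f (X n)) i = X m.
Proof.
have := hW n i m; case: (t (bW n i m)) => H; split=> // h.
  by case: (proj1 H _).
by apply: NNPP => /H.
Qed.

Lemma class_closed n i : exists m, rsect (f (X n)) i = X m.
Proof.
have [_ [_ Et]] := HE.
have E1 : E x (X n) by apply/Hf; exists n.
have E2 : E (X n) (rsect (f (X n)) i) by apply/Hf; exists i.
by have [m <-] := proj1 (Hf _ _) (Et _ _ _ E1 E2); exists m.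
Qed.

Lemma flipr_sound i j l n n' : flipr i j l n n' t -> X n' = flip f i j l (X n).
Proof.
move=> [b [m' [[e1 /hWf e2] H]]]; rewrite hx in e1; rewrite /flip e1 e2 /flip_ok e1.
case D: decb; move: H; rewrite !hx.
  move/decbP: D => [d1 d2] [[_ [_ ->]] //|[[h|/hW h] _]]; last by rewrite d2 in h.
  by rewrite h in d1; move: d1; case: (b).
move=> [[h1 [/hWf h2 _]]|[_ ->] //].
by move/negP: D; case; apply/decbP.
Qed.

(** With [flipr_sound] this justifies the existential over [n'] in [val]: some index satisfies the
    relation, and every such index denotes the right real. *)
Lemma flipr_total i j l n : exists n', flipr i j l n n' t.
Proof.
have [m' em] := class_closed n (flip_idx i j (X n l)).
case: (classic (X m' l = ~~ X n l /\ rsect (f (X m')) (flip_idx i j (~~ X n l)) = X n)) => [[h1 h2]|N].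
  exists m', (X n l), m'; split; first by rewrite hx hWf.
  by left; rewrite hx hWf.
exists n, (X n l), m'; split; first by rewrite hx hWf.
right; split=> //; rewrite hx hW.
case: (classic (X m' l = X n l)) => h; [by left|right=> h2; apply: N; split=> //].
by case: (X m' l) (X n l) h => -[].
Qed.

Lemma val_spec w n m : val w n m t <-> color (run_word (pact f) w (X n, m)) = true.
Proof.
elim: w n m => [|l w IH] n m /=.
  by rewrite /colorbit /color /=; case: Z.ltb => //; case: Z.eqb => //; rewrite hx.
rewrite /pact /=; case: (fst l); last exact: IH.
have lev n' : levr m n n' t -> X n' = level f m (X n).
  rewrite /levr /level /flips; case: Z.ltb => [|-> //].
  by case: unpickle => [[[i j] k]|-> //] /flipr_sound.
split=> [[n' [/lev h1 /IH]]|]; first by rewrite h1.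
move=> H; suff [n' hn'] : exists n', levr m n n' t.
  by exists n'; split=> //; apply/IH; rewrite (lev _ hn').
rewrite /levr; case: Z.ltb; last by exists n.
by case: unpickle => [[[i j] k]|]; [apply: flipr_total|exists n].
Qed.
End ValSpec.

Lemma val_ext (t t' : real) : (forall n k, t (xbit n k) = t' (xbit n k)) ->
  (forall n i m, t (bW n i m) = t' (bW n i m)) ->
  forall w n m, val w n m t <-> val w n m t'.
Proof.
move=> h1 h2 w; elim: w => [|l w IH] n m /=; first by rewrite /colorbit h1.
case: (fst l); last exact: IH.
have lev n' : levr m n n' t <-> levr m n n' t'.
  rewrite /levr /flipr; case: Z.ltb => //; case: unpickle => [[[i j] k]|] //.
  by split=> -[b [m' H]]; exists b, m'; move: H; rewrite !h1 !h2.
by split=> -[n' [/lev h3 /IH h4]]; exists n'.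
Qed.

(** * Convergence of the network *)

Section Correctness.
Variables (P : program) (p : real) (e : nat -> list letter) (mode : bool).
Variables (E : real -> real -> Prop) (f : real -> real).
Hypotheses (HE : equivalence_rel E) (Hf : forall x y, E x y <-> exists n, rsect (f x) n = y).
Variable x : real.
Definition xs (n : nat) : real := if n is n'.+1 then rsect (f x) n' else x.

Variables (A : nat -> wo) (a0 : A 0).
Hypothesis HA : forall n (V : wo) (c : V -> config) (m : A n -> V) v,
  fzrun P (rpair (xs n) p) c -> monotone m -> (forall i, m i <=w v) -> tape3 (c v) = f (xs n).

(** Each of the countably many levels contains all the orders [A n], so that every copy has time to
    converge within any one level. *)
Definition stagewo := lexwo natwo (sigwo A).
Definition bot : sigwo A := existT _ 0 a0.

Section Stages.
Variables (W : wo) (m : stagewo -> W) (s : W -> real).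
Hypotheses (Hm : monotone m) (Hs : macro_iter (want (netU P p e mode) bX x) s).
Definition lv (k : nat) : W := m (k, bot).
Definition mA k n (a : A n) : W := m (k, existT _ n a).
Let bs := bit_succ Hs.
Let bt := bit_tail Hs.

Lemma lv_lt k k' : k < k' -> lv k <w lv k'.
Proof. by move=> h; apply: Hm; left. Qed.

Lemma mA_gt k n (a : A n) : lv k <w mA k.+1 a. Proof. by apply: Hm; left; apply: ltnSn. Qed.
Lemma mA_lt k n (a : A n) : mA k a <w lv k.+1. Proof. by apply: Hm; left; apply: ltnSn. Qed.
Lemma mA_mono k n : monotone (@mA k n).
Proof. by move=> i j h; apply: Hm; right; split=> //; apply: right_lex. Qed.

Lemma start_stages : exists o0 o1, [/\ wmin o0, wsucc o0 o1 & o1 <=w lv 1].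
Proof.
have [|o0 [_ H0]] := @wleast W (fun _ => True); first by exists (lv 0).
have mo : wmin o0 by move=> j hj; apply: (wlt_ge hj); apply: H0.
have h : o0 <w lv 1 by apply: wle_lt_trans (lv_lt (ltn0Sn 0)); apply: H0.
by have [o1 [h1 h2]] := wlt_has_succ h; exists o0, o1.
Qed.

Section Started.
Variables (o0 o1 : W).
Hypotheses (mo : wmin o0) (so : wsucc o0 o1) (ho : o1 <=w lv 1).

Lemma I1_on u : o0 <w u -> s u bI1 = true.
Proof. by move=> h; apply/(bt (R := True) (t := 9) _ _ h). Qed.

Lemma I2_on u : o1 <w u -> s u bI2 = true.
Proof.
move=> h; apply/(bt (R := True) (t := 10) _ _ h) => // v hv; rewrite /rule I1_on //.
exact: wlt_le_trans (proj1 so) hv.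
Qed.

Lemma I2_o1 : s o1 bI2 = false.
Proof.
apply: negbTE; apply/negP => h; have := proj1 (bs 0 0 0 (t := 10) ltac:(by []) so) h.
by rewrite /rule (bit_min Hs).
Qed.

(** Two levels are allowed because [lv k] is only a mark inside level [k]; it is level [k.+1] that
    lies entirely between [lv k] and [lv k.+2]. *)
Lemma copy_output n r k u : rst n (s r) -> (forall u, r <w u -> nrst n (s u)) ->
  (forall k, input p n k (s r) <-> rpair (xs n) p k = true) ->
  r <=w lv k -> lv k.+2 <=w u ->
  [/\ forall i, s u (bT 2 n i) = f (xs n) i &
    (forall (V : wo) (c : V -> config) (m : A n -> V) v, fzrun P (rpair (xs n) p) c ->
       monotone m -> (forall i, m i <=w v) -> st (c v) = q_halt) -> s u (bHL n) = true].
Proof.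
move=> h1 h2 h3 h4 h5; have [c Hc] := fzrun_exists P (rpair (xs n) p) (tailwo r).
have hu : r <w u by apply: wle_lt_trans h4 _; apply: wlt_le_trans h5; apply: lv_lt; lia.
have En := copy_enc Hs h1 h2 h3 Hc (exist _ u hu).
have hA (a : A n) : r <w mA k.+1 a by apply: wle_lt_trans h4 _; apply: mA_gt.
pose m' (a : A n) : tailwo r := exist _ (mA k.+1 a) (hA a).
have mm' : monotone m' by move=> i j hij; apply: mA_mono.
have le' i : m' i <=w (exist _ u hu : tailwo r).
  by left; apply: wlt_le_trans (mA_lt _ _) h5.
split=> [i|Hh].
  by rewrite (enc_T2 En) (HA Hc mm' le').
by rewrite (enc_HL En) (Hh _ _ _ _ Hc mm' le').
Qed.

Lemma outer_output u : lv 3 <=w u ->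
  [/\ forall i, s u (bT 2 0 i) = f x i &
    (forall (V : wo) (c : V -> config) (m : A 0 -> V) v, fzrun P (rpair x p) c ->
       monotone m -> (forall i, m i <=w v) -> st (c v) = q_halt) -> s u (bHL 0) = true].
Proof.
move=> hu; apply: (copy_output (n := 0) (r := o1) (k := 1)) => //.
- by left; apply: I2_o1.
- by move=> v hv; split; [apply: I2_on|left].
- move=> k; rewrite /input /rpair; case: Nat.even => //.
  by rewrite (bit_input Hs _ (proj1 so)).
Qed.

Lemma D_stable u k : lv 3 <w u -> s u (bD k) = f x k.
Proof.
move=> h; apply: bool_ext; apply: (bt (t := 7) _ _ h) => // v hv.
by rewrite /rule (proj1 (outer_output hv)).
Qed.

Lemma unchanged u : lv 3 <w u -> ~ changed (s u).
Proof.
move=> h [k /differE]; rewrite D_stable //.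
by rewrite (proj1 (outer_output (or_introl h))).
Qed.

Lemma RZ_off u : lv 4 <w u -> s u bRZ = false.
Proof.
move=> h; apply: negbTE; apply/negP; move/(bt (R := False) (t := 8) _ _ h); apply=> // v hv.
split=> // H; apply: (@unchanged v) => //.
by apply: wlt_le_trans hv; apply: lv_lt.
Qed.

(** Resets cease because [bRZ] is eventually off. They are closed under limits above [o1], as the
    limsup keeps [bRZ] on there; so there is a last one. *)
Lemma last_reset : exists r, [/\ rst 1 (s r), r <=w lv 5 & forall u, r <w u -> nrst 1 (s u)].
Proof.
have lv1 k : 0 < k -> o1 <=w lv k.
  by case: k => // -[//|k] _; left; apply: wle_lt_trans ho _; apply: lv_lt.
have [|u hu|u lu hu C|r [h1 h2 h3]] := @closed_max W (fun u => rst 1 (s u)) o1 (lv 5).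
- by left; apply: I2_o1.
- apply: wnlt => h; have o1u : o1 <w u by apply: wle_lt_trans (lv1 5 isT) h.
  case: hu => [|[_]]; first by rewrite I2_on.
  by rewrite RZ_off //; apply: wlt_trans h; apply: lv_lt.
- right; split=> //; apply/(bit_lim Hs _ lu) => j hj.
  have [k [k1 [k2 k3]]] : exists k, (j <w k /\ o1 <w k) /\ k <w u /\ rst 1 (s k).
    case: (wltVge j o1) => h.
      by have [k [h1 [h2 h3]]] := C o1 hu; exists k; do ?split=> //; apply: wlt_trans h h1.
    by have [k [h1 [h2 h3]]] := C j hj; exists k; do ?split=> //; apply: wle_lt_trans h h1.
  by exists k; case: k1 => k1 k4; split=> //; split=> //; case: k3 => [|[]//]; rewrite I2_on.
exists r; split=> //.
  apply: wnlt => h; have o1u : o1 <w r by apply: wle_lt_trans (lv1 5 isT) h.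
  case: h1 => [|[_]]; first by rewrite I2_on.
  by rewrite RZ_off //; apply: wlt_trans h; apply: lv_lt.
by move=> u hu; apply/nrstE => /h3 h; apply: (wlt_ge hu).
Qed.

(** The last reset may precede the known convergence of copy 0. But no change is detected after it,
    so the output of copy 0 is constant from [r] to [lv 3], where it is known to be [f x]. Hence the
    inner copies were restarted on the right inputs. *)
Lemma reset_output r : r <=w lv 5 -> (forall u, r <w u -> nrst 1 (s u)) ->
  forall k, s r (bT 2 0 k) = f x k.
Proof.
move=> hr Hn k; case: (wltVge r (lv 3)) => h; last by case: (outer_output h).
have same u : r <=w u -> u <=w lv 5 -> forall k, s u (bT 2 0 k) = s u (bD k).
  move=> h1 h2 i.
  have h6 : u <w lv 6 by apply: wle_lt_trans h2 _; apply: lv_lt.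
  have [u' [su' _]] := wlt_has_succ h6.
  have [_ [//|RZ]] := Hn u' (wle_lt_trans h1 (proj1 su')).
  apply: NNPP => ne; suff : s u' bRZ = true by rewrite RZ.
  by apply/(bs _ _ _ (t := 8) _ su') => //; exists i; apply/differE.
have const u : r <=w u -> u <=w lv 3 -> forall k, s u (bT 2 0 k) = s r (bT 2 0 k).
  elim/(well_founded_ind (wlt_wf (w := W))): u => u IH [h1|<- //] h2 i.
  have h25 : u <=w lv 5 by left; apply: wle_lt_trans h2 _; apply: lv_lt.
  case: (wcases u) => [/(_ r)//|[[b sb]|lu]].
    have hb : r <=w b by apply: wsucc_le sb h1.
    rewrite same //; last by left.
    rewrite -(IH b (proj1 sb) hb); last by left; apply: wlt_le_trans (proj1 sb) h2.
    by apply: bool_ext; apply: (bs _ _ _ (t := 7) _ sb).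
  apply: bool_ext; rewrite (bit_lim Hs _ lu); apply: (cofinally_const lu h1) => l h3 h4.
  by rewrite IH //; left=> //; apply: wlt_le_trans h4 h2.
have h33 : lv 3 <=w lv 3 by right.
by rewrite -(const (lv 3) (or_introl h) h33); case: (outer_output h33).
Qed.

Lemma inner_output n u : lv 7 <=w u ->
  [/\ forall i, s u (bT 2 n.+1 i) = f (xs n.+1) i &
    (forall (V : wo) (c : V -> config) (m : A n.+1 -> V) v, fzrun P (rpair (xs n.+1) p) c ->
       monotone m -> (forall i, m i <=w v) -> st (c v) = q_halt) -> s u (bHL n.+1) = true].
Proof.
move=> hu; have [r [h1 h2 h3]] := last_reset.
apply: (copy_output (r := r) (k := 5)) => //.
- by case: h1 => [|[_]]; [left|right].
- by move=> v /h3 [h4 [//|h5]]; split=> //; right.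
- by move=> k; rewrite /input /rpair; case: Nat.even => //; rewrite (reset_output h2 h3).
Qed.

Lemma W_stable u n i k : lv 7 <w u ->
  s u (bW n i k) = true <-> rsect (f (xs n.+1)) i <> xs k.+1.
Proof.
move=> h; rewrite -real_neq; apply: (bt (t := 13) _ _ h) => // v hv.
have h3 : lv 3 <=w v by left; apply: wlt_le_trans hv; apply: lv_lt.
by split=> -[j /= H]; exists j; move: H;
  rewrite differE (proj1 (outer_output h3)) (proj1 (inner_output n hv)).
Qed.

Lemma V_stable u k : lv 7 <w u -> s u (bV k) = true <-> xs k.+1 <> x.
Proof.
move=> h; rewrite -real_neq; apply: (bt (t := 14) _ _ h) => // v hv.
have h3 : lv 3 <=w v by left; apply: wlt_le_trans hv; apply: lv_lt.
have hx j : s v (bX j) = x j.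
  by apply: (bit_input Hs (a0 := lv 6)); apply: wlt_le_trans hv; apply: lv_lt.
by split=> -[j /= H]; exists j; move: H; rewrite differE (proj1 (outer_output h3)) hx.
Qed.

(** The levels add up: copy 0 has settled by [lv 3], resets are over by [lv 5], the inner copies
    have settled by [lv 7], the comparison bits by [lv 8], and the output by [lv 9]. *)
Lemma out_stable u k : lv 9 <=w u -> s u (bOut k) = theta f e x k.
Proof.
move=> hu; have h8 : lv 8 <w u by apply: wlt_le_trans hu; apply: lv_lt.
apply: bool_ext; apply: (bt (t := 15) _ _ h8) => // v hv; rewrite /rule.
have h7 : lv 7 <w v by apply: wlt_le_trans hv; apply: lv_lt.
have h3 : lv 3 <=w v by left; apply: wlt_trans h7; apply: lv_lt.
have VS n := @val_spec E f HE Hf x (s v) (fun n k => proj1 (outer_output h3) _)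
  (fun n i m => W_stable n i m h7) (e k) n 0%Z.
have Vf n : s v (bV n) = false <-> xs n.+1 = x.
  have := V_stable n h7; case: (s v (bV n)) => H; split=> // h'; first by case: (proj1 H _).
  by apply: NNPP => /H.
rewrite /theta; split=> [[n [/Vf h1 /VS]]|H]; first by rewrite (h1 : rsect (f x) n = x).
have [n en] : exists n, rsect (f x) n = x by apply/Hf; case: HE.
by exists n; split; [apply/Vf|apply/VS; rewrite en].
Qed.

Hypothesis halts : forall n (V : wo) (c : V -> config) (m : A n -> V) v,
  fzrun P (rpair (xs n) p) c -> monotone m -> (forall i, m i <=w v) -> st (c v) = q_halt.

Lemma not_busy u : lv 7 <=w u -> ~ busy (s u).
Proof.
move=> hu; have h37 : lv 3 <w u by apply: wlt_le_trans hu; apply: lv_lt.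
have h47 : lv 4 <w u by apply: wlt_le_trans hu; apply: lv_lt.
have o1u : o1 <w u by apply: wle_lt_trans ho _; apply: wlt_le_trans hu; apply: lv_lt.
move=> [[[[|n]]|]|[|]].
- by have [_ ->] := outer_output (or_introl h37); [|move=> V c m' v; apply: (halts (n := 0))].
- by have [_ ->] := inner_output n hu; [|move=> V c m' v; apply: halts].
- exact: unchanged.
- by rewrite RZ_off.
- by rewrite I2_on.
Qed.

Lemma halt_bit : mode = true -> exists u, s u 0 = true.
Proof.
move=> md; have N u : lv 7 <w u -> s u bN = false.
  move=> h; apply: negbTE; apply/negP; move/(bt (R := False) (t := 16) _ _ h); apply=> // v hv.
  by split=> // /(not_busy hv).
have F u : lv 8 <w u -> s u bF = true.
  move=> h; apply/(bt (R := True) (t := 17) _ _ h) => // v hv.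
  have h7 : lv 7 <w v by apply: wlt_le_trans hv; apply: lv_lt.
  rewrite /rule N // I1_on //; apply: wlt_trans (proj1 so) _; apply: wle_lt_trans ho _.
  by apply: wlt_trans h7; apply: lv_lt.
have [u [su _]] := wlt_has_succ (lv_lt (ltnSn 9)).
by exists u; apply/(bit_halt Hs su); split=> //; apply: F; apply: lv_lt.
Qed.
End Started.

Lemma out_eventually u k : lv 9 <=w u -> s u (bOut k) = theta f e x k.
Proof. by have [o0 [o1 [h1 h2 h3]]] := start_stages; apply: (out_stable h1 h2 h3). Qed.

Lemma halt_eventually : mode = true ->
  (forall n (V : wo) (c : V -> config) (m : A n -> V) v,
    fzrun P (rpair (xs n) p) c -> monotone m -> (forall i, m i <=w v) -> st (c v) = q_halt) ->
  exists u, s u 0 = true.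
Proof. by have [o0 [o1 [h1 h2 h3]]] := start_stages => md hl; apply: (halt_bit h1 h2 h3). Qed.
End Stages.

(** * Soundness of the halting criterion *)

Section Frozen.
Variables (W : wo) (s : W -> real).
Hypothesis Hs : macro_iter (want (netU P p e mode) bX x) s.
Let bs := bit_succ Hs.
Let bt := bit_tail Hs.

Lemma I1_nonmin o u : o <w u -> s u bI1 = true.
Proof. by move=> h; apply/(bt (R := True) (t := 9) _ _ h). Qed.

(** When every copy has halted, the output of copy 0 agrees with its stored previous value and no
    reset is pending, each rule reproduces this situation, and limits preserve it. *)
Lemma frozen t u : ~ busy (s t) -> t <=w u -> ~ busy (s u) /\ forall n k, s u (bT 2 n k) = s t (bT 2 n k).
Proof.
move=> nb tu.
have unb v : ~ busy (s v) <-> [/\ forall n, s v (bHL n) = true, forall k, s v (bT 2 0 k) = s v (bD k),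
    s v bRZ = false & s v bI2 = true].
  split=> [H|[h1 h2 h3 h4]].
    split.
    - by move=> n; apply: NNPP => /negP/negbTE h; apply: H; left; left; exists n.
    - by move=> k; apply: NNPP => h; apply: H; left; right; exists k; apply/differE.
    - by apply: negbTE; apply/negP => h; apply: H; right; left.
    - by apply: NNPP => /negP/negbTE h; apply: H; right; right.
  move=> [[[n]|[k /differE]]|[|]]; [by rewrite h1|by rewrite h2|by rewrite h3|by rewrite h4].
have [t1 t2 t3 t4] := proj1 (unb t) nb.
have [o ho] : exists o, o <w t.
  apply: NNPP => N; suff : s t bI2 = false by rewrite t4.
  by apply: (bit_min Hs) => j hj; apply: N; exists j.
rewrite unb; elim/(well_founded_ind (wlt_wf (w := W))): u tu => u IH [h1|<- //].
case: (wcases u) => [/(_ t)//|[[b sb]|lu]].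
  have hb : t <=w b by apply: wsucc_le sb h1.
  have [[i1 i2 i3 i4] i5] := IH b (proj1 sb) hb.
  have nr n : nrst n (s b) by split=> //; right.
  have nr' n : ~ rst n (s b) by apply/nrstE.
  have T2 n k : s u (bT 2 n k) = s b (bT 2 n k).
    apply: bool_ext; rewrite (bs _ _ _ (t := 2) _ sb) // /rule /keep i1.
    by split=> [[_ [[]|[]]]|] //; split=> //; left.
  split; last by move=> n k; rewrite T2.
  split.
  - by move=> n; apply/(bs _ _ _ (t := 5) _ sb) => //; split=> //; left.
  - by move=> k; rewrite T2; apply: bool_ext; rewrite (bs _ _ _ (t := 7) _ sb).
  - apply: negbTE; apply/negP => h.
    by have [k /differE] := proj1 (bs 0 0 0 (t := 8) ltac:(by []) sb) h; rewrite i2.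
  - by apply/(bs _ _ _ (t := 10) _ sb) => //; apply: (I1_nonmin (o := o)); apply: wlt_le_trans ho hb.
have bE i (R : bool) : (forall l, t <w l -> l <w u -> s l i = R) -> s u i = R.
  move=> H; apply: bool_ext; rewrite (bit_lim Hs _ lu).
  by apply: (cofinally_const lu h1) => l k1 k2; rewrite H.
have IH' l : t <w l -> l <w u -> _ := fun k1 k2 => IH l k2 (or_introl k1).
have T2 n k : s u (bT 2 n k) = s t (bT 2 n k).
  by apply: bE => l k1 k2; have [_ ->] := IH' l k1 k2.
split=> //; split.
- by move=> n; apply: bE => l k1 k2; have [[-> _ _ _] _] := IH' l k1 k2.
- move=> k; rewrite T2; symmetry; apply: bE => l k1 k2.
  by have [[_ <- _ _] ->] := IH' l k1 k2.
- by apply: bE => l k1 k2; have [[_ _ -> _] _] := IH' l k1 k2.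
- by apply: bE => l k1 k2; have [[_ _ _ ->] _] := IH' l k1 k2.
Qed.

Lemma N_off_frozen b : s b bN = false -> s b bI1 = true -> exists t, t <w b /\ ~ busy (s t).
Proof.
elim/(well_founded_ind (wlt_wf (w := W))): b => b IH hN hI.
case: (wcases b) => [mb|[[a sa]|lb]]; first by rewrite (bit_min Hs _ mb) in hI.
  exists a; split; first by case: sa.
  move=> hb; suff : s b bN = true by rewrite hN.
  exact/(bs _ _ _ (t := 16) _ sa).
have [j hj Hj] : exists2 j, j <w b & forall k, j <w k -> k <w b -> s k bN = false.
  apply: NNPP => M; suff : s b bN = true by rewrite hN.
  apply/(bit_lim Hs _ lb) => j hj; apply: NNPP => M'; apply: M; exists j => // k k1 k2.
  by apply: negbTE; apply/negP => h; apply: M'; exists k.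
have [k [k1 k2]] := proj2 lb j hj.
have [t [t1 t2]] := IH k k2 (Hj _ k1 k2) (I1_nonmin k1).
by exists t; split=> //; apply: wlt_trans t1 k2.
Qed.

(** Two stages are provided because the comparison bits are fixed only after [t], and the output
    bits computed from them only after [t']. *)
Lemma F_frozen b : s b bF = true -> exists t t', [/\ ~ busy (s t), t <w t' & t' <w b].
Proof.
elim/(well_founded_ind (wlt_wf (w := W))): b => b IH hF.
case: (wcases b) => [mb|[[a sa]|lb]]; first by rewrite (bit_min Hs _ mb) in hF.
  have [h1 h2] := proj1 (bs 0 0 0 (t := 17) ltac:(by []) sa) hF.
  have [t [t1 t2]] := N_off_frozen h2 h1.
  by exists t, a; split=> //; case: sa.
have [[j hj] _] := lb; have [k [k1 [k2 k3]]] := proj1 (bit_lim Hs _ lb) hF j hj.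
have [t [t' [h1 h2 h3]]] := IH k k2 k3.
by exists t, t'; split=> //; apply: wlt_trans h3 k2.
Qed.

(** The network may raise [bF] before the levels of the convergence estimate are reached; this lemma
    transports the output to those later stages. *)
Lemma out_frozen b u k : s b bF = true -> b <=w u -> s u (bOut k) = s b (bOut k).
Proof.
move=> /F_frozen [t [t' [nb tt' t'b]]] bu.
have fr v : t <=w v -> forall n k, s v (bT 2 n k) = s t (bT 2 n k).
  by move=> h; case: (frozen nb h).
have [o ho] : exists o, o <w t.
  apply: NNPP => N; apply: nb; right; right.
  by apply: (bit_min Hs) => j hj; apply: N; exists j.
have W_t v n i j : t <w v -> s v (bW n i j) = true <-> rule P p e 13 n i j (s t).
  move=> h; apply: (bt (t := 13) _ _ h) => // w hw; rewrite /rule.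
  by split=> -[l H]; exists l; move: H; rewrite !differE !(fr w hw).
have V_t v j : t <w v -> s v (bV j) = true <-> rule P p e 14 j 0 0 (s t).
  move=> h; apply: (bt (t := 14) _ _ h) => // w hw; rewrite /rule.
  have hX l : s w (bX l) = s t (bX l).
    by rewrite !(bit_input Hs (a0 := o)) //; apply: wlt_le_trans ho hw.
  by split=> -[l H]; exists l; move: H; rewrite !differE !(fr w hw) hX.
have main v : t' <w v -> s v (bOut k) = true <-> rule P p e 15 k 0 0 (s t').
  move=> h; apply: (bt (t := 15) _ _ h) => // w hw; rewrite /rule.
  have tw : t <w w by apply: wlt_le_trans tt' hw.
  have eV n : s w (bV n) = s t' (bV n) by apply: bool_ext; rewrite !V_t.
  have VE n : val (e k) n 0 (s w) <-> val (e k) n 0 (s t').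
    apply: val_ext => *; first by rewrite /xbit !fr //; left.
    by apply: bool_ext; rewrite !W_t.
  by split=> -[n [h1 h2]]; exists n; rewrite eV in h1 *; split=> //; apply/VE.
by apply: bool_ext; rewrite !main //; apply: wlt_le_trans t'b bu.
Qed.
End Frozen.
End Correctness.

(** * Enumerability of the shift equivalence relation *)

Lemma triangle_succ w : Nat.div (Nat.mul w.+1 (Nat.add w.+1 1)) 2 =
  Nat.div (Nat.mul w (Nat.add w 1)) 2 + w.+1.
Proof.
have -> : Nat.mul w.+1 (Nat.add w.+1 1) = Nat.add (Nat.mul w (Nat.add w 1)) (Nat.mul w.+1 2) by lia.
by rewrite PeanoNat.Nat.div_add.
Qed.

(** The values on diagonal [w] lie between [T w] and [T w + w], which is below [T w.+1], so
    different diagonals do not meet. *)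
Lemma npair_inj n k n' k' : npair n k = npair n' k' -> n = n' /\ k = k'.
Proof.
pose T w := Nat.div (Nat.mul w (Nat.add w 1)) 2.
have TS w : T w.+1 = T w + w.+1 by apply: triangle_succ.
have Tm w w' : w < w' -> T w + w < T w'.
  by elim: w' => // w' IH; rewrite ltnS leq_eqVlt => /orP [/eqP ->|/IH]; rewrite TS; lia.
have E a b : npair a b = T (a + b) + b by [].
rewrite !E => e; case: (ltngtP (n + k) (n' + k')) => h.
- by have := Tm _ _ h; lia.
- by have := Tm _ _ h; lia.
- by rewrite h in e; lia.
Qed.

Section Universal.
Variables (e : nat -> list letter) (he : F2_bijection e).

(** Reading [x] at [pos] makes section [n] the translate of [x] by [e n], so an enumeration of the
    class is a mere rearrangement of the bits of [x]. *)
Lemma Einf_translation : exists pos : nat -> nat,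
  forall n k, e (pos (npair n k)) = gmul (ginv (e n)) (e k).
Proof.
have [er [einj esurj]] := he.
pose R c m := forall n k, c = npair n k -> e m = gmul (ginv (e n)) (e k).
exists (fun c => epsilon (inhabits 0) (R c)) => n k.
apply: (epsilon_spec (inhabits 0) (R (npair n k))) => //.
have [m em] := esurj (gmul (ginv (e n)) (e k)) (reduce_reduced _).
by exists m => n' k' /npair_inj [<- <-].
Qed.

Lemma Einf_it_enumerable : it_enumerable (Einf e).
Proof.
have [pos Hpos] := Einf_translation.
(* Bit 1 is on from stage 1 and raises the halting bit 0 at stage 2. The output is then taken from
   stage 1, where bit [j.+2] holds [x j]. *)
pose U n (s : real) := (n = 0 /\ s 1 = true) \/ n = 1.
have oU n : open_set (U n).
  apply: open_or; last exact: open_const.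
  by apply: open_and; [exact: open_const|exact: open_lit].
have [P [p [vP H]]] := @macro_machine U (fun j => j.+2) (fun c => (pos c).+2) oU.
exists (fun x c => x (pos c)); split.
  exists P, p; split=> // x; have [H1 _] := H x.
  have [s Hs] := macro_iter_exists (want U (fun j => j.+2) x) natwo.
  have [s0 s1 _] := Hs.
  have m0 : wmin (0 : natwo) by move=> j; rewrite /wlt /=; lia.
  have sc (n : natwo) : wsucc n (n.+1 : natwo).
    by split=> [|k []]; rewrite /wlt /=; lia.
  have b0 n : s 0 n = false by apply: s0.
  have b1 n : s 1 n = true <-> want U (fun j => j.+2) x (s 0) n by apply: (s1 _ _ (sc 0)).
  have b2 n : s 2 n = true <-> want U (fun j => j.+2) x (s 1) n by apply: (s1 _ _ (sc 1)).
  have e1 j : s 1 j.+2 = x j.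
    apply: bool_ext; rewrite b1; split=> [[[[]|]//|[j' [->]]]|xj] //.
    by right; exists j.
  have -> : (fun c => x (pos c)) = (fun c => s 1 (pos c).+2).
    by apply: functional_extensionality => c; rewrite e1.
  apply: (H1 natwo s Hs 1 2 (sc 1)).
    move=> [|[|d]] hd; [exact: b0| |by move: hd; rewrite /wlt /=; lia].
    apply: negbTE; apply/negP => /b1 [[[_]|//]|[j //]].
    by rewrite b0.
  by apply/b2; left; left; split=> //; apply/b1; left; right.
have [er [einj esurj]] := he.
move=> x y; split=> [[g [rg Hg]]|[n <-]].
  have [n en] := esurj g rg; exists n; apply: functional_extensionality => k.
  by rewrite /rsect; symmetry; apply: Hg; rewrite Hpos en.
exists (e n); split=> // k m em; rewrite /rsect; congr (x _); apply: einj.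
by rewrite Hpos em.
Qed.

Lemma it_enumerable_ev E : it_enumerable E -> ev_enumerable E.
Proof.
move=> [f [[P [p [vP H]]] Hf]]; exists f; split=> //; exists P, p; split=> // x.
exact: halts_eventually.
Qed.

(** * Computability of the reduction *)

Section Reductions.
Variables (E : real -> real -> Prop) (f : real -> real).
Hypotheses (HE : equivalence_rel E) (Hf : forall x y, E x y <-> exists n, rsect (f x) n = y).

(** The halting times of [f] on [x] and on all members of [f x] are assembled into [stagewo A], over
    which bit 0 does come on. Its first stage is a successor, since at a limit the bit would have
    been on before. *)
Lemma theta_it_computable : it_computable f -> it_computable (theta f e).
Proof.
move=> [P0 [p0 [_ Hh]]].
have [P [p [vP H]]] := macro_machine bX bOut (@open_netU P0 p0 e true).
exists P, p; split=> // x; have [H1 _] := H x.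
have HA n := halts_with_fz (Hh (xs f x n)).
pose A n := proj1_sig (constructive_indefinite_description _ (HA n)).
have [[a0] _] := proj2_sig (constructive_indefinite_description _ (HA 0)).
have HA1 n (V : wo) (c : V -> config) (m : A n -> V) v : fzrun P0 (rpair (xs f x n) p0) c ->
    monotone m -> (forall i, m i <=w v) -> st (c v) = q_halt /\ tape3 (c v) = f (xs f x n).
  by have [_ h] := proj2_sig (constructive_indefinite_description _ (HA n)); apply: h.
have HA2 n (V : wo) (c : V -> config) (m : A n -> V) v : fzrun P0 (rpair (xs f x n) p0) c ->
    monotone m -> (forall i, m i <=w v) -> tape3 (c v) = f (xs f x n).
  by move=> h1 h2 h3; case: (HA1 n V c m v h1 h2 h3).
have HA3 n (V : wo) (c : V -> config) (m : A n -> V) v : fzrun P0 (rpair (xs f x n) p0) c ->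
    monotone m -> (forall i, m i <=w v) -> st (c v) = q_halt.
  by move=> h1 h2 h3; case: (HA1 n V c m v h1 h2 h3).
pose W := stagewo A.
have [s Hs] := macro_iter_exists (want (netU P0 p0 e true) bX x) W.
have mid : monotone (fun u : W => u) by [].
have hex := halt_eventually a0 HA2 mid Hs erefl HA3.
have [a [sa amin]] := wleast hex.
have below d : d <w a -> s d 0 = false.
  by move=> hd; apply: negbTE; apply/negP => sd; apply: (wlt_ge hd); apply: amin.
have [b sb] : exists b, wsucc b a.
  case: (wcases a) => [ma|[//|la]]; first by rewrite (bit_min Hs) in sa.
  have [[j hj] _] := la; have [k [_ [k2 k3]]] := proj1 (bit_lim Hs _ la) sa j hj.
  by rewrite below in k3.
have [_ Fb] := proj1 (bit_halt Hs sb) sa.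
suff -> : theta f e x = (fun j => s b (bOut j)) by exact: (H1 W s Hs b a sb below sa).
apply: functional_extensionality => j.
have out := out_eventually HE Hf (a0 := a0 : A 0) HA2 mid Hs.
(* If the halt comes before level 9, the output bits are frozen from [b] on and so agree with those
   at level 9. *)
case: (wltVge b (lv a0 (fun u : W => u) 9)) => h.
  by rewrite -(out_frozen Hs j Fb (or_introl h)) out //; right.
by rewrite out.
Qed.

(** With [mode] false bit 0 never comes on, so the iteration runs forever and the estimate at level
    9 gives the permanent output. *)
Lemma theta_ev_computable : ev_computable f -> ev_computable (theta f e).
Proof.
move=> [P0 [p0 [_ Hh]]].
have [P [p [vP H]]] := macro_machine bX bOut (@open_netU P0 p0 e false).
exists P, p; split=> // x; have [_ H2] := H x.
have HA n := eventually_fz (Hh (xs f x n)).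
pose A n := proj1_sig (constructive_indefinite_description _ (HA n)).
have [[a0] _] := proj2_sig (constructive_indefinite_description _ (HA 0)).
have HA2 n (V : wo) (c : V -> config) (m : A n -> V) v : fzrun P0 (rpair (xs f x n) p0) c ->
    monotone m -> (forall i, m i <=w v) -> tape3 (c v) = f (xs f x n).
  by have [_ h] := proj2_sig (constructive_indefinite_description _ (HA n)); apply: h.
apply: (H2 _ (stagewo A) (9, bot a0)) => W m s mm Hs; split; last first.
  by move=> b hb j; apply: (out_eventually HE Hf (a0 := a0 : A 0) HA2 mm Hs).
move=> b; elim/(well_founded_ind (wlt_wf (w := W))): b => b IH.
case: (wcases b) => [mb|[[a sa]|lb]]; first exact: (bit_min Hs).
  by apply: negbTE; apply/negP => /(bit_halt Hs sa) [].
apply: negbTE; apply/negP => /(bit_lim Hs _ lb) C.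
have [[j hj] _] := lb; have [k [_ [k2 k3]]] := C j hj.
by rewrite IH in k3.
Qed.
End Reductions.
End Universal.

Theorem mainTheorem10 (e : nat -> list letter) (he : F2_bijection e) :
  it_enumerable (Einf e) /\
  (forall E, equivalence_rel E -> it_enumerable E -> reduces_c E (Einf e)) /\
  ev_enumerable (Einf e) /\
  (forall E, equivalence_rel E -> ev_enumerable E -> reduces_e E (Einf e)).
Proof.
split; first exact: Einf_it_enumerable.
split.
  move=> E HE [f [cf Hf]]; exists (theta f e); split; first exact: (theta_it_computable e HE Hf).
  by move=> x y; apply: (theta_reduction HE Hf).
split; first by apply: it_enumerable_ev; apply: Einf_it_enumerable.
move=> E HE [f [cf Hf]]; exists (theta f e); split; first exact: (theta_ev_computable e HE Hf).
by move=> x y; apply: (theta_reduction HE Hf).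
Qed.
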